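(* Let $\mathbb K$ be an algebraically closed field, $n\ge2$, $r,s\in\mathbb K$ nonzero, $r\ne s$, and $\widetilde U=U_{r,s}(\mathfrak{gl}_n)$. For modules $N,N'$ in the category $\mathcal O$ let $R_{N,N'}=\Theta\circ\widetilde f\circ P:N\otimes N'\to N'\otimes N$. Then for all $M,M',M''$ in $\mathcal O$ the quantum Yang--Baxter equation holds: $$R_{12}\circ R_{23}\circ R_{12}=R_{23}\circ R_{12}\circ R_{23}$$ as maps from $M\otimes M'\otimes M''$ to $M''\otimes M'\otimes M$, where $R_{12}$ (resp. $R_{23}$) denotes the map $R$ for the appropriate pair of modules applied to the first two (resp. last two) tensor factors and the identity on the remaining factor.
   Context: Let $\epsilon_1,\dots,\epsilon_n$ be an orthonormal basis of $\mathbb R^n$ with inner product $\langle\,,\rangle$, $\alpha_j=\epsilon_j-\epsilon_{j+1}$ for $1\le j<n$, $\alpha_n=\epsilon_n$, $\Lambda=\bigoplus_{i=1}^n\mathbb Z\epsilon_i=\bigoplus_{i=1}^n\mathbb Z\alpha_i$, $Q^+=\sum_{i=1}^{n-1}\mathbb Z_{\ge0}\alpha_i$. $\widetilde U=U_{r,s}(\mathfrak{gl}_n)$ is the unital associative $\mathbb K$-algebra generated by $e_j,f_j$ ($1\le j<n$), $a_i^{\pm1},b_i^{\pm1}$ ($1\le i\le n$) with relations: (R1) the $a_i^{\pm1},b_j^{\pm1}$ all commute and $a_ia_i^{-1}=b_jb_j^{-1}=1$; (R2) $a_ie_j=r^{\langle\epsilon_i,\alpha_j\rangle}e_ja_i$,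 $a_if_j=r^{-\langle\epsilon_i,\alpha_j\rangle}f_ja_i$; (R3) $b_ie_j=s^{\langle\epsilon_i,\alpha_j\rangle}e_jb_i$, $b_if_j=s^{-\langle\epsilon_i,\alpha_j\rangle}f_jb_i$; (R4) $[e_i,f_j]=\frac{\delta_{i,j}}{r-s}(a_ib_{i+1}-a_{i+1}b_i)$; (R5) $[e_i,e_j]=[f_i,f_j]=0$ if $|i-j|>1$; (R6) $e_i^2e_{i+1}-(r+s)e_ie_{i+1}e_i+rs\,e_{i+1}e_i^2=0$, $e_ie_{i+1}^2-(r+s)e_{i+1}e_ie_{i+1}+rs\,e_{i+1}^2e_i=0$; (R7) $f_i^2f_{i+1}-(r^{-1}+s^{-1})f_if_{i+1}f_i+r^{-1}s^{-1}f_{i+1}f_i^2=0$, $f_if_{i+1}^2-(r^{-1}+s^{-1})f_{i+1}f_if_{i+1}+r^{-1}s^{-1}f_{i+1}^2f_i=0$. With $\omega_j=a_jb_{j+1}$, $\omega_j'=a_{j+1}b_j$, it is a Hopf algebra with $a_i^{\pm1},b_i^{\pm1}$ group-like, $\Delta(e_i)=e_i\otimes1+\omega_i\otimes e_i$, $\Delta(f_i)=1\otimes f_i+f_i\otimes\omega_i'$, $\varepsilon(e_i)=\varepsilon(f_i)=0$. Pairing: $\widetilde B$ is the Hopf subalgebra generated by all $e_j,\omega_j^{\pm1}$ and $a_n^{\pm1}$; $\widetilde B'$ is the subalgebra generated by all $f_j,(\omega_j')^{\pm1}$ and $b_n^{\pm1}$, with the coproduct opposite to that of $\widetilde U$. The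 bilinear form $(\,,)$ on $\widetilde B'\times\widetilde B$ is the Hopf pairing (i.e. $(1,h)=\varepsilon(h)$, $(h',1)=\varepsilon(h')$, $(h',hk)=\sum(h'_{(1)},h)(h'_{(2)},k)$, $(h'k',h)=\sum(h',h_{(1)})(k',h_{(2)})$, using these coproducts) determined by $(f_i,e_j)=\frac{\delta_{i,j}}{s-r}$, $(\omega_i',\omega_j)=r^{\langle\epsilon_j,\alpha_i\rangle}s^{\langle\epsilon_{j+1},\alpha_i\rangle}$, $(b_n,a_n)=1$, $(b_n,\omega_j)=s^{-\langle\epsilon_n,\alpha_j\rangle}$, $(\omega_i',a_n)=r^{\langle\epsilon_n,\alpha_i\rangle}$, inverses of group-like generators giving inverse values, and $0$ on all other pairs of generators. $U^+$ (resp. $U^-$) is the subalgebra generated by $1$ and the $e_i$ (resp. $f_i$), $1\le i<n$; for $\zeta\in Q^+$, $U^+_\zeta$ (resp. $U^-_{-\zeta}$) is the span of monomials $e_{i_1}\cdots e_{i_\ell}$ (resp. $f_{i_1}\cdots f_{i_\ell}$) with $\alpha_{i_1}+\cdots+\alpha_{i_\ell}=\zeta$. The spaces $U^+_\zeta$ and $U^-_{-\zeta}$ are nondegenerately paired by $(\,,)$. Let $\{u_k^\zeta\}$ be a basis of $U^+_\zeta$ and $\{v_k^\zeta\}$ the dual basis of $U^-_{-\zeta}$, $(v_k^\zeta,u_l^\zeta)=\delta_{k,l}$. Put $\Theta_\zeta=\sum_kv_k^\zeta\otimes u_k^\zeta$ and $\Theta=\sum_{\zeta\in Q^+}\Theta_\zeta$.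 Category $\mathcal O$: $\widetilde U$-modules $M$ such that $M=\bigoplus_{\lambda\in\mathrm{wt}(M)}M_\lambda$ with the set of weights $\mathrm{wt}(M)\subseteq\Lambda$, where $M_\lambda=\{m: a_i m=r^{\langle\epsilon_i,\lambda\rangle}m,\ b_i m=s^{\langle\epsilon_i,\lambda\rangle}m\ \forall i\}$; $\dim M_\lambda<\infty$ for all $\lambda\in\mathrm{wt}(M)$; and $\mathrm{wt}(M)\subseteq\bigcup_{\mu\in F}(\mu-Q^+)$ for some finite $F\subset\Lambda$. $\Theta$ acts as a well-defined linear map on tensor products of two modules in $\mathcal O$, since only finitely many $\Theta_\zeta$ act nontrivially on a given vector. For $\lambda=\sum_{i=1}^n\lambda_i\alpha_i\in\Lambda$ put $\omega_\lambda=\omega_1^{\lambda_1}\cdots\omega_{n-1}^{\lambda_{n-1}}a_n^{\lambda_n}$, $\omega'_\lambda=(\omega_1')^{\lambda_1}\cdots(\omega_{n-1}')^{\lambda_{n-1}}b_n^{\lambda_n}$, and $f(\lambda,\mu)=(\omega'_\mu,\omega_\lambda)^{-1}$ for $\lambda,\mu\in\Lambda$. On a tensor product $N'\otimes N$ of modules in $\mathcal O$, $\widetilde f(m'\otimes m)=f(\lambda,\mu)\,m'\otimes m$ for $m'\in N'_\lambda$, $m\in N_\mu$. $P:N\otimes N'\to N'\otimes N$ is the flip. *)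

(* Defs.v *)
From HB Require Import structures.
From mathcomp Require Import all_boot all_order all_algebra generic_quotient.
From mathcomp Require Import zify.
From mathcomp Require Import boolp classical_sets functions cardinality fsbigop.

Set Implicit Arguments.
Unset Strict Implicit.
Unset Printing Implicit Defensive.

Import Order.TTheory GRing.Theory Num.Theory.
Local Open Scope classical_set_scope.
Local Open Scope ring_scope.
Local Open Scope quotient_scope.

Section TensorDef.
Variables (K : fieldType) (M N : lmodType K).

(* A formal sum of pure tensors is a list of pairs; [teq] is the congruence of
   commutative monoids generated by bilinearity.  Opposites are given by
   [(- m) (x) n], so the quotient is the usual tensor product over [K]. *)
Inductive teq : seq (M * N) -> seq (M * N) -> Prop :=
| teq_refl s : teq s s
| teq_sym s t : teq s t -> teq t s
| teq_trans s t u : teq s t -> teq t u -> teq s u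
| teq_cat s s' t t' : teq s s' -> teq t t' -> teq (s ++ t) (s' ++ t')
| teq_catC s t : teq (s ++ t) (t ++ s)
| teq_addl m m' n : teq [:: (m + m', n)] [:: (m, n); (m', n)]
| teq_addr m n n' : teq [:: (m, n + n')] [:: (m, n); (m, n')]
| teq_scale a m n : teq [:: (a *: m, n)] [:: (m, a *: n)]
| teq_0l n : teq [:: (0, n)] [::].

Definition teqb (s t : seq (M * N)) : bool := `[< teq s t >].

Lemma teqb_refl : reflexive teqb.
Proof. by move=> s; apply/asboolP/teq_refl. Qed.

Lemma teqb_sym : symmetric teqb.
Proof. by move=> s t; apply/asboolP/asboolP => /teq_sym. Qed.

Lemma teqb_trans : transitive teqb.
Proof.
by move=> s t u /asboolP h /asboolP h'; apply/asboolP/(teq_trans h h').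
Qed.

Canonical teqb_equiv := EquivRel teqb teqb_refl teqb_sym teqb_trans.

Definition tensor : Type := {eq_quot teqb}.
HB.instance Definition _ := Choice.on tensor.

Definition tcls (s : seq (M * N)) : tensor := \pi_({eq_quot teqb}) s.
Definition trep (t : tensor) : seq (M * N) := repr (t : {eq_quot teqb}).

Lemma trepK t : tcls (trep t) = t.
Proof. exact: (@reprK _ {eq_quot teqb}). Qed.

Lemma tclsP s t : tcls s = tcls t <-> teq s t.
Proof.
by split=> [/eqmodP/asboolP|h]; last by apply/eqmodP/asboolP.
Qed.

Lemma trep_teq s : teq (trep (tcls s)) s.
Proof. by apply/tclsP; rewrite trepK. Qed.

Definition tpure (m : M) (n : N) : tensor := tcls [:: (m, n)].

Definition tadd (t u : tensor) : tensor := tcls (trep t ++ trep u).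
Definition tscale (a : K) (t : tensor) : tensor :=
  tcls [seq (a *: p.1, p.2) | p <- trep t].

Lemma tadd_cls s t : tadd (tcls s) (tcls t) = tcls (s ++ t).
Proof. by apply/tclsP/teq_cat; apply: trep_teq. Qed.

Lemma teq_map a s t : teq s t ->
  teq [seq (a *: p.1, p.2) | p <- s] [seq (a *: p.1, p.2) | p <- t].
Proof.
elim=> {s t} /=.
- by move=> s; apply: teq_refl.
- by move=> s t _; apply: teq_sym.
- by move=> s t u _ h _; apply: teq_trans.
- by move=> s s' t t' _ h _ h'; rewrite !map_cat; apply: teq_cat.
- by move=> s t; rewrite !map_cat; apply: teq_catC.
- by move=> m m' n; rewrite scalerDr; apply: teq_addl.
- by move=> m n n'; apply: teq_addr.
- by move=> b m n; rewrite scalerA mulrC -scalerA; apply: teq_scale.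
- by move=> n; rewrite scaler0; apply: teq_0l.
Qed.

Lemma tscale_cls a s :
  tscale a (tcls s) = tcls [seq (a *: p.1, p.2) | p <- s].
Proof. by apply/tclsP/teq_map/trep_teq. Qed.

Lemma taddA : associative tadd.
Proof.
move=> x y z; rewrite -(trepK x) -(trepK y) -(trepK z) !tadd_cls.
by rewrite catA.
Qed.

Lemma taddC : commutative tadd.
Proof.
move=> x y; rewrite -(trepK x) -(trepK y) !tadd_cls.
exact/tclsP/teq_catC.
Qed.

Lemma tadd0 : left_id (tcls [::]) tadd.
Proof. by move=> x; rewrite -(trepK x) tadd_cls. Qed.

Lemma tclsS p s : tcls (p :: s) = tadd (tpure p.1 p.2) (tcls s).
Proof. by rewrite /tpure tadd_cls; case: p. Qed.

Lemma tpureDl m m' n : tpure (m + m') n = tadd (tpure m n) (tpure m' n).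
Proof. by rewrite /tpure tadd_cls; apply/tclsP/teq_addl. Qed.

Lemma tpureDr m n n' : tpure m (n + n') = tadd (tpure m n) (tpure m n').
Proof. by rewrite /tpure tadd_cls; apply/tclsP/teq_addr. Qed.

Lemma tpure0l n : tpure 0 n = tcls [::].
Proof. exact/tclsP/teq_0l. Qed.

Lemma tscaleDl t a b : tscale (a + b) t = tadd (tscale a t) (tscale b t).
Proof.
rewrite -(trepK t) !tscale_cls; elim: (trep t) => [|p s ih] /=.
  by rewrite tadd0.
rewrite !tclsS ih /= scalerDl tpureDl -!taddA; congr tadd.
by rewrite !taddA; congr tadd; rewrite taddC.
Qed.

Lemma tscaleDr a : {morph tscale a : t u / tadd t u}.
Proof.
move=> t u; rewrite -(trepK t) -(trepK u) !(tscale_cls, tadd_cls).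
by rewrite map_cat.
Qed.

Lemma tscaleA a b t : tscale a (tscale b t) = tscale (a * b) t.
Proof.
rewrite -(trepK t) !tscale_cls -map_comp; congr tcls.
by apply: eq_map => p /=; rewrite scalerA.
Qed.

Lemma tscale1 : left_id 1 tscale.
Proof.
move=> t; rewrite -(trepK t) tscale_cls; congr tcls.
by rewrite -[RHS]map_id; apply: eq_map => -[x y] /=; rewrite scale1r.
Qed.

Lemma taddN : left_inverse (tcls [::]) (tscale (-1)) tadd.
Proof.
move=> t; rewrite -{2}(tscale1 t) -tscaleDl addNr -(trepK t) tscale_cls.
elim: (trep t) => [//|p s ih] /=.
by rewrite tclsS ih scale0r tpure0l tadd0.
Qed.

HB.instance Definition _ :=
  GRing.isZmodule.Build tensor taddA taddC tadd0 taddN.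
HB.instance Definition _ :=
  GRing.Zmodule_isLmodule.Build K tensor tscaleA tscale1 tscaleDr
    (fun t => tscaleDl t).

End TensorDef.

Notation "m (x) n" := (tpure m n) (at level 40, left associativity).

Section TensorTheory.
Variables (K : fieldType) (M N : lmodType K).
Implicit Types (m : M) (n : N).

Definition bilin (V : lmodType K) (g : M -> N -> V) : Prop :=
  [/\ forall m m' n, g (m + m') n = g m n + g m' n,
      forall m n n', g m (n + n') = g m n + g m n',
      forall a m n, g (a *: m) n = a *: g m n
    & forall a m n, g m (a *: n) = a *: g m n].

(* [tlift g] is the linear map induced by [g] whenever [g] is bilinear
   ([tlift_pure], [tlift_linear]). *)
Definition tlift (V : lmodType K) (g : M -> N -> V) (t : tensor M N) : V :=
  \sum_(p <- trep t) g p.1 p.2.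

Lemma tpure_bilin : bilin (fun m n => m (x) n).
Proof.
split=> [m m' n|m n n'|a m n|a m n]; first exact: tpureDl.
- exact: tpureDr.
- by rewrite [RHS]tscale_cls.
- by rewrite [RHS]tscale_cls /=; apply/tclsP/teq_sym/teq_scale.
Qed.

Lemma tensorE (t : tensor M N) : t = \sum_(p <- trep t) p.1 (x) p.2.
Proof.
rewrite -{1}(trepK t); elim: (trep t) => [|p s ih]; first by rewrite big_nil.
by rewrite big_cons -ih tclsS.
Qed.

Lemma tensor_ind (P : tensor M N -> Prop) :
  P 0 -> (forall t u, P t -> P u -> P (t + u)) ->
  (forall m n, P (m (x) n)) -> forall t, P t.
Proof.
move=> P0 PD Pp t; rewrite [t]tensorE.
by elim/big_ind: _ => // p _; apply: Pp.
Qed.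

Section Lift.
Variables (V : lmodType K) (g : M -> N -> V).
Hypothesis g_bilin : bilin g.

Lemma tlift_cls s : tlift g (tcls s) = \sum_(p <- s) g p.1 p.2.
Proof.
case: g_bilin => gDl gDr gZl gZr; rewrite /tlift.
suff teq_sum s1 s2 : teq s1 s2 ->
    \sum_(p <- s1) g p.1 p.2 = \sum_(p <- s2) g p.1 p.2.
  exact/teq_sum/trep_teq.
elim=> {s s1 s2} //=.
- by move=> s t u _ -> _ ->.
- by move=> s s' t t' _ h _ h'; rewrite !big_cat /= h h'.
- by move=> s t; rewrite !big_cat /= addrC.
- by move=> m m' n; rewrite !(big_cons, big_nil) /= gDl !addr0.
- by move=> m n n'; rewrite !(big_cons, big_nil) /= gDr !addr0.
- by move=> a m n; rewrite !(big_cons, big_nil) /= gZl gZr.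
- by move=> n; rewrite !(big_cons, big_nil) /= addr0 -(scale0r 0) gZl scale0r.
Qed.

Lemma tlift_pure m n : tlift g (m (x) n) = g m n.
Proof. by rewrite tlift_cls big_seq1. Qed.

Lemma tliftD t u : tlift g (t + u) = tlift g t + tlift g u.
Proof.
rewrite -(trepK t) -(trepK u) [tcls _ + _]tadd_cls !tlift_cls.
by rewrite big_cat.
Qed.

Lemma tliftZ a t : tlift g (a *: t) = a *: tlift g t.
Proof.
case: g_bilin => _ _ gZl _.
rewrite -(trepK t) [a *: _]tscale_cls !tlift_cls big_map scaler_sumr.
by apply: eq_bigr => p _ /=; rewrite gZl.
Qed.

Lemma tlift_linear : linear (tlift g).
Proof. by move=> a t u; rewrite tliftD tliftZ. Qed.

Lemma tlift0 : tlift g 0 = 0.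
Proof. by rewrite -(scale0r 0) tliftZ scale0r. Qed.

End Lift.

End TensorTheory.

Section TensorMaps.
Variable K : fieldType.
Implicit Types A B C D : lmodType K.

Definition tflip A B : tensor A B -> tensor B A :=
  tlift (fun x y => y (x) x).

Definition tmap A B C D (f : A -> C) (g : B -> D) :
    tensor A B -> tensor C D :=
  tlift (fun x y => f x (x) g y).

Definition tassoc A B C : tensor (tensor A B) C -> tensor A (tensor B C) :=
  tlift (fun t z => tlift (fun x y => x (x) (y (x) z)) t).

Definition tassocV A B C : tensor A (tensor B C) -> tensor (tensor A B) C :=
  tlift (fun x t => tlift (fun y z => (x (x) y) (x) z) t).

Lemma tflip_pure A B (x : A) (y : B) : tflip (x (x) y) = y (x) x.
Proof.
apply: tlift_pure; case: (@tpure_bilin K B A) => hDl hDr hZl hZr.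
by split=> *; rewrite ?hDl ?hDr ?hZl ?hZr.
Qed.

Lemma tmap_pure A B C D (f : {linear A -> C}) (g : {linear B -> D}) x y :
  tmap f g (x (x) y) = f x (x) g y.
Proof.
apply: (@tlift_pure _ _ _ _ (fun x y => f x (x) g y)).
case: (@tpure_bilin K C D) => hDl hDr hZl hZr.
by split=> *; rewrite ?linearD ?linearZ ?hDl ?hDr ?hZl ?hZr.
Qed.

Let assoc_bilin A B C (z : C) :
  bilin (fun (x : A) (y : B) => x (x) (y (x) z)).
Proof.
case: (@tpure_bilin K A (tensor B C)) => hDl hDr hZl hZr.
case: (@tpure_bilin K B C) => kDl kDr kZl kZr.
by split=> *; rewrite ?kDl ?kZl ?hDl ?hDr ?hZl ?hZr.
Qed.

Let assocV_bilin A B C (x : A) :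
  bilin (fun (y : B) (z : C) => (x (x) y) (x) z).
Proof.
case: (@tpure_bilin K (tensor A B) C) => hDl hDr hZl hZr.
case: (@tpure_bilin K A B) => kDl kDr kZl kZr.
by split=> *; rewrite ?kDr ?kZr ?hDl ?hDr ?hZl ?hZr.
Qed.

Lemma tassoc_pure A B C (x : A) (y : B) (z : C) :
  tassoc ((x (x) y) (x) z) = x (x) (y (x) z).
Proof.
have hb w := @assoc_bilin A B C w.
case: (@tpure_bilin K A (tensor B C)) => hDl hDr hZl hZr.
case: (@tpure_bilin K B C) => kDl kDr kZl kZr.
rewrite /tassoc tlift_pure; first exact: tlift_pure.
split=> [t t' w|t w w'|a t w|a t w]; rewrite ?(tliftD (hb w)) ?(tliftZ (hb w)) //.
- rewrite [in LHS]/tlift [X in _ = X + _]/tlift [X in _ = _ + X]/tlift -big_split.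
  by apply: eq_bigr => p _; rewrite kDr hDr.
- rewrite [in LHS]/tlift [in RHS]/tlift scaler_sumr.
  by apply: eq_bigr => p _; rewrite kZr hZr.
Qed.

Lemma tassocV_pure A B C (x : A) (y : B) (z : C) :
  tassocV (x (x) (y (x) z)) = (x (x) y) (x) z.
Proof.
have hb w := @assocV_bilin A B C w.
case: (@tpure_bilin K (tensor A B) C) => hDl hDr hZl hZr.
case: (@tpure_bilin K A B) => kDl kDr kZl kZr.
rewrite /tassocV tlift_pure; first exact: tlift_pure.
split=> [w w' t|w t t'|a w t|a w t]; rewrite ?(tliftD (hb w)) ?(tliftZ (hb w)) //.
- rewrite [in LHS]/tlift [X in _ = X + _]/tlift [X in _ = _ + X]/tlift -big_split.
  by apply: eq_bigr => p _; rewrite kDl hDl.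
- rewrite [in LHS]/tlift [in RHS]/tlift scaler_sumr.
  by apply: eq_bigr => p _; rewrite kZl hZl.
Qed.

End TensorMaps.

Section Terms.
Variables (K : fieldType) (G : Type).

Inductive term : Type :=
| TGen of G
| TCst of K
| TAdd of term & term
| TMul of term & term.

Definition TSub (x y : term) : term := TAdd x (TMul (TCst (-1)) y).

Fixpoint ev (A : algType K) (phi : G -> A) (t : term) : A :=
  match t with
  | TGen g => phi g
  | TCst c => c%:A
  | TAdd x y => ev phi x + ev phi y
  | TMul x y => ev phi x * ev phi y
  end.

HB.instance Definition _ := gen_eqMixin term.
HB.instance Definition _ := gen_choiceMixin term.

Section Presentation.
Variable R : term -> term -> Prop.

(* The congruence generated by [R] and the axioms of unital associative
   [K]-algebras. *)
Inductive pcong : term -> term -> Prop :=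
| pc_rel x y : R x y -> pcong x y
| pc_refl x : pcong x x
| pc_sym x y : pcong x y -> pcong y x
| pc_trans x y z : pcong x y -> pcong y z -> pcong x z
| pc_add x x' y y' : pcong x x' -> pcong y y' -> pcong (TAdd x y) (TAdd x' y')
| pc_mul x x' y y' : pcong x x' -> pcong y y' -> pcong (TMul x y) (TMul x' y')
| pc_addA x y z : pcong (TAdd x (TAdd y z)) (TAdd (TAdd x y) z)
| pc_addC x y : pcong (TAdd x y) (TAdd y x)
| pc_add0 x : pcong (TAdd (TCst 0) x) x
| pc_addN x : pcong (TAdd (TMul (TCst (-1)) x) x) (TCst 0)
| pc_mulA x y z : pcong (TMul x (TMul y z)) (TMul (TMul x y) z)
| pc_mul1l x : pcong (TMul (TCst 1) x) x
| pc_mul1r x : pcong (TMul x (TCst 1)) x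
| pc_mulDl x y z : pcong (TMul (TAdd x y) z) (TAdd (TMul x z) (TMul y z))
| pc_mulDr x y z : pcong (TMul x (TAdd y z)) (TAdd (TMul x y) (TMul x z))
| pc_cstD a b : pcong (TCst (a + b)) (TAdd (TCst a) (TCst b))
| pc_cstM a b : pcong (TCst (a * b)) (TMul (TCst a) (TCst b))
| pc_cstC a x : pcong (TMul (TCst a) x) (TMul x (TCst a)).

Definition pcongb (x y : term) : bool := `[< pcong x y >].

Lemma pcongb_refl : reflexive pcongb.
Proof. by move=> s; apply/asboolP/pc_refl. Qed.

Lemma pcongb_sym : symmetric pcongb.
Proof. by move=> s t; apply/asboolP/asboolP => /pc_sym. Qed.

Lemma pcongb_trans : transitive pcongb.
Proof.
by move=> s t u /asboolP h /asboolP h'; apply/asboolP/(pc_trans h h').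
Qed.

Canonical pcongb_equiv := EquivRel pcongb pcongb_refl pcongb_sym pcongb_trans.

Definition presalg : Type := {eq_quot pcongb}.
HB.instance Definition _ := Choice.on presalg.

Definition pcls (x : term) : presalg := \pi_({eq_quot pcongb}) x.
Definition prep (x : presalg) : term := repr (x : {eq_quot pcongb}).

Lemma prepK x : pcls (prep x) = x.
Proof. exact: (@reprK _ {eq_quot pcongb}). Qed.

Lemma pclsP x y : pcls x = pcls y <-> pcong x y.
Proof.
by split=> [/eqmodP/asboolP|h]; last by apply/eqmodP/asboolP.
Qed.

Lemma prep_pcong x : pcong (prep (pcls x)) x.
Proof. by apply/pclsP; rewrite prepK. Qed.

Definition padd (x y : presalg) : presalg := pcls (TAdd (prep x) (prep y)).
Definition pmul (x y : presalg) : presalg := pcls (TMul (prep x) (prep y)).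
Definition pscale (a : K) (x : presalg) : presalg :=
  pcls (TMul (TCst a) (prep x)).

Lemma padd_cls x y : padd (pcls x) (pcls y) = pcls (TAdd x y).
Proof. by apply/pclsP/pc_add; apply: prep_pcong. Qed.

Lemma pmul_cls x y : pmul (pcls x) (pcls y) = pcls (TMul x y).
Proof. by apply/pclsP/pc_mul; apply: prep_pcong. Qed.

Lemma pscaleE a x : pscale a x = pmul (pcls (TCst a)) x.
Proof. by rewrite -{2}(prepK x) pmul_cls. Qed.

Let clsE := (padd_cls, pmul_cls).

Lemma paddA : associative padd.
Proof.
by move=> x y z; rewrite -(prepK x) -(prepK y) -(prepK z) !clsE; apply/pclsP/pc_addA.
Qed.

Lemma paddC : commutative padd.
Proof. by move=> x y; apply/pclsP/pc_addC. Qed.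

Lemma padd0 : left_id (pcls (TCst 0)) padd.
Proof. by move=> x; rewrite -(prepK x) clsE; apply/pclsP/pc_add0. Qed.

Lemma paddN : left_inverse (pcls (TCst 0)) (pscale (-1)) padd.
Proof.
by move=> x; rewrite pscaleE -(prepK x) !clsE; apply/pclsP/pc_addN.
Qed.

Lemma pmulA : associative pmul.
Proof.
by move=> x y z; rewrite -(prepK x) -(prepK y) -(prepK z) !clsE; apply/pclsP/pc_mulA.
Qed.

Lemma pmul1l : left_id (pcls (TCst 1)) pmul.
Proof. by move=> x; rewrite -(prepK x) clsE; apply/pclsP/pc_mul1l. Qed.

Lemma pmul1r : right_id (pcls (TCst 1)) pmul.
Proof. by move=> x; rewrite -(prepK x) clsE; apply/pclsP/pc_mul1r. Qed.

Lemma pmulDl : left_distributive pmul padd.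
Proof.
by move=> x y z; rewrite -(prepK x) -(prepK y) -(prepK z) !clsE; apply/pclsP/pc_mulDl.
Qed.

Lemma pmulDr : right_distributive pmul padd.
Proof.
by move=> x y z; rewrite -(prepK x) -(prepK y) -(prepK z) !clsE; apply/pclsP/pc_mulDr.
Qed.

Lemma pcstD a b : pcls (TCst (a + b)) = padd (pcls (TCst a)) (pcls (TCst b)).
Proof. by rewrite clsE; apply/pclsP/pc_cstD. Qed.

Lemma pcstM a b : pcls (TCst (a * b)) = pmul (pcls (TCst a)) (pcls (TCst b)).
Proof. by rewrite clsE; apply/pclsP/pc_cstM. Qed.

Lemma pcstC a x : pmul (pcls (TCst a)) x = pmul x (pcls (TCst a)).
Proof. by rewrite -(prepK x) !clsE; apply/pclsP/pc_cstC. Qed.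

HB.instance Definition _ :=
  GRing.isZmodule.Build presalg paddA paddC padd0 paddN.
HB.instance Definition _ :=
  GRing.Zmodule_isPzRing.Build presalg pmulA pmul1l pmul1r pmulDl pmulDr.

Lemma pscaleA a b (x : presalg) : pscale a (pscale b x) = pscale (a * b) x.
Proof. by rewrite !pscaleE pcstM pmulA. Qed.

Lemma pscale1 : left_id 1 pscale.
Proof. by move=> x; rewrite pscaleE pmul1l. Qed.

Lemma pscaleDr : right_distributive pscale +%R.
Proof. by move=> a x y; rewrite !pscaleE; apply: pmulDr. Qed.

Lemma pscaleDl (x : presalg) : {morph pscale^~ x : a b / a + b}.
Proof. by move=> a b; rewrite !pscaleE pcstD; apply: pmulDl. Qed.

HB.instance Definition _ :=
  GRing.Zmodule_isLmodule.Build K presalg pscaleA pscale1 pscaleDr pscaleDl.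

Lemma presalg_scalerAl a (x y : presalg) : a *: (x * y) = a *: x * y.
Proof. by rewrite [LHS]pscaleE [a *: x]pscaleE [LHS]pmulA. Qed.

Lemma presalg_scalerAr a (x y : presalg) : a *: (x * y) = x * (a *: y).
Proof.
rewrite [LHS]pscaleE [a *: y]pscaleE [LHS]pmulA [RHS]pmulA.
by rewrite -[pmul x _]pcstC.
Qed.

Lemma ev_pcong (A : algType K) (phi : G -> A) x y :
  (forall u v, R u v -> ev phi u = ev phi v) -> pcong x y ->
  ev phi x = ev phi y.
Proof.
move=> hR; elim=> {x y} /=; first exact: hR.
- by [].
- by [].
- by move=> x y z _ -> _ ->.
- by move=> x x' y y' _ -> _ ->.
- by move=> x x' y y' _ -> _ ->.
- by move=> x y z; rewrite addrA.
- by move=> x y; rewrite addrC.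
- by move=> x; rewrite scale0r add0r.
- by move=> x; rewrite scaleN1r mulN1r addNr scale0r.
- by move=> x y z; rewrite mulrA.
- by move=> x; rewrite scale1r mul1r.
- by move=> x; rewrite scale1r mulr1.
- by move=> x y z; rewrite mulrDl.
- by move=> x y z; rewrite mulrDr.
- by move=> a b; rewrite scalerDl.
- by move=> a b; rewrite -scalerAl mul1r scalerA.
- by move=> a x; rewrite -scalerAl -scalerAr mul1r mulr1.
Qed.

(* The algebra morphism determined by the images of the generators; it is one
   when these images satisfy the relations ([plift_morph]). *)
Definition plift (A : algType K) (phi : G -> A) (x : presalg) : A :=
  ev phi (prep x).

Lemma plift_morph (A : algType K) (phi : G -> A) :
    (forall u v, R u v -> ev phi u = ev phi v) ->
  [/\ forall a x y, plift phi (a *: x + y) = a *: plift phi x + plift phi y,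
      plift phi 1 = 1,
      forall x y, plift phi (x * y) = plift phi x * plift phi y
    & forall g, plift phi (pcls (TGen g)) = phi g].
Proof.
move=> hR.
have E t : plift phi (pcls t) = ev phi t by exact/(ev_pcong hR)/prep_pcong.
split=> [a x y||x y|g].
- rewrite -(prepK x) -(prepK y) [a *: _]pscaleE pmul_cls [_ + _]padd_cls.
  by rewrite !E /= -scalerAl mul1r.
- by rewrite [LHS]E /= scale1r.
- by rewrite -(prepK x) -(prepK y) [_ * _]pmul_cls !E.
- by rewrite E.
Qed.

End Presentation.
End Terms.

Arguments TGen {K G}.
Arguments TCst {K G}.

(* Throughout, [n = m.+1].  The indices [1 <= i <= n] are the elements of
   ['I_m.+1], and the indices [1 <= j < n] those of ['I_m], shifted to start
   from 0; [lo j] and [hi j] are [j] and [j + 1] as elements of ['I_m.+1]. *)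
Section Lattice.
Variable m : nat.

Definition lo (j : 'I_m) : 'I_m.+1 := widen_ord (leqnSn m) j.
Definition hi (j : 'I_m) : 'I_m.+1 := lift ord0 j.

Definition Lat : Type := {ffun 'I_m.+1 -> int}.
HB.instance Definition _ := GRing.Zmodule.on Lat.

Definition eps (i : 'I_m.+1) : Lat := [ffun k => (k == i)%:Z].

Definition inner (x y : Lat) : int := \sum_i x i * y i.

Definition alpha (j : 'I_m) : Lat := eps (lo j) - eps (hi j).

(* [Q^+], through the coefficients on the simple roots. *)
Definition Qplus : Type := {ffun 'I_m -> nat}.
HB.instance Definition _ := Choice.on Qplus.

Definition Qval (z : Qplus) : Lat := \sum_j alpha j *+ z j.

(* Coefficients in the basis [alpha_1, ..., alpha_(n-1), alpha_n = eps_n]. *)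
Definition acoef (x : Lat) (i : 'I_m.+1) : int := \sum_(k < m.+1 | (k <= i)%N) x k.

Lemma innerE i x : inner (eps i) x = x i.
Proof.
rewrite /inner (bigD1 i) //= ffunE eqxx mul1r big1 ?addr0 // => k ki.
by rewrite ffunE (negbTE ki) mul0r.
Qed.

Lemma acoefE (x : Lat) :
  x = \sum_j alpha j *~ acoef x (lo j) + eps ord_max *~ acoef x ord_max.
Proof.
apply/ffunP => k; rewrite ffunE sum_ffunE ffunMzE ffunE.
under eq_bigr do rewrite ffunMzE !ffunE mulrzBl.
rewrite sumrB addrAC; set c := acoef x.
have -> : \sum_(i < m) (k == lo i)%:Z *~ c (lo i)
          + (k == ord_max)%:Z *~ c ord_max = c k.
  transitivity (\sum_i (k == i)%:Z *~ c i).
    by rewrite big_ord_recr /=; congr (_ + _); apply: eq_bigr => i _; congr (_ *~ c _); apply: val_inj.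
  rewrite (bigD1 k) //= eqxx big1 ?addr0 ?intz // => i /negbTE.
  by rewrite eq_sym => ->; rewrite mul0rz.
case: (unliftP ord0 k) => [j ->|->].
  have -> : \sum_(i < m) (lift ord0 j == hi i)%:Z *~ c (lo i) = c (lo j).
    rewrite (bigD1 j) //= eqxx big1 ?addr0 ?intz // => i /negbTE ij.
    by rewrite (inj_eq lift_inj) eq_sym ij mul0rz.
  rewrite /c /acoef (bigD1 (lift ord0 j)) //= -addrA [X in _ + X]addrC.
  rewrite -[LHS]addr0; congr (_ + _); apply/eqP; rewrite eq_sym addrC subr_eq0.
  apply/eqP/eq_bigl => i; rewrite -val_eqE /= /bump /= add1n.
  by rewrite andbC -ltn_neqAle ltnS.
rewrite big1 => [|i _]; last by rewrite (negbTE (neq_lift _ _)) mul0rz.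
rewrite subr0 /c /acoef (bigD1 ord0) //= big1 ?addr0 // => i.
by rewrite leqn0 -val_eqE /= => /andP[->].
Qed.

End Lattice.

(* Generators; [true] marks the inverse of [a_i] or [b_i]. *)
Inductive ggen (m : nat) : Type :=
| gE of 'I_m
| gF of 'I_m
| gA of 'I_m.+1 & bool
| gB of 'I_m.+1 & bool.

Definition torus m (g : ggen m) : bool :=
  match g with gA _ _ | gB _ _ => true | _ => false end.

Declare Scope gterm_scope.
Delimit Scope gterm_scope with GT.
Notation "x + y" := (TAdd x y) : gterm_scope.
Notation "x - y" := (TSub x y) : gterm_scope.
Notation "x * y" := (TMul x y) : gterm_scope.
Notation "c *: x" := (TMul (TCst c) x) : gterm_scope.

Section Relations.
Variables (K : fieldType) (m : nat) (r s : K).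

Local Notation tm := (term K (ggen m)).
Local Open Scope gterm_scope.
Let e j : tm := TGen (gE j).
Let f j : tm := TGen (gF j).
Let a i : tm := TGen (gA i false).
Let a' i : tm := TGen (gA i true).
Let b i : tm := TGen (gB i false).
Let b' i : tm := TGen (gB i true).

Inductive gl_rel : tm -> tm -> Prop :=
| R1_comm g h : torus g -> torus h -> gl_rel (TGen g * TGen h) (TGen h * TGen g)
| R1_a i : gl_rel (a i * a' i) (TCst 1)
| R1_b i : gl_rel (b i * b' i) (TCst 1)
| R2_e i j : gl_rel (a i * e j) ((r ^ inner (eps i) (alpha j))%R *: (e j * a i))
| R2_f i j : gl_rel (a i * f j) ((r ^ (- inner (eps i) (alpha j)))%R *: (f j * a i))
| R3_e i j : gl_rel (b i * e j) ((s ^ inner (eps i) (alpha j))%R *: (e j * b i))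
| R3_f i j : gl_rel (b i * f j) ((s ^ (- inner (eps i) (alpha j)))%R *: (f j * b i))
| R4 (i j : 'I_m) : gl_rel (e i * f j - f j * e i)
    (((i == j)%:R / (r - s))%R *: (a (lo i) * b (hi i) - a (hi i) * b (lo i)))
| R5_e (i j : 'I_m) : (i.+1 < j)%N || (j.+1 < i)%N -> gl_rel (e i * e j) (e j * e i)
| R5_f (i j : 'I_m) : (i.+1 < j)%N || (j.+1 < i)%N -> gl_rel (f i * f j) (f j * f i)
| R6_1 (i j : 'I_m) : j = i.+1 :> nat -> gl_rel
    (e i * e i * e j - (r + s)%R *: (e i * e j * e i) + (r * s)%R *: (e j * e i * e i))
    (TCst 0)
| R6_2 (i j : 'I_m) : j = i.+1 :> nat -> gl_rel
    (e i * e j * e j - (r + s)%R *: (e j * e i * e j) + (r * s)%R *: (e j * e j * e i))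
    (TCst 0)
| R7_1 (i j : 'I_m) : j = i.+1 :> nat -> gl_rel
    (f i * f i * f j - (r^-1 + s^-1)%R *: (f i * f j * f i)
      + (r^-1 * s^-1)%R *: (f j * f i * f i))
    (TCst 0)
| R7_2 (i j : 'I_m) : j = i.+1 :> nat -> gl_rel
    (f i * f j * f j - (r^-1 + s^-1)%R *: (f j * f i * f j)
      + (r^-1 * s^-1)%R *: (f j * f j * f i))
    (TCst 0).

Local Close Scope gterm_scope.

Definition Ugl : Type := presalg gl_rel.
HB.instance Definition _ := GRing.PzRing.on Ugl.
HB.instance Definition _ := GRing.Lmodule.copy Ugl (presalg gl_rel).

Definition counit_gen (g : ggen m) : K^o := (torus g)%:R.

Lemma counit_gen_rel x y :
  gl_rel x y -> ev counit_gen x = ev counit_gen y.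
Proof.
have E := (mulr0, mul0r, mulr1, subrr, addr0, scale0r, scaler0, scale1r).
case=> {x y} [g h gT hT|i|i|i j|i j|i j|i j|i j|i j _|i j _|i j _|i j _|i j _
  |i j _] /=; rewrite /counit_gen /= ?gT ?hT.
all: try by rewrite ?E.
by rewrite !mulr1 scaleN1r subrr !mulr0 addr0.
Qed.

Definition counit (x : Ugl) : K := plift counit_gen x.

Lemma Ugl_oner_neq0 : (1 : Ugl) != 0.
Proof.
apply/eqP => /(congr1 counit); rewrite /counit.
case: (plift_morph counit_gen_rel) => hl h1 _ _.
rewrite h1 -(scaler0 _ (-1)) -[X in plift _ X]addr0 hl scaleN1r addNr => /eqP.
by rewrite oner_eq0.
Qed.

HB.instance Definition _ := GRing.PzSemiRing_isNonZero.Build Ugl Ugl_oner_neq0.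
HB.instance Definition _ := GRing.Lmodule_isLalgebra.Build K Ugl
  (@presalg_scalerAl _ _ gl_rel).
HB.instance Definition _ := GRing.Lalgebra_isAlgebra.Build K Ugl
  (@presalg_scalerAr _ _ gl_rel).

End Relations.

Section TensorAlgebra.
Variables (K : fieldType) (A B : algType K).
Implicit Types t u v : tensor A B.

Definition tmul_pure (x : A) (y : B) (u : tensor A B) : tensor A B :=
  tlift (fun x' y' => (x * x') (x) (y * y')) u.

Definition tmul t u : tensor A B := tlift (fun x y => tmul_pure x y u) t.

Lemma tmul_pure_bilin x y : bilin (fun (x' : A) (y' : B) => (x * x') (x) (y * y')).
Proof.
case: (@tpure_bilin K A B) => hDl hDr hZl hZr.
split=> [z z' w|z w w'|a z w|a z w]; rewrite ?mulrDr ?hDl ?hDr //.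
  by rewrite -scalerAr hZl.
by rewrite -scalerAr hZr.
Qed.

Lemma tmul_pureE x y x' y' :
  tmul_pure x y (x' (x) y') = (x * x') (x) (y * y').
Proof. exact/tlift_pure/tmul_pure_bilin. Qed.

Lemma tmul_pureD x y u v :
  tmul_pure x y (u + v) = tmul_pure x y u + tmul_pure x y v.
Proof. exact/tliftD/tmul_pure_bilin. Qed.

Lemma tmul_pure0 x y : tmul_pure x y 0 = 0.
Proof. exact/tlift0/tmul_pure_bilin. Qed.

Lemma tmul_pureZ x y a u : tmul_pure x y (a *: u) = a *: tmul_pure x y u.
Proof. exact/tliftZ/tmul_pure_bilin. Qed.

Lemma tmul_bilin u : bilin (fun x y => tmul_pure x y u).
Proof.
case: (@tpure_bilin K A B) => hDl hDr hZl hZr.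
split=> [z z' w|z w w'|a z w|a z w].
- elim/tensor_ind: u => [|u v hu hv|x y].
  + by rewrite !tmul_pure0 addr0.
  + by rewrite !tmul_pureD hu hv addrACA.
  + by rewrite !tmul_pureE mulrDl hDl.
- elim/tensor_ind: u => [|u v hu hv|x y].
  + by rewrite !tmul_pure0 addr0.
  + by rewrite !tmul_pureD hu hv addrACA.
  + by rewrite !tmul_pureE mulrDl hDr.
- elim/tensor_ind: u => [|u v hu hv|x y].
  + by rewrite !tmul_pure0 scaler0.
  + by rewrite !tmul_pureD hu hv scalerDr.
  + by rewrite !tmul_pureE -scalerAl hZl.
- elim/tensor_ind: u => [|u v hu hv|x y].
  + by rewrite !tmul_pure0 scaler0.
  + by rewrite !tmul_pureD hu hv scalerDr.
  + by rewrite !tmul_pureE -scalerAl hZr.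
Qed.

Lemma tmul_pp x y x' y' : tmul (x (x) y) (x' (x) y') = (x * x') (x) (y * y').
Proof. by rewrite /tmul (tlift_pure (tmul_bilin _)) tmul_pureE. Qed.

Lemma tmulDl : left_distributive tmul +%R.
Proof. by move=> t u v; apply/tliftD/tmul_bilin. Qed.

Lemma tmul0l u : tmul 0 u = 0.
Proof. exact/tlift0/tmul_bilin. Qed.

Lemma tmulZl a t u : tmul (a *: t) u = a *: tmul t u.
Proof. exact/tliftZ/tmul_bilin. Qed.

Lemma tmulDr : right_distributive tmul +%R.
Proof.
move=> t u v; elim/tensor_ind: t => [|t t' h h'|x y].
- by rewrite !tmul0l addr0.
- by rewrite !tmulDl h h' addrACA.
- by rewrite /tmul !(tlift_pure (tmul_bilin _)) tmul_pureD.
Qed.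

Lemma tmul0r t : tmul t 0 = 0.
Proof. by apply: (addrI (tmul t 0)); rewrite -tmulDr !addr0. Qed.

Lemma tmulZr a t u : tmul t (a *: u) = a *: tmul t u.
Proof.
elim/tensor_ind: t => [|t t' h h'|x y].
- by rewrite !tmul0l scaler0.
- by rewrite !tmulDl h h' scalerDr.
- by rewrite /tmul !(tlift_pure (tmul_bilin _)) tmul_pureZ.
Qed.

Lemma tmulA : associative tmul.
Proof.
move=> t u v; elim/tensor_ind: t => [|t t' h h'|x y].
- by rewrite !tmul0l.
- by rewrite !tmulDl h h'.
elim/tensor_ind: u => [|u u' h h'|x' y'].
- by rewrite !(tmul0l, tmul0r).
- by rewrite !(tmulDl, tmulDr) h h'.
elim/tensor_ind: v => [|v v' h h'|x'' y''].
- by rewrite !tmul0r.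
- by rewrite !tmulDr h h'.
by rewrite !tmul_pp !mulrA.
Qed.

Lemma tmul1l : left_id (1 (x) 1) tmul.
Proof.
elim/tensor_ind => [|t t' h h'|x y]; first by rewrite tmul0r.
  by rewrite tmulDr h h'.
by rewrite tmul_pp !mul1r.
Qed.

Lemma tmul1r : right_id (1 (x) 1) tmul.
Proof.
elim/tensor_ind => [|t t' h h'|x y]; first by rewrite tmul0l.
  by rewrite tmulDl h h'.
by rewrite tmul_pp !mulr1.
Qed.

HB.instance Definition _ :=
  GRing.Zmodule_isPzRing.Build (tensor A B) tmulA tmul1l tmul1r tmulDl tmulDr.

End TensorAlgebra.

Section Hopf.
Variables (K : fieldType) (m : nat) (r s : K).

Local Notation U := (Ugl m r s).
Local Notation UU := (tensor U U).

Lemma counitP :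
  [/\ forall a x y, counit (a *: x + y : U) = a * counit x + counit y,
      counit (1 : U) = 1
    & forall x y : U, counit (x * y) = counit x * counit y].
Proof.
case: (plift_morph (@counit_gen_rel K m r s)) => hl h1 hM _.
by split=> [a x y||x y]; rewrite /counit ?hl ?h1 ?hM // /GRing.scale /= mulr1.
Qed.

Lemma UU_oner_neq0 : (1 : UU) != 0.
Proof.
case: counitP => hl h1 _.
have h0 : counit (0 : U) = 0.
  by rewrite -(addr0 0) -[X in X + _](scaler0 _ (-1)) hl mulN1r addNr.
have hD x y : counit (x + y : U) = counit x + counit y.
  by rewrite -[x]scale1r hl mul1r scale1r.
have hZ a x : counit (a *: x : U) = a * counit x.
  by rewrite -[a *: x]addr0 hl h0 addr0.
have hb : bilin (fun x y : U => (counit x * counit y : K^o)).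
  split=> [x x' y|x y y'|a x y|a x y]; rewrite ?hD ?hZ ?mulrDl ?mulrDr //.
    by rewrite -mulrA.
  by rewrite mulrCA.
apply/eqP => /(congr1 (tlift (fun x y : U => (counit x * counit y : K^o)))).
rewrite (tlift0 hb) (tlift_pure hb) h1 mul1r => /eqP.
by rewrite oner_eq0.
Qed.

HB.instance Definition _ := GRing.PzSemiRing_isNonZero.Build UU UU_oner_neq0.
HB.instance Definition _ := GRing.Lmodule_isLalgebra.Build K UU
  (fun a x y => esym (@tmulZl K U U a x y)).
HB.instance Definition _ := GRing.Lalgebra_isAlgebra.Build K UU
  (fun a x y => esym (@tmulZr K U U a x y)).

Definition ue (j : 'I_m) : U := pcls _ (TGen (gE j)).
Definition uf (j : 'I_m) : U := pcls _ (TGen (gF j)).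
(* [ua i false] is [a_i] and [ua i true] its inverse; likewise below. *)
Definition ua (i : 'I_m.+1) (v : bool) : U := pcls _ (TGen (gA i v)).
Definition ub (i : 'I_m.+1) (v : bool) : U := pcls _ (TGen (gB i v)).
Definition om (j : 'I_m) (v : bool) : U := ua (lo j) v * ub (hi j) v.
Definition om' (j : 'I_m) (v : bool) : U := ua (hi j) v * ub (lo j) v.

Definition Delta_gen (g : ggen m) : UU :=
  match g with
  | gE j => ue j (x) 1 + om j false (x) ue j
  | gF j => 1 (x) uf j + uf j (x) om' j false
  | gA i v => ua i v (x) ua i v
  | gB i v => ub i v (x) ub i v
  end.

Definition Delta (x : U) : UU := plift Delta_gen x.

Definition ugen (g : ggen m) : U := pcls _ (TGen g).

Lemma ev_pclsE (t : term K (ggen m)) : ev ugen t = pcls _ t.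
Proof.
elim: t => //= [c|x -> y ->|x -> y ->].
- by rewrite -[c%:A]/(pscale c (pcls _ (TCst 1))) pscaleE [LHS]pmul1r.
- exact: padd_cls.
- exact: pmul_cls.
Qed.

Lemma gl_relE x y : gl_rel r s x y -> ev ugen x = ev ugen y.
Proof. by move=> h; rewrite !ev_pclsE; apply/pclsP/pc_rel. Qed.

Lemma subE (A : algType K) (x y : A) : x + (-1)%:A * y = x - y.
Proof. by rewrite scaleN1r mulN1r. Qed.

Lemma cstE (A : algType K) (c : K) (y : A) : c%:A * y = c *: y.
Proof. by rewrite -scalerAl mul1r. Qed.

Lemma torusC g h : torus g -> torus h -> ugen g * ugen h = ugen h * ugen g.
Proof. by move=> hg hh; have := gl_relE (R1_comm r s hg hh). Qed.

Lemma ua_e i j : ua i false * ue j = r ^ inner (eps i) (alpha j) *: (ue j * ua i false).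
Proof. by have /= := gl_relE (R2_e r s i j); rewrite cstE. Qed.

Lemma ua_f i j : ua i false * uf j = r ^ (- inner (eps i) (alpha j)) *: (uf j * ua i false).
Proof. by have /= := gl_relE (R2_f r s i j); rewrite cstE. Qed.

Lemma ub_e i j : ub i false * ue j = s ^ inner (eps i) (alpha j) *: (ue j * ub i false).
Proof. by have /= := gl_relE (R3_e r s i j); rewrite cstE. Qed.

Lemma ub_f i j : ub i false * uf j = s ^ (- inner (eps i) (alpha j)) *: (uf j * ub i false).
Proof. by have /= := gl_relE (R3_f r s i j); rewrite cstE. Qed.

Lemma om_e i j : om i false * ue j =
  (r ^ inner (eps (lo i)) (alpha j) * s ^ inner (eps (hi i)) (alpha j))
    *: (ue j * om i false).
Proof.
rewrite /om -mulrA ub_e -scalerAr [ua _ _ * (_ * _)]mulrA ua_e -scalerAl scalerA -mulrA.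
by rewrite [X in X *: _]mulrC.
Qed.

Lemma om_f i j : om i false * uf j =
  (r ^ (- inner (eps (lo i)) (alpha j)) * s ^ (- inner (eps (hi i)) (alpha j)))
    *: (uf j * om i false).
Proof.
rewrite /om -mulrA ub_f -scalerAr [ua _ _ * (_ * _)]mulrA ua_f -scalerAl scalerA -mulrA.
by rewrite [X in X *: _]mulrC.
Qed.

Lemma om'_e i j : om' i false * ue j =
  (r ^ inner (eps (hi i)) (alpha j) * s ^ inner (eps (lo i)) (alpha j))
    *: (ue j * om' i false).
Proof.
rewrite /om' -mulrA ub_e -scalerAr [ua _ _ * (_ * _)]mulrA ua_e -scalerAl scalerA -mulrA.
by rewrite [X in X *: _]mulrC.
Qed.

Lemma om'_f i j : om' i false * uf j =
  (r ^ (- inner (eps (hi i)) (alpha j)) * s ^ (- inner (eps (lo i)) (alpha j)))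
    *: (uf j * om' i false).
Proof.
rewrite /om' -mulrA ub_f -scalerAr [ua _ _ * (_ * _)]mulrA ua_f -scalerAl scalerA -mulrA.
by rewrite [X in X *: _]mulrC.
Qed.

End Hopf.

Lemma scomml (K : fieldType) (A : algType K) (c : K) (u v w : A) :
  v * u = c *: (u * v) -> v * u * w = c *: (u * v * w).
Proof. by move=> ->; rewrite -scalerAl. Qed.

Lemma scommr (K : fieldType) (A : algType K) (c : K) (u v w : A) :
  v * u = c *: (u * v) -> w * v * u = c *: (w * u * v).
Proof. by move=> h; rewrite -!mulrA h -scalerAr. Qed.

Section Serre.
Variables (K : fieldType) (A : algType K) (p q : K).
Hypotheses (p0 : p != 0) (q0 : q != 0).
Variables x1 x2 y1 y2 : A.
Hypotheses (c11 : y1 * x1 = (p / q) *: (x1 * y1))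
           (c22 : y2 * x2 = (p / q) *: (x2 * y2))
           (c12 : y1 * x2 = q *: (x2 * y1))
           (c21 : y2 * x1 = p^-1 *: (x1 * y2)).

Let brq (u v : A) := u * v - q *: (v * u).
Let brp (u v : A) := u * v - p *: (v * u).

Lemma serre1E (u v : A) :
  u * u * v - (p + q) *: (u * v * u) + (p * q) *: (v * u * u) = brp u (brq u v).
Proof.
rewrite /brp /brq mulrBr mulrBl scalerBr -!scalerAr -!scalerAl scalerA !mulrA.
by rewrite scalerDl !opprD !opprK !addrA; congr (_ + _); rewrite addrAC.
Qed.

Lemma serre2E (u v : A) :
  u * v * v - (p + q) *: (v * u * v) + (p * q) *: (v * v * u) = brp (brq u v) v.
Proof.
rewrite /brp /brq mulrBr mulrBl scalerBr -!scalerAr -!scalerAl scalerA !mulrA.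
by rewrite scalerDl !opprD !opprK !addrA; congr (_ + _); rewrite addrAC.
Qed.

Let brpDl u u' v : brp (u + u') v = brp u v + brp u' v.
Proof. by rewrite /brp mulrDl mulrDr scalerDr opprD addrACA. Qed.

Let brpDr u v v' : brp u (v + v') = brp u v + brp u v'.
Proof. by rewrite /brp mulrDl mulrDr scalerDr opprD addrACA. Qed.

Let brpZl a u v : brp (a *: u) v = a *: brp u v.
Proof.
by rewrite /brp -scalerAl -scalerAr scalerBr !scalerA [p * a]mulrC.
Qed.

Let brpZr a u v : brp u (a *: v) = a *: brp u v.
Proof.
by rewrite /brp -scalerAl -scalerAr scalerBr !scalerA [p * a]mulrC.
Qed.

Let brqDl u u' v : brq (u + u') v = brq u v + brq u' v.
Proof. by rewrite /brq mulrDl mulrDr scalerDr opprD addrACA. Qed.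

Let brqDr u v v' : brq u (v + v') = brq u v + brq u v'.
Proof. by rewrite /brq mulrDl mulrDr scalerDr opprD addrACA. Qed.

Let brq_sum : brq (x1 + y1) (x2 + y2) =
  brq x1 x2 + brq y1 y2 + (1 - q / p) *: (x1 * y2).
Proof.
rewrite brqDl !brqDr [brq y1 x2]/brq c12 subrr add0r.
rewrite [brq x1 y2]/brq c21 scalerA scalerBl scale1r.
by rewrite -addrA [X in _ + X]addrC addrA.
Qed.

Lemma serre1_add :
  brp x1 (brq x1 x2) = 0 -> brp y1 (brq y1 y2) = 0 ->
  brp (x1 + y1) (brq (x1 + y1) (x2 + y2)) = 0.
Proof.
move=> hx hy; rewrite brq_sum brpDl 2!(brpDr x1) 2!(brpDr y1) !brpZr hx hy.
have -> : brp y1 (brq x1 x2) = 0.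
  have e1 : y1 * x1 * x2 = p *: (x1 * x2 * y1).
    by rewrite (scomml _ c11) (scommr _ c12) scalerA divfK.
  have e2 : y1 * x2 * x1 = p *: (x2 * x1 * y1).
    by rewrite (scomml _ c12) (scommr _ c11) scalerA mulrC divfK.
  rewrite /brp /brq mulrBr mulrBl -scalerAr -scalerAl !mulrA e1 e2 scalerBr.
  by rewrite !scalerA [q * p]mulrC subrr.
have -> : brp x1 (x1 * y2) = 0.
  by rewrite /brp !mulrA (scommr _ c21) scalerA divff // scale1r subrr.
have -> : brp x1 (brq y1 y2) = (1 - p / q) *: (x1 * brq y1 y2).
  have e : brq y1 y2 * x1 = q^-1 *: (x1 * brq y1 y2).
    have e1 : y1 * y2 * x1 = q^-1 *: (x1 * y1 * y2).
      by rewrite (scommr _ c21) (scomml _ c11) scalerA mulKf.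
    have e2 : y2 * y1 * x1 = q^-1 *: (x1 * y2 * y1).
      by rewrite (scommr _ c11) (scomml _ c21) scalerA mulrC mulKf.
    rewrite /brq mulrBl mulrBr -scalerAl -scalerAr !mulrA e1 e2 scalerBr.
    by rewrite !scalerA [q * _]mulrC.
  by rewrite {1}/brp e scalerA scalerBl scale1r.
have -> : brp y1 (x1 * y2) = (p / q) *: (x1 * brq y1 y2).
  rewrite /brp /brq mulrA (scomml _ c11) mulrBr scalerBr -!scalerAr scalerA.
  by rewrite divfK // !mulrA.
rewrite !(add0r, addr0, scaler0) scalerA -scalerDl.
have -> : 1 - p / q + (1 - q / p) * (p / q) = 0.
  by rewrite mulrBl mul1r mulf_div [q * p]mulrC divff ?mulf_neq0 // subrKA subrr.
by rewrite scale0r.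
Qed.

Lemma serre2_add :
  brp (brq x1 x2) x2 = 0 -> brp (brq y1 y2) y2 = 0 ->
  brp (brq (x1 + y1) (x2 + y2)) (x2 + y2) = 0.
Proof.
move=> hx hy; rewrite brq_sum brpDr 2!(brpDl _ _ x2) 2!(brpDl _ _ y2) !brpZl hx hy.
have -> : brp (brq y1 y2) x2 = 0.
  have e1 : y1 * y2 * x2 = p *: (x2 * y1 * y2).
    by rewrite (scommr _ c22) (scomml _ c12) scalerA divfK.
  have e2 : y2 * y1 * x2 = p *: (x2 * y2 * y1).
    by rewrite (scommr _ c12) (scomml _ c22) scalerA mulrC divfK.
  rewrite /brp /brq mulrBr mulrBl -scalerAr -scalerAl !mulrA e1 e2 scalerBr.
  by rewrite !scalerA [q * p]mulrC subrr.
have -> : brp (x1 * y2) y2 = 0.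
  by rewrite /brp !mulrA (scomml _ c21) scalerA divff // scale1r subrr.
have -> : brp (brq x1 x2) y2 = (1 - p / q) *: (brq x1 x2 * y2).
  have e : y2 * brq x1 x2 = q^-1 *: (brq x1 x2 * y2).
    have e1 : y2 * x1 * x2 = q^-1 *: (x1 * x2 * y2).
      by rewrite (scomml _ c21) (scommr _ c22) scalerA mulKf.
    have e2 : y2 * x2 * x1 = q^-1 *: (x2 * x1 * y2).
      by rewrite (scomml _ c22) (scommr _ c21) scalerA mulrC mulKf.
    rewrite /brq mulrBl mulrBr -scalerAl -scalerAr !mulrA e1 e2 scalerBr.
    by rewrite !scalerA [q * _]mulrC.
  by rewrite {1}/brp e scalerA scalerBl scale1r.
have -> : brp (x1 * y2) x2 = (p / q) *: (brq x1 x2 * y2).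
  rewrite /brp /brq (scommr _ c22) mulrBl scalerBr -!scalerAl scalerA.
  by rewrite divfK // !mulrA.
rewrite !(add0r, addr0, scaler0) scalerA -scalerDl addrC.
have -> : 1 - p / q + (1 - q / p) * (p / q) = 0.
  by rewrite mulrBl mul1r mulf_div [q * p]mulrC divff ?mulf_neq0 // subrKA subrr.
by rewrite scale0r.
Qed.

End Serre.

Lemma zmod_cancel (V : zmodType) (x y z u v w : V) :
  x + y + (z + u) - (x + v + (w + u)) = (y - w) + (z - v).
Proof.
rewrite [z + u]addrC [w + u]addrC [x + y + _]addrACA [x + v + _]addrACA opprD [LHS]addrACA subrr add0r.
by rewrite [v + w]addrC opprD [LHS]addrACA.
Qed.

Section Coproduct.
Variables (K : fieldType) (m : nat) (r s : K).
Hypotheses (r0 : r != 0) (s0 : s != 0).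

Local Notation U := (Ugl m r s).
Local Notation UU := (tensor U U).
Local Notation ue := (@ue K m r s).
Local Notation uf := (@uf K m r s).
Local Notation ua := (@ua K m r s).
Local Notation ub := (@ub K m r s).
Local Notation om := (@om K m r s).
Local Notation om' := (@om' K m r s).

Let tM (x y x' y' : U) : (x (x) y : UU) * (x' (x) y') = (x * x') (x) (y * y').
Proof. exact: tmul_pp. Qed.

Let tZl a (x y : U) : (a *: x) (x) y = a *: (x (x) y).
Proof. by case: (@tpure_bilin K U U). Qed.

Let tZr a (x y : U) : x (x) (a *: y) = a *: (x (x) y).
Proof. by case: (@tpure_bilin K U U). Qed.

Let tDl (x x' y : U) : (x + x') (x) y = x (x) y + x' (x) y.
Proof. by case: (@tpure_bilin K U U). Qed.

Let tDr (x y y' : U) : x (x) (y + y') = x (x) y + x (x) y'.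
Proof. by case: (@tpure_bilin K U U). Qed.

Let tNl (x y : U) : (- x) (x) y = - (x (x) y).
Proof. by rewrite -scaleN1r tZl scaleN1r. Qed.

Let tNr (x y : U) : x (x) (- y) = - (x (x) y).
Proof. by rewrite -scaleN1r tZr scaleN1r. Qed.

Let tBl (x x' y : U) : (x - x') (x) y = x (x) y - x' (x) y.
Proof. by rewrite tDl tNl. Qed.

Let tBr (x y y' : U) : x (x) (y - y') = x (x) y - x (x) y'.
Proof. by rewrite tDr tNr. Qed.

Let t0l (y : U) : (0 : U) (x) y = 0.
Proof. by rewrite -(scale0r (0 : U)) tZl scale0r. Qed.

Let t0r (y : U) : y (x) (0 : U) = 0.
Proof. by rewrite -(scale0r (0 : U)) tZr scale0r. Qed.

Lemma inner_alpha (i : 'I_m.+1) (j : 'I_m) :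
  inner (eps i) (alpha j) = (i == lo j)%:Z - (i == hi j)%:Z.
Proof. by rewrite innerE !ffunE. Qed.

Lemma inner_lo (i j : 'I_m) :
  inner (eps (lo i)) (alpha j) = (i == j :> nat)%:Z - (i == j.+1 :> nat)%:Z.
Proof. by rewrite inner_alpha -!val_eqE. Qed.

Lemma inner_hi (i j : 'I_m) :
  inner (eps (hi i)) (alpha j) = (i.+1 == j :> nat)%:Z - (i == j :> nat)%:Z.
Proof. by rewrite inner_alpha -!val_eqE /= /bump !add1n eqSS. Qed.

Lemma Delta_gen_torus (g : ggen m) : torus g -> Delta_gen r s g = ugen r s g (x) ugen r s g.
Proof. by case: g. Qed.

Lemma ua_om i j v w : ua i v * om j w = om j w * ua i v.
Proof.
rewrite /om mulrA (@torusC _ _ r s (gA i v) (gA (lo j) w)) // -!mulrA.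
by rewrite (@torusC _ _ r s (gA i v) (gB (hi j) w)).
Qed.

Lemma ua_om' i j v w : ua i v * om' j w = om' j w * ua i v.
Proof.
rewrite /om' mulrA (@torusC _ _ r s (gA i v) (gA (hi j) w)) // -!mulrA.
by rewrite (@torusC _ _ r s (gA i v) (gB (lo j) w)).
Qed.

Lemma ub_om i j v w : ub i v * om j w = om j w * ub i v.
Proof.
rewrite /om mulrA (@torusC _ _ r s (gB i v) (gA (lo j) w)) // -!mulrA.
by rewrite (@torusC _ _ r s (gB i v) (gB (hi j) w)).
Qed.

Lemma ub_om' i j v w : ub i v * om' j w = om' j w * ub i v.
Proof.
rewrite /om' mulrA (@torusC _ _ r s (gB i v) (gA (hi j) w)) // -!mulrA.
by rewrite (@torusC _ _ r s (gB i v) (gB (lo j) w)).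
Qed.

Lemma omC i j v w : om i v * om j w = om j w * om i v.
Proof. by rewrite {1}/om -mulrA ub_om mulrA ua_om -mulrA. Qed.

Lemma om'C i j v w : om' i v * om' j w = om' j w * om' i v.
Proof. by rewrite {1}/om' -mulrA ub_om' mulrA ua_om' -mulrA. Qed.

Let DE i : UU := ue i (x) 1 + om i false (x) ue i.
Let DF i : UU := 1 (x) uf i + uf i (x) om' i false.

Let zE := (subrr, subr0, sub0r, expr0z, expr1z, exprN1, opprB, mulr1, mul1r, scale1r).

Lemma om_e_far (i j : 'I_m) : (i.+1 < j)%N || (j.+1 < i)%N ->
  om i false * ue j = ue j * om i false.
Proof.
move=> hij; rewrite om_e inner_lo inner_hi.
have -> : (i == j :> nat) = false by lia.
have -> : (i == j.+1 :> nat) = false by lia.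
have -> : (i.+1 == j :> nat) = false by lia.
by rewrite !zE.
Qed.

Lemma om'_f_far (i j : 'I_m) : (i.+1 < j)%N || (j.+1 < i)%N ->
  om' i false * uf j = uf j * om' i false.
Proof.
move=> hij; rewrite om'_f inner_lo inner_hi.
have -> : (i == j :> nat) = false by lia.
have -> : (i == j.+1 :> nat) = false by lia.
have -> : (i.+1 == j :> nat) = false by lia.
by rewrite !zE.
Qed.

Lemma om_e_diag (i : 'I_m) :
  om i false * ue i = (r / s) *: (ue i * om i false).
Proof.
rewrite om_e inner_lo inner_hi eqxx.
have -> : (i == i.+1 :> nat) = false by lia.
have -> : (i.+1 == i :> nat) = false by lia.
by rewrite !zE.
Qed.

Lemma om'_f_diag (i : 'I_m) :
  om' i false * uf i = (r / s) *: (uf i * om' i false).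
Proof.
rewrite om'_f inner_lo inner_hi eqxx.
have -> : (i == i.+1 :> nat) = false by lia.
have -> : (i.+1 == i :> nat) = false by lia.
by rewrite !zE.
Qed.

Lemma om_e_up (i j : 'I_m) : j = i.+1 :> nat ->
  om i false * ue j = s *: (ue j * om i false).
Proof.
move=> ij; rewrite om_e inner_lo inner_hi ij eqxx.
have -> : (i == i.+1 :> nat) = false by lia.
have -> : (i == i.+2 :> nat) = false by lia.
by rewrite !zE.
Qed.

Lemma om'_f_up (i j : 'I_m) : j = i.+1 :> nat ->
  om' i false * uf j = r^-1 *: (uf j * om' i false).
Proof.
move=> ij; rewrite om'_f inner_lo inner_hi ij eqxx.
have -> : (i == i.+1 :> nat) = false by lia.
have -> : (i == i.+2 :> nat) = false by lia.
by rewrite !zE.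
Qed.

Lemma om_e_down (i j : 'I_m) : j = i.+1 :> nat ->
  om j false * ue i = r^-1 *: (ue i * om j false).
Proof.
move=> ij; rewrite om_e inner_lo inner_hi ij eqxx.
have -> : (i.+1 == i :> nat) = false by lia.
have -> : (i.+2 == i :> nat) = false by lia.
by rewrite !zE.
Qed.

Lemma om'_f_down (i j : 'I_m) : j = i.+1 :> nat ->
  om' j false * uf i = s *: (uf i * om' j false).
Proof.
move=> ij; rewrite om'_f inner_lo inner_hi ij eqxx.
have -> : (i.+1 == i :> nat) = false by lia.
have -> : (i.+2 == i :> nat) = false by lia.
by rewrite !zE.
Qed.

Let De_comm (i j : 'I_m) : (i.+1 < j)%N || (j.+1 < i)%N ->
  DE i * DE j = DE j * DE i.
Proof.
move=> hij; have /= h := gl_relE (R5_e r s hij).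
have hji : (j.+1 < i)%N || (i.+1 < j)%N by rewrite orbC.
rewrite /DE !mulrDl !mulrDr !tM !mulr1 !mul1r (omC i j).
rewrite om_e_far // (om_e_far hji) [ue i * ue j]h -!addrA; congr (_ + _).
by rewrite addrCA.
Qed.

Let Df_comm (i j : 'I_m) : (i.+1 < j)%N || (j.+1 < i)%N ->
  DF i * DF j = DF j * DF i.
Proof.
move=> hij; have /= h := gl_relE (R5_f r s hij).
have hji : (j.+1 < i)%N || (i.+1 < j)%N by rewrite orbC.
rewrite /DF !mulrDl !mulrDr !tM !mulr1 !mul1r (om'C i j).
rewrite om'_f_far // (om'_f_far hji) [uf i * uf j]h -!addrA; congr (_ + _).
by rewrite addrCA.
Qed.

Let De_Df (i j : 'I_m) : DE i * DF j - DF j * DE i =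
  ((i == j)%:R / (r - s)) *:
    (ua (lo i) false * ub (hi i) false (x) (ua (lo i) false * ub (hi i) false)
     - ua (hi i) false * ub (lo i) false (x) (ua (hi i) false * ub (lo i) false)).
Proof.
have /= h := gl_relE (R4 r s i j); rewrite !subE cstE in h.
rewrite /DE /DF !mulrDl !mulrDr !tM !mulr1 !mul1r.
rewrite om_f om'_e tZl tZr.
have -> : r ^ inner (eps (hi j)) (alpha i) * s ^ inner (eps (lo j)) (alpha i)
    = r ^ (- inner (eps (lo i)) (alpha j)) * s ^ (- inner (eps (hi i)) (alpha j)).
  by rewrite !inner_lo !inner_hi !opprB [i == j :> nat]eq_sym
             [i == j.+1 :> nat]eq_sym [i.+1 == j :> nat]eq_sym.
rewrite zmod_cancel -tBl -tBr [ue i * uf j - _]h.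
case: (eqVneq i j) => [->|_]; last by rewrite mul0r !scale0r t0l t0r addr0.
rewrite tZl tZr -scalerDr tBl tBr; congr (_ *: _).
change (om j false (x) om' j false - om' j false (x) om' j false
  + (om j false (x) om j false - om j false (x) om' j false) =
  om j false (x) om j false - om' j false (x) om' j false).
by rewrite addrC addrA subrK.
Qed.

Let serre_e1 (i j : 'I_m) : j = i.+1 :> nat ->
  DE i * DE i * DE j - (r + s) *: (DE i * DE j * DE i)
    + (r * s) *: (DE j * DE i * DE i) = 0.
Proof.
move=> ij; have /= := gl_relE (R6_1 r s ij).
rewrite subE !cstE scale0r => h.
rewrite serre1E; apply: serre1_add => //; rewrite -?serre1E ?tM ?mulr1 ?mul1r.
- by rewrite om_e_diag tZl.
- by rewrite om_e_up // tZl.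
- by rewrite om_e_down // tZl.
- by rewrite -!tZl -tBl -tDl [X in X (x) _]h t0l.
- rewrite (omC j i) -[_ * om j _ * _]mulrA (omC j i) !mulrA.
  by rewrite -!tZr -tBr -tDr [X in _ (x) X]h t0r.
Qed.

Let serre_e2 (i j : 'I_m) : j = i.+1 :> nat ->
  DE i * DE j * DE j - (r + s) *: (DE j * DE i * DE j)
    + (r * s) *: (DE j * DE j * DE i) = 0.
Proof.
move=> ij; have /= := gl_relE (R6_2 r s ij).
rewrite subE !cstE scale0r => h.
rewrite serre2E; apply: serre2_add => //; rewrite -?serre2E ?tM ?mulr1 ?mul1r.
- by rewrite om_e_diag tZl.
- by rewrite om_e_up // tZl.
- by rewrite om_e_down // tZl.
- by rewrite -!tZl -tBl -tDl [X in X (x) _]h t0l.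
- rewrite -[om j _ * om j _ * om i _]mulrA (omC j i).
  rewrite [om j _ * (om i _ * om j _)]mulrA (omC j i).
  by rewrite -!tZr -tBr -tDr [X in _ (x) X]h t0r.
Qed.

Let serre_f1 (i j : 'I_m) : j = i.+1 :> nat ->
  DF i * DF i * DF j - (r^-1 + s^-1) *: (DF i * DF j * DF i)
    + (r^-1 * s^-1) *: (DF j * DF i * DF i) = 0.
Proof.
move=> ij; have /= := gl_relE (R7_1 r s ij).
rewrite subE !cstE scale0r => h.
rewrite [r^-1 + _]addrC [r^-1 * _]mulrC in h *.
rewrite serre1E; apply: serre1_add; rewrite -?serre1E ?invr_neq0 //
  ?tM ?mulr1 ?mul1r ?invrK ?(mulrC s^-1 r).
- by rewrite om'_f_diag tZr.
- by rewrite om'_f_up // tZr.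
- by rewrite om'_f_down // tZr.
- by rewrite -!tZr -tBr -tDr [X in _ (x) X]h t0r.
- rewrite (om'C j i) -[_ * om' j _ * _]mulrA (om'C j i) !mulrA.
  by rewrite -!tZl -tBl -tDl [X in X (x) _]h t0l.
Qed.

Let serre_f2 (i j : 'I_m) : j = i.+1 :> nat ->
  DF i * DF j * DF j - (r^-1 + s^-1) *: (DF j * DF i * DF j)
    + (r^-1 * s^-1) *: (DF j * DF j * DF i) = 0.
Proof.
move=> ij; have /= := gl_relE (R7_2 r s ij).
rewrite subE !cstE scale0r => h.
rewrite [r^-1 + _]addrC [r^-1 * _]mulrC in h *.
rewrite serre2E; apply: serre2_add; rewrite -?serre2E ?invr_neq0 //
  ?tM ?mulr1 ?mul1r ?invrK ?(mulrC s^-1 r).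
- by rewrite om'_f_diag tZr.
- by rewrite om'_f_up // tZr.
- by rewrite om'_f_down // tZr.
- by rewrite -!tZr -tBr -tDr [X in _ (x) X]h t0r.
- rewrite -[om' j _ * om' j _ * om' i _]mulrA (om'C j i).
  rewrite [om' j _ * (om' i _ * om' j _)]mulrA (om'C j i).
  by rewrite -!tZl -tBl -tDl [X in X (x) _]h t0l.
Qed.

Lemma Delta_gen_rel x y :
  gl_rel r s x y -> ev (@Delta_gen K m r s) x = ev (@Delta_gen K m r s) y.
Proof.
case=> {x y} [g h gT hT|i|i|i j|i j|i j|i j|i j|i j ij|i j ij|i j ij|i j ij
  |i j ij|i j ij]; rewrite [LHS]/= [RHS]/= ?subE ?cstE ?scale0r.
- by rewrite !Delta_gen_torus // !tM torusC.
- have /= h := gl_relE (R1_a r s i).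
  by rewrite tM [ua i false * _]h !scale1r.
- have /= h := gl_relE (R1_b r s i).
  by rewrite tM [ub i false * _]h !scale1r.
- rewrite mulrDl mulrDr !tM mulr1 mul1r ua_om ua_e tZl tZr.
  by rewrite scalerDr.
- rewrite mulrDl mulrDr !tM mulr1 mul1r ua_om' ua_f tZl tZr.
  by rewrite scalerDr.
- rewrite mulrDl mulrDr !tM mulr1 mul1r ub_om ub_e tZl tZr.
  by rewrite scalerDr.
- rewrite mulrDl mulrDr !tM mulr1 mul1r ub_om' ub_f tZl tZr.
  by rewrite scalerDr.
- by rewrite !tM; apply: De_Df.
- exact: De_comm.
- exact: Df_comm.
- exact: serre_e1.
- exact: serre_e2.
- exact: serre_f1.
- exact: serre_f2.
Qed.

Lemma DeltaP :
  [/\ forall a (x y : U), Delta (a *: x + y) = a *: Delta x + Delta y,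
      Delta (1 : U) = 1,
      forall x y : U, Delta (x * y) = Delta x * Delta y
    & [/\ forall j, Delta (ue j) = ue j (x) 1 + om j false (x) ue j,
          forall j, Delta (uf j) = 1 (x) uf j + uf j (x) om' j false,
          forall i v, Delta (ua i v) = ua i v (x) ua i v
        & forall i v, Delta (ub i v) = ub i v (x) ub i v]].
Proof.
case: (plift_morph Delta_gen_rel) => hl h1 hM hg; split=> //.
by split=> *; apply: hg.
Qed.

End Coproduct.

Section Subspaces.
Variables (K : fieldType) (A : algType K).

Inductive subalg (S : A -> Prop) : A -> Prop :=
| sub_gen x : S x -> subalg S x
| sub_cst (c : K) : subalg S c%:A
| sub_add x y : subalg S x -> subalg S y -> subalg S (x + y)
| sub_mul x y : subalg S x -> subalg S y -> subalg S (x * y).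

Definition lspan (S : A -> Prop) (x : A) : Prop :=
  exists l : seq (K * A),
    (forall p, p \in l -> S p.2) /\ x = \sum_(p <- l) p.1 *: p.2.

Definition basis_of_subspace (S : A -> Prop) (d : nat) (u : 'I_d -> A) : Prop :=
  [/\ forall k, S (u k),
      forall c : 'I_d -> K, \sum_k c k *: u k = 0 -> forall k, c k = 0
    & forall x, S x -> exists c : 'I_d -> K, x = \sum_k c k *: u k].

End Subspaces.

Section Pairing.
Variables (K : fieldType) (m : nat) (r s : K).

Local Notation U := (Ugl m r s).
Local Notation ue := (@ue K m r s).
Local Notation uf := (@uf K m r s).
Local Notation ua := (@ua K m r s).
Local Notation ub := (@ub K m r s).
Local Notation om := (@om K m r s).
Local Notation om' := (@om' K m r s).

(* [true] marks the inverse of a group-like generator. *)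
Inductive bgen : Type :=
| BE of 'I_m
| BW of 'I_m & bool
| BA of bool.

Inductive bgen' : Type :=
| BF of 'I_m
| BW' of 'I_m & bool
| BB of bool.

Definition bval (g : bgen) : U :=
  match g with
  | BE j => ue j
  | BW j v => om j v
  | BA v => ua ord_max v
  end.

Definition bval' (g : bgen') : U :=
  match g with
  | BF j => uf j
  | BW' j v => om' j v
  | BB v => ub ord_max v
  end.

Definition Bplus : U -> Prop := subalg (fun x => exists g, x = bval g).
Definition Bminus : U -> Prop := subalg (fun x => exists g, x = bval' g).

Definition inv_if (v : bool) (c : K) : K := if v then c^-1 else c.

Definition gpair (g' : bgen') (g : bgen) : K :=
  match g', g with
  | BF i, BE j => (i == j)%:R / (s - r)
  | BW' i v, BW j w => inv_if (v (+) w)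
      (r ^ inner (eps (lo j)) (alpha i) * s ^ inner (eps (hi j)) (alpha i))
  | BB _, BA _ => 1
  | BB v, BW j w => inv_if (v (+) w) (s ^ (- inner (eps ord_max) (alpha j)))
  | BW' i v, BA w => inv_if (v (+) w) (r ^ inner (eps ord_max) (alpha i))
  | _, _ => 0
  end.

(* [form] is only meaningful on [Bminus] x [Bplus].  A list [w] of pairs with
   [Delta h = \sum_(p <- w) p.1 (x) p.2] plays the role of Sweedler's
   [\sum h_(1) (x) h_(2)]; on [Bminus] the coproduct is the opposite one. *)
Record hopf_pairing (form : U -> U -> K) : Prop := HopfPairing {
  hp_linl : forall a x y h, Bminus x -> Bminus y -> Bplus h ->
    form (a *: x + y) h = a * form x h + form y h;
  hp_linr : forall a x h k, Bminus x -> Bplus h -> Bplus k ->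
    form x (a *: h + k) = a * form x h + form x k;
  hp_1l : forall h, Bplus h -> form 1 h = counit h;
  hp_1r : forall x, Bminus x -> form x 1 = counit x;
  hp_mulr : forall x h k (w : seq (U * U)), Bminus x -> Bplus h -> Bplus k ->
    (forall p, p \in w -> Bminus p.1 /\ Bminus p.2) ->
    tflip (Delta x) = \sum_(p <- w) p.1 (x) p.2 ->
    form x (h * k) = \sum_(p <- w) form p.1 h * form p.2 k;
  hp_mull : forall x y h (w : seq (U * U)), Bminus x -> Bminus y -> Bplus h ->
    (forall p, p \in w -> Bplus p.1 /\ Bplus p.2) ->
    Delta h = \sum_(p <- w) p.1 (x) p.2 ->
    form (x * y) h = \sum_(p <- w) form x p.1 * form y p.2;
  hp_gen : forall g' g, form (bval' g') (bval g) = gpair g' g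
}.

Definition Uplus (z : Qplus m) : U -> Prop :=
  lspan (fun x => exists2 l : seq 'I_m,
    \sum_(i <- l) alpha i = Qval z & x = \prod_(i <- l) ue i).

Definition Uminus (z : Qplus m) : U -> Prop :=
  lspan (fun x => exists2 l : seq 'I_m,
    \sum_(i <- l) alpha i = Qval z & x = \prod_(i <- l) uf i).

Definition dual_bases (form : U -> U -> K) (d : Qplus m -> nat)
    (u v : forall z, 'I_(d z) -> U) : Prop :=
  forall z,
  [/\ basis_of_subspace (Uplus z) (@u z),
      basis_of_subspace (Uminus z) (@v z)
    & forall k l, form (v z k) (u z l) = (k == l)%:R].

Definition zpow (x x' : U) (k : int) : U :=
  match k with Posz p => x ^+ p | Negz p => x' ^+ p.+1 end.

Definition om_lat (x : Lat m) : U :=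
  (\prod_(j < m) zpow (om j false) (om j true) (acoef x (lo j)))
  * zpow (ua ord_max false) (ua ord_max true) (acoef x ord_max).

Definition om'_lat (x : Lat m) : U :=
  (\prod_(j < m) zpow (om' j false) (om' j true) (acoef x (lo j)))
  * zpow (ub ord_max false) (ub ord_max true) (acoef x ord_max).

Definition fcoef (form : U -> U -> K) (x y : Lat m) : K :=
  (form (om'_lat y) (om_lat x))^-1.

End Pairing.

Record amodule (K : fieldType) (A : algType K) := AModule {
  acarrier :> lmodType K;
  act : A -> acarrier -> acarrier;
  act_linl : forall (c : K) (x y : A) (w : acarrier),
    act (c *: x + y) w = c *: act x w + act y w;
  act_linr : forall (c : K) (x : A) (w w' : acarrier),
    act x (c *: w + w') = c *: act x w + act x w';
  act1 : forall w : acarrier, act 1 w = w;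
  actM : forall (x y : A) (w : acarrier), act (x * y) w = act x (act y w)
}.

Section CategoryO.
Variables (K : fieldType) (m : nat) (r s : K).

Local Notation U := (Ugl m r s).
Implicit Types M N : amodule U.

Definition wt_space M (x : Lat m) (w : M) : Prop :=
  forall i, act (ua r s i false) w = r ^ inner (eps i) x *: w
         /\ act (ub r s i false) w = s ^ inner (eps i) x *: w.

Definition wt M : set (Lat m) := [set x | exists2 w : M, wt_space x w & w != 0].

(* [c] is a decomposition of [w] as a finite sum of weight vectors. *)
Definition wt_dec M (w : M) (c : Lat m -> M) : Prop :=
  [/\ forall x, wt_space x (c x),
      finite_set [set x | c x != 0]
    & w = \sum_(x \in [set: Lat m]) c x].

Definition Qpos : set (Lat m) := range (@Qval m).

Record catO M : Prop := CatO {
  catO_sum : forall w : M, exists! c, wt_dec w c;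
  catO_fin : forall x, wt M x -> exists p (e : 'I_p -> M),
    (forall k, wt_space x (e k)) /\
    forall w, wt_space x w -> exists c : 'I_p -> K, w = \sum_k c k *: e k;
  catO_bound : exists F : seq (Lat m),
    forall x, wt M x -> exists2 y, y \in F & Qpos (y - x)
}.

Definition wt_comp M (w : M) (x : Lat m) : M :=
  xget (fun=> 0) [set c | wt_dec w c] x.

Section RMatrix.
Variable form : U -> U -> K.
Variables (d : Qplus m -> nat) (u v : forall z, 'I_(d z) -> U).

(* On category O the components below have finite support, so that both
   functions are bilinear and the [tlift]s are linear maps; elsewhere the
   values of [ftilde] and [Theta] are irrelevant. *)
Definition ftilde N' N : tensor N' N -> tensor N' N :=
  tlift (fun w' w => \sum_(x \in [set: Lat m]) \sum_(y \in [set: Lat m])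
    fcoef form x y *: (wt_comp w' x (x) wt_comp w y)).

Definition Theta N' N : tensor N' N -> tensor N' N :=
  tlift (fun w' w => \sum_(z \in [set: Qplus m])
    \sum_(k < d z) act (v k) w' (x) act (u k) w).

Definition Rmat N N' (t : tensor N N') : tensor N' N :=
  Theta (ftilde (tflip t)).

(* The triple tensor product is [(M (x) M') (x) M'']. *)
Definition R12 N N' L : tensor (tensor N N') L -> tensor (tensor N' N) L :=
  tmap (@Rmat N N') id.

Definition R23 L N N' : tensor (tensor L N) N' -> tensor (tensor L N') N :=
  fun t => tassocV (tmap id (@Rmat N N') (tassoc t)).

End RMatrix.

End CategoryO.

Arguments R12 {K m r s} form {d} u v N N' L t.
Arguments R23 {K m r s} form {d} u v L N N' t.

(* Main.v *)
From HB Require Import structures.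
Require Import Defs.
From mathcomp Require Import all_boot all_order all_algebra.
From mathcomp Require Import zify ring.
From mathcomp Require Import boolp classical_sets functions cardinality fsbigop.

Set Implicit Arguments.
Unset Strict Implicit.
Unset Printing Implicit Defensive.

Import Order.TTheory GRing.Theory Num.Theory.
Local Open Scope ring_scope.

(** The second leg of (1 (x) Delta)(Theta) consists of elements Delta(u) with u in U^+, which is why
    commutation with the Delta(e_i) suffices. The obstacle is that [form] is constrained only
    through Sweedler decompositions that stay inside [Bminus] and [Bplus]. The adjoints p and p' are
    therefore computed on words: an explicit list for the opposite coproduct of F_l yields the
    recursions [dR] and [dL], and the same recursions come out when e_i is commuted through F_l
    letter by letter with (R4). Comparing the two gives the commutator formula. The torus factors
    left by the coproducts drop out because the pairing of U^- with U^+ ignores a factor omega_i to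
    the right of its U^+ argument and a factor omega_i' to the right of its U^- argument. Theta is
    an infinite sum of operators, but on a given vector only finitely many degrees act, so every
    identity is checked on finite lists of degrees. *)

(* Write [H] for the composite of the two braidings that carry [C] past [A (x) B].
   Since the coproduct of [U^+] is dual to the product of [U^-], one has
   [(1 (x) Delta)(Theta) = sum v_i v_j (x) u_i omega_j (x) u_j], and moving the
   torus part through [f] identifies [H], on vectors of total weight [kappa] in
   [A (x) B] and of weight [nu] in [C], with [f(nu, kappa) (1 (x) Delta)(Theta)].
   Thus the Yang-Baxter equation says that [H] is natural with respect to
   [R : M (x) M' -> M' (x) M].  As [R] preserves the total weight, it remains to
   see that [R] commutes with [Delta(e_i)].  This rests on the commutator formula
   [[e_i, y] = p(y) omega_i' - omega_i p'(y)] on [U^-], where [p] and [p'] are the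
   adjoints of right and left multiplication by [e_i] on [U^+]. *)

(** * Tensor products and finite sums *)

Section LinearMaps.
Variables (K : fieldType) (V W : lmodType K) (f : V -> W).
Hypothesis f_lin : linear f.

(** Theta, f and R are linear only under hypotheses of category O, so they remain bare functions.
    Packing them locally gives access to the general facts on linear maps. *)
Let F : {linear V -> W} := HB.pack f (GRing.isLinear.Build _ _ _ _ f f_lin).

Lemma lin0 : f 0 = 0. Proof. exact: (linear0 F). Qed.
Lemma linD x y : f (x + y) = f x + f y. Proof. exact: (linearD F). Qed.
Lemma linN x : f (- x) = - f x. Proof. exact: (linearN F). Qed.
Lemma linZ a x : f (a *: x) = a *: f x. Proof. exact: (linearZZ F). Qed.
Lemma lin_sum I (s : seq I) (P : pred I) (g : I -> V) :
  f (\sum_(i <- s | P i) g i) = \sum_(i <- s | P i) f (g i).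
Proof. exact: (linear_sum F). Qed.

End LinearMaps.

Lemma linear_comp K (U V W : lmodType K) (f : V -> W) (g : U -> V) :
  linear f -> linear g -> linear (f \o g).
Proof. by move=> hf hg a x y /=; rewrite hg hf. Qed.

Section TensorLinear.
Variable K : fieldType.
Implicit Types A B C D : lmodType K.

Lemma tpDl A B (x x' : A) (y : B) : (x + x') (x) y = x (x) y + x' (x) y.
Proof. by case: (@tpure_bilin K A B). Qed.

Lemma tpDr A B (x : A) (y y' : B) : x (x) (y + y') = x (x) y + x (x) y'.
Proof. by case: (@tpure_bilin K A B). Qed.

Lemma tpZl A B a (x : A) (y : B) : (a *: x) (x) y = a *: (x (x) y).
Proof. by case: (@tpure_bilin K A B). Qed.

Lemma tpZr A B a (x : A) (y : B) : x (x) (a *: y) = a *: (x (x) y).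
Proof. by case: (@tpure_bilin K A B). Qed.

Lemma tpure_linl A B (y : B) : linear (fun x : A => x (x) y).
Proof. by move=> a x x'; rewrite tpDl tpZl. Qed.

Lemma tpure_linr A B (x : A) : linear (fun y : B => x (x) y).
Proof. by move=> a y y'; rewrite tpDr tpZr. Qed.

Definition tp0l A B y := lin0 (@tpure_linl A B y).
Definition tp0r A B x := lin0 (@tpure_linr A B x).
Definition tpNl A B y x := linN (@tpure_linl A B y) x.

Lemma tp_suml A B (y : B) I (s : seq I) (P : pred I) (g : I -> A) :
  (\sum_(i <- s | P i) g i) (x) y = \sum_(i <- s | P i) g i (x) y.
Proof. exact: (lin_sum (tpure_linl y)). Qed.

Lemma tp_sumr A B (x : A) I (s : seq I) (P : pred I) (g : I -> B) :
  x (x) (\sum_(i <- s | P i) g i) = \sum_(i <- s | P i) x (x) g i.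
Proof. exact: (lin_sum (tpure_linr x)). Qed.

Lemma linear_bilin A B C (g : A -> B -> C) :
  (forall y, linear (g^~ y)) -> (forall x, linear (g x)) -> bilin g.
Proof.
move=> hl hr; split=> *.
- exact: (linD (hl _)).
- exact: (linD (hr _)).
- exact: (linZ (hl _)).
- exact: (linZ (hr _)).
Qed.

Lemma tmap_bilin A B C D (f : A -> C) (g : B -> D) :
  linear f -> linear g -> bilin (fun x y => f x (x) g y).
Proof.
move=> hf hg; apply: linear_bilin => [y|x] a z z'.
  by rewrite hf tpDl tpZl.
by rewrite hg tpDr tpZr.
Qed.

Lemma tmapE A B C D (f : A -> C) (g : B -> D) x y :
  linear f -> linear g -> tmap f g (x (x) y) = f x (x) g y.
Proof. by move=> hf hg; rewrite /tmap tlift_pure //; apply: tmap_bilin. Qed.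

Lemma tmap_linear A B C D (f : A -> C) (g : B -> D) :
  linear f -> linear g -> linear (tmap f g).
Proof. by move=> hf hg; apply/tlift_linear/tmap_bilin. Qed.

Lemma tflip_linear A B : linear (@tflip K A B).
Proof.
apply/tlift_linear/linear_bilin => [y|x]; first exact: tpure_linr.
exact: tpure_linl.
Qed.

Lemma tassoc_linear A B C : linear (@tassoc K A B C).
Proof.
have hb z : bilin (fun (x : A) (y : B) => x (x) (y (x) (z : C))).
  by apply: linear_bilin => [y|x] a w w'; rewrite ?tpDl ?tpZl ?tpDr ?tpZr.
apply/tlift_linear/linear_bilin => [z|t]; first exact/tlift_linear/hb.
move=> a z z'; elim/tensor_ind: t => [|t t' h h'|x y].
- by rewrite !(tlift0 (hb _)) scaler0 addr0.
- by rewrite !(tliftD (hb _)) h h' scalerDr addrACA.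
- by rewrite !(tlift_pure (hb _)) !tpDr !tpZr.
Qed.

Lemma tassocV_linear A B C : linear (@tassocV K A B C).
Proof.
have hb x : bilin (fun (y : B) (z : C) => ((x : A) (x) y) (x) z).
  by apply: linear_bilin => [y|y] a w w'; rewrite ?(tpDl, tpDr, tpZl, tpZr).
apply/tlift_linear/linear_bilin => [t|x]; last exact/tlift_linear/hb.
move=> a z z'; elim/tensor_ind: t => [|t t' h h'|x y].
- by rewrite !(tlift0 (hb _)) scaler0 addr0.
- by rewrite !(tliftD (hb _)) h h' scalerDr addrACA.
- by rewrite !(tlift_pure (hb _)) !(tpDl, tpZl).
Qed.

Lemma tensor_linear_eq A B C (f g : tensor A B -> C) : linear f -> linear g ->
  (forall x y, f (x (x) y) = g (x (x) y)) -> f =1 g.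
Proof.
move=> hf hg fg; elim/tensor_ind => [|t t' h h'|x y] //.
  by rewrite !lin0.
by rewrite !linD // h h'.
Qed.

Lemma tassocVK A B C : cancel (@tassocV K A B C) (@tassoc K A B C).
Proof.
apply: tensor_linear_eq => //.
  by apply: linear_comp; [apply: tassoc_linear | apply: tassocV_linear].
move=> x t; elim/tensor_ind: t => [|t t' h h'|y z].
- by rewrite tp0r !(lin0 (@tassocV_linear _ _ _), lin0 (@tassoc_linear _ _ _)).
- by rewrite tpDr !(linD (@tassocV_linear _ _ _), linD (@tassoc_linear _ _ _)) h h'.
- by rewrite tassocV_pure tassoc_pure.
Qed.

End TensorLinear.

Section FiniteSums.
Variable K : fieldType.
Implicit Types (T : choiceType) (V W : lmodType K).
Local Open Scope classical_set_scope.

Lemma fsum_seq T V (s : seq T) (F : T -> V) : uniq s ->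
  (forall z, z \notin s -> F z = 0) ->
  \sum_(z \in [set: T]) F z = \sum_(z <- s) F z.
Proof.
move=> us hs; rewrite (fsbigE s) //=; last by move=> z _; apply: hs.
by apply: eq_bigl => z; rewrite in_setT.
Qed.

Lemma fin_seq T (S : set T) : finite_set S ->
  exists2 s : seq T, uniq s & forall z, S z -> z \in s.
Proof.
case/finite_seqP => s ->; exists (undup s); first exact: undup_uniq.
by move=> z /=; rewrite mem_undup.
Qed.

Lemma fsum_fin T V (F : T -> V) : finite_set [set z | F z != 0] ->
  exists2 s : seq T, uniq s &
    (forall z, z \notin s -> F z = 0) /\ \sum_(z \in [set: T]) F z = \sum_(z <- s) F z.
Proof.
case/fin_seq => s us hs; have h z : z \notin s -> F z = 0.
  by move=> zs; apply/eqP/negPn/negP => /hs; rewrite (negbTE zs).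
by exists s => //; split=> //; apply: fsum_seq.
Qed.

(** A sum with infinite support is 0 by convention, so additivity needs both supports to be
    finite. *)
Lemma fsumD T V (F G : T -> V) :
  finite_set [set z | F z != 0] -> finite_set [set z | G z != 0] ->
  \sum_(z \in [set: T]) (F z + G z) =
  \sum_(z \in [set: T]) F z + \sum_(z \in [set: T]) G z.
Proof.
move=> /fin_seq[s us hs] /fin_seq[t ut ht].
have hF z : z \notin undup (s ++ t) -> F z = 0.
  rewrite mem_undup mem_cat negb_or => /andP[zs _]; apply/eqP/negPn/negP.
  by move/hs; rewrite (negbTE zs).
have hG z : z \notin undup (s ++ t) -> G z = 0.
  rewrite mem_undup mem_cat negb_or => /andP[_ zs]; apply/eqP/negPn/negP.
  by move/ht; rewrite (negbTE zs).
rewrite !(@fsum_seq _ _ (undup (s ++ t))) ?undup_uniq ?big_split //.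
by move=> z zs; rewrite hF // hG // addr0.
Qed.

Lemma lin_fsum T V W (f : V -> W) (F : T -> V) : linear f ->
  finite_set [set z | F z != 0] ->
  f (\sum_(z \in [set: T]) F z) = \sum_(z \in [set: T]) f (F z).
Proof.
move=> hf /fsum_fin[s us [h ->]]; rewrite (lin_sum hf); apply/esym/fsum_seq => //.
by move=> z /h ->; rewrite (lin0 hf).
Qed.

Lemma fsum1 T V (z0 : T) (F : T -> V) : (forall z, z != z0 -> F z = 0) ->
  \sum_(z \in [set: T]) F z = F z0.
Proof.
move=> h; rewrite (@fsum_seq _ _ [:: z0]) ?big_seq1 // => z.
by rewrite inE => /h.
Qed.

Lemma fsum_closed T V (P : V -> Prop) (F : T -> V) :
  P 0 -> (forall x y, P x -> P y -> P (x + y)) -> (forall z, P (F z)) ->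
  P (\sum_(z \in [set: T]) F z).
Proof. by move=> P0 PD PF; elim/big_ind: _. Qed.

End FiniteSums.

(** * The pairing on words *)

Section Subalgebras.
Variables (K : fieldType) (A : algType K) (S : A -> Prop).

Lemma subalg1 : subalg S 1.
Proof. by rewrite -[1]scale1r; apply: sub_cst. Qed.

Lemma subalg_scale c x : subalg S x -> subalg S (c *: x).
Proof. by rewrite -[x in c *: x]mul1r scalerAl; apply/sub_mul/sub_cst. Qed.

Lemma subalg0 : subalg S 0.
Proof. by rewrite -(scale0r 1); apply: sub_cst. Qed.

Lemma subalg_prod I (l : seq I) (g : I -> A) :
  (forall i, subalg S (g i)) -> subalg S (\prod_(i <- l) g i).
Proof.
move=> h; elim/big_ind: _ => //; first exact: subalg1.
exact: sub_mul.
Qed.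

Lemma lspan_ind (P : A -> Prop) : P 0 ->
  (forall c x y, S x -> P y -> P (c *: x + y)) -> forall x, lspan S x -> P x.
Proof.
move=> P0 PZ _ [l [hl ->]]; elim: l hl => [|p l ih] hl; first by rewrite big_nil.
rewrite big_cons; apply: PZ; first by apply: hl; rewrite mem_head.
by apply: ih => q ql; apply: hl; rewrite inE ql orbT.
Qed.

Lemma lspan_gen x : S x -> lspan S x.
Proof.
exists [:: (1, x)]; rewrite big_seq1 scale1r; split=> // p.
by rewrite inE => /eqP ->.
Qed.

Lemma lspan0 : lspan S 0.
Proof. by exists [::]; rewrite big_nil; split=> // p; rewrite in_nil. Qed.

Lemma lspanD x y : lspan S x -> lspan S y -> lspan S (x + y).
Proof.
move=> [l [hl ->]] [l' [hl' ->]]; exists (l ++ l'); rewrite big_cat; split=> // p.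
by rewrite mem_cat => /orP[/hl|/hl'].
Qed.

Lemma lspanZ c x : lspan S x -> lspan S (c *: x).
Proof.
move=> [l [hl ->]]; exists [seq (c * p.1, p.2) | p <- l]; split.
  by move=> _ /mapP[p /hl hp ->].
by rewrite big_map scaler_sumr; apply: eq_bigr => p _; rewrite scalerA.
Qed.

End Subalgebras.

Lemma lspan_map (K : fieldType) (A : algType K) (S T : A -> Prop) (f : A -> A) :
  linear f -> (forall x, S x -> lspan T (f x)) ->
  forall x, lspan S x -> lspan T (f x).
Proof.
move=> hf h; apply: lspan_ind => [|c x y Sx Ty].
  by rewrite (lin0 hf); apply: lspan0.
by rewrite hf; apply/lspanD/Ty/lspanZ/h.
Qed.

(** This makes the opposite coproduct multiplicative, as the induction over f-words requires. *)
Lemma tflipM (K : fieldType) (A B : algType K) (t u : tensor A B) :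
  tflip (t * u) = tflip t * tflip u.
Proof.
have hl := @tflip_linear K A B.
elim/tensor_ind: t => [|t t' h h'|x y]; first by rewrite mul0r (lin0 hl) mul0r.
  by rewrite mulrDl !(linD hl) h h' mulrDl.
elim/tensor_ind: u => [|u u' h h'|x' y']; first by rewrite mulr0 (lin0 hl) mulr0.
  by rewrite mulrDr !(linD hl) h h' mulrDr.
by rewrite [_ * _]tmul_pp !tflip_pure [RHS]tmul_pp.
Qed.

(** * Degrees in the positive part of the root lattice *)

Section RootLattice.
Variable m : nat.

Local Notation acoef := (@acoef m).

Lemma acoefD (x y : Lat m) (i : 'I_m.+1) : acoef (x + y) i = acoef x i + acoef y i.
Proof. by rewrite /acoef -big_split; apply: eq_bigr => k _; rewrite ffunE. Qed.

Lemma acoefN (x : Lat m) (i : 'I_m.+1) : acoef (- x) i = - acoef x i.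
Proof. by rewrite /acoef -sumrN; apply: eq_bigr => k _; rewrite ffunE. Qed.

Lemma acoef_eps (k i : 'I_m.+1) : acoef (eps k) i = (k <= i)%N%:Z.
Proof.
rewrite /acoef; under eq_bigr => l _ do rewrite ffunE.
rewrite big_mkcond (bigD1 k) //= eqxx big1 => [|l /negbTE ->]; last by case: ifP.
by rewrite addr0; case: ifP.
Qed.

Lemma acoef_alpha (j : 'I_m) (i : 'I_m.+1) : acoef (alpha j) i = (i == lo j)%:Z.
Proof.
rewrite /alpha acoefD acoefN !acoef_eps -val_eqE /= /bump /= add1n.
by lia.
Qed.

Lemma acoef_sum I (l : seq I) (g : I -> Lat m) (i : 'I_m.+1) :
  acoef (\sum_(k <- l) g k) i = \sum_(k <- l) acoef (g k) i.
Proof.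
elim: l => [|k l ih]; last by rewrite !big_cons acoefD ih.
by rewrite !big_nil /acoef big1 // => k _; rewrite ffunE.
Qed.

Definition qadd (z z' : Qplus m) : Qplus m := [ffun j => (z j + z' j)%N].
Definition qroot (i : 'I_m) : Qplus m := [ffun j => nat_of_bool (j == i)].
Definition wdeg (l : seq 'I_m) : Qplus m := [ffun j => count_mem j l].

Lemma QvalD z z' : Qval (qadd z z') = Qval z + Qval z'.
Proof.
by rewrite /Qval -big_split; apply: eq_bigr => j _; rewrite ffunE mulrnDr.
Qed.

Lemma Qval_root i : Qval (qroot i) = alpha i.
Proof.
rewrite /Qval (bigD1 i) //= ffunE eqxx mulr1n big1 ?addr0 // => j /negbTE ji.
by rewrite ffunE ji.
Qed.

Lemma acoef_Qval z j : acoef (Qval z) (lo j) = (z j)%:Z.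
Proof.
have aM (x : Lat m) k (i : 'I_m.+1) : acoef (x *+ k) i = acoef x i *+ k.
  by elim: k => [|k ih]; [rewrite !mulr0n /acoef big1 // => l _; rewrite ffunE | rewrite !mulrS acoefD ih].
rewrite acoef_sum (bigD1 j) //= aM acoef_alpha eqxx big1 => [|i ij].
  by rewrite addr0 natz.
by rewrite aM acoef_alpha -val_eqE /= val_eqE eq_sym (negbTE ij) mul0rn.
Qed.

Lemma Qval_inj : injective (@Qval m).
Proof.
move=> z z' h; apply/ffunP => j; apply/eqP.
by rewrite -eqz_nat -!acoef_Qval h.
Qed.

Lemma wdeg_cons i l : wdeg (i :: l) = qadd (qroot i) (wdeg l).
Proof. by apply/ffunP => j; rewrite !ffunE /= eq_sym. Qed.

Lemma wdeg_cat l l' : wdeg (l ++ l') = qadd (wdeg l) (wdeg l').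
Proof. by apply/ffunP => j; rewrite !ffunE count_cat. Qed.

(** The recursions on words delete or move letters, so they track degrees through permutations. *)
Lemma perm_wdeg l l' : perm_eq l l' <-> wdeg l = wdeg l'.
Proof.
split=> [/permP h|h]; first by apply/ffunP => j; rewrite !ffunE h.
by apply/allP => j _; have /ffunP/(_ j) := h; rewrite !ffunE => /eqP.
Qed.

Lemma wdegE l : \sum_(i <- l) alpha i = Qval (wdeg l).
Proof.
elim: l => [|i l ih]; last by rewrite big_cons ih wdeg_cons QvalD Qval_root.
by rewrite big_nil /Qval big1 // => j _; rewrite ffunE.
Qed.

Lemma sum_alpha l z : \sum_(i <- l) alpha i = Qval z <-> wdeg l = z.
Proof. by rewrite wdegE; split=> [/Qval_inj|->]. Qed.

Lemma qaddC : commutative qadd.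
Proof. by move=> x y; apply/ffunP => j; rewrite !ffunE addnC. Qed.

Lemma qaddI z : injective (qadd z).
Proof.
by move=> x y /ffunP h; apply/ffunP => j; have := h j; rewrite !ffunE => /addnI.
Qed.

Lemma qsub_root i (z : Qplus m) : z i != 0%N -> exists y, z = qadd (qroot i) y.
Proof.
move=> zi; exists [ffun j => (z j - (j == i))%N]; apply/ffunP => j; rewrite !ffunE.
by case: eqP => [->|_] /=; [rewrite add1n subn1 prednK // lt0n | rewrite add0n subn0].
Qed.

End RootLattice.

(** * Words in the e_i and f_i, and their coproducts *)

Section WordCalculus.
Variables (K : fieldType) (m : nat) (r s : K).
Hypotheses (r0 : r != 0) (s0 : s != 0).

Local Notation U := (Ugl m r s).
Local Notation ue := (@ue K m r s).
Local Notation uf := (@uf K m r s).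
Local Notation ua := (@ua K m r s).
Local Notation ub := (@ub K m r s).
Local Notation om := (@om K m r s).
Local Notation om' := (@om' K m r s).
Local Notation Bplus := (@Bplus K m r s).
Local Notation Bminus := (@Bminus K m r s).
Local Notation Uplus := (@Uplus K m r s).
Local Notation Uminus := (@Uminus K m r s).

Definition eword (l : seq 'I_m) : U := \prod_(i <- l) ue i.
Definition fword (l : seq 'I_m) : U := \prod_(i <- l) uf i.
Definition omword (l : seq 'I_m) : U := \prod_(i <- l) om i false.

Lemma eword_cons i l : eword (i :: l) = ue i * eword l.
Proof. exact: big_cons. Qed.

Lemma fword_cons i l : fword (i :: l) = uf i * fword l.
Proof. exact: big_cons. Qed.

Lemma omword_cons i l : omword (i :: l) = om i false * omword l.
Proof. exact: big_cons. Qed.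

Lemma eword_rcons l i : eword (rcons l i) = eword l * ue i.
Proof. by rewrite /eword -cats1 big_cat big_seq1. Qed.

Lemma Bplus_ue i : Bplus (ue i).
Proof. by apply: sub_gen; exists (BE i). Qed.

Lemma Bplus_om i v : Bplus (om i v).
Proof. by apply: sub_gen; exists (BW i v). Qed.

Lemma Bminus_uf i : Bminus (uf i).
Proof. by apply: sub_gen; exists (BF i). Qed.

Lemma Bminus_om' i v : Bminus (om' i v).
Proof. by apply: sub_gen; exists (BW' i v). Qed.

Lemma Bplus_eword l : Bplus (eword l).
Proof. exact/subalg_prod/Bplus_ue. Qed.

Lemma Bplus_omword l : Bplus (omword l).
Proof. by apply: subalg_prod => i; apply: Bplus_om. Qed.

Lemma Bminus_fword l : Bminus (fword l).
Proof. exact/subalg_prod/Bminus_uf. Qed.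

Lemma UplusP z x : Uplus z x <-> lspan (fun y => exists2 l, wdeg l = z & y = eword l) x.
Proof.
by split; apply: lspan_map => // y [l h ->]; apply: lspan_gen; exists l => //;
  apply/sum_alpha.
Qed.

Lemma UminusP z x : Uminus z x <-> lspan (fun y => exists2 l, wdeg l = z & y = fword l) x.
Proof.
by split; apply: lspan_map => // y [l h ->]; apply: lspan_gen; exists l => //;
  apply/sum_alpha.
Qed.

Lemma Uplus_word l : Uplus (wdeg l) (eword l).
Proof. by apply/UplusP/lspan_gen; exists l. Qed.

Lemma Uminus_word l : Uminus (wdeg l) (fword l).
Proof. by apply/UminusP/lspan_gen; exists l. Qed.

Lemma Uplus_Bplus z x : Uplus z x -> Bplus x.
Proof.
move/UplusP; apply: lspan_ind => [|c x' y [l _ ->] hy]; first exact: subalg0.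
by apply: sub_add => //; apply/subalg_scale/Bplus_eword.
Qed.

Lemma Uminus_Bminus z x : Uminus z x -> Bminus x.
Proof.
move/UminusP; apply: lspan_ind => [|c x' y [l _ ->] hy]; first exact: subalg0.
by apply: sub_add => //; apply/subalg_scale/Bminus_fword.
Qed.

Lemma UminusM z z' x y : Uminus z x -> Uminus z' y -> Uminus (qadd z z') (x * y).
Proof.
move=> /UminusP hx /UminusP hy; move: x hx; apply: lspan_ind => [|c x w [l hl ->] hw].
  by rewrite mul0r; apply: lspan0.
rewrite mulrDl; apply: lspanD => //; rewrite -scalerAl; apply: lspanZ.
move: y hy {hw}; apply: lspan_ind => [|c' y w' [l' hl' ->] hw'].
  by rewrite mulr0; apply: lspan0.
rewrite mulrDr; apply: lspanD => //; rewrite -scalerAr; apply: lspanZ.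
by rewrite /fword -big_cat -hl -hl' -wdeg_cat; apply: Uminus_word.
Qed.

Lemma UplusM z z' x y : Uplus z x -> Uplus z' y -> Uplus (qadd z z') (x * y).
Proof.
move=> /UplusP hx /UplusP hy; move: x hx; apply: lspan_ind => [|c x w [l hl ->] hw].
  by rewrite mul0r; apply: lspan0.
rewrite mulrDl; apply: lspanD => //; rewrite -scalerAl; apply: lspanZ.
move: y hy {hw}; apply: lspan_ind => [|c' y w' [l' hl' ->] hw'].
  by rewrite mulr0; apply: lspan0.
rewrite mulrDr; apply: lspanD => //; rewrite -scalerAr; apply: lspanZ.
by rewrite /eword -big_cat -hl -hl' -wdeg_cat; apply: Uplus_word.
Qed.

Lemma Uplus_e i : Uplus (qroot i) (ue i).
Proof.
have -> : qroot i = wdeg [:: i] by apply/ffunP => j; rewrite !ffunE /= addn0 eq_sym.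
by rewrite -[ue i](big_seq1 *%R i); apply: Uplus_word.
Qed.

(** The pairing value of omega_j' with omega_i. It is also the scalar by which f_j commutes with
    omega_i, and this coincidence makes [dL] arise both from commutators and from the coproduct. *)
Definition omval (j i : 'I_m) : K :=
  r ^ inner (eps (lo i)) (alpha j) * s ^ inner (eps (hi i)) (alpha j).

Lemma uf_om i j : uf j * om i false = omval j i *: (om i false * uf j).
Proof.
by rewrite om_f scalerA /omval mulrACA -!expfzDr // !subrr !expr0z mulr1 scale1r.
Qed.

Lemma om'_fword i l : exists c, om' i false * fword l = c *: (fword l * om' i false).
Proof.
elim: l => [|j l [c hc]]; first by exists 1; rewrite /fword big_nil mulr1 mul1r scale1r.
rewrite fword_cons mulrA om'_f -!scalerAl -[uf j * om' i _ * _]mulrA hc -scalerAr scalerA mulrA.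
by eexists.
Qed.

Lemma om_eword i l : exists c, om i false * eword l = c *: (eword l * om i false).
Proof.
elim: l => [|j l [c hc]]; first by exists 1; rewrite /eword big_nil mulr1 mul1r scale1r.
rewrite eword_cons mulrA om_e -!scalerAl -[ue j * om i _ * _]mulrA hc -scalerAr scalerA mulrA.
by eexists.
Qed.

Lemma ue_uf i j : ue i * uf j - uf j * ue i =
  ((i == j)%:R / (r - s)) *: (om i false - om' i false).
Proof.
have /= := gl_relE (R4 r s i j); rewrite !subE Defs.cstE => ->.
by case: eqP => [->//|_]; rewrite mul0r !scale0r.
Qed.

(* [dR i l] and [dL i l] are the components of [F_l] along [e_i] under the two
   legs of the coproduct. *)
Fixpoint dR (i : 'I_m) (l : seq 'I_m) : U :=
  if l is j :: l' then
    uf j * dR i l' + ((j == i)%:R / (s - r)) *: (om' j false * fword l')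
  else 0.

Fixpoint dL (i : 'I_m) (l : seq 'I_m) : U :=
  if l is j :: l' then
    omval j i *: (uf j * dL i l') + ((j == i)%:R / (s - r)) *: fword l'
  else 0.

(** Induction with the Leibniz rule for the commutator with e_i. By (R4), the omega_i' part of each
    [e_i, f_i] enters [dR]; the omega_i part is pulled to the far left, past the f_j, and enters
    [dL]. *)
Lemma ue_fword i l : ue i * fword l - fword l * ue i = dR i l - om i false * dL i l.
Proof.
elim: l => [|j l ih]; first by rewrite /fword big_nil mulr1 mul1r mulr0 !subrr.
have -> : ue i * fword (j :: l) - fword (j :: l) * ue i =
    (ue i * uf j - uf j * ue i) * fword l + uf j * (ue i * fword l - fword l * ue i).
  by rewrite fword_cons mulrBl mulrBr !mulrA addrA subrK.
rewrite ih ue_uf /= mulrBr mulrA uf_om mulrDr -!scalerAr !mulrA.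
rewrite opprD addrACA addrC; congr (_ + _); last by rewrite -scalerAl.
rewrite -scalerAl eq_sym; case: eqP => [->|_]; last by rewrite !mul0r !scale0r subrr.
by rewrite -scalerBr -mulrBl -[s - r]opprB invrN mulrN scaleNr -scalerN -[- (_ * fword _)]mulNr opprB.
Qed.

(** Moving omega_i' to the far right leaves an element y of U^-, which is p(F_l) in the commutator
    formula. The condition [perm_eq (i :: w) l] says that w is a rearrangement of l with one letter
    i removed, so the span is 0 when i does not occur in l. *)
Lemma dR_span i l : exists2 y, lspan (fun x => exists2 w, perm_eq (i :: w) l & x = fword w) y
  & dR i l = y * om' i false.
Proof.
elim: l => [|j l [y hy e]]; first by exists 0; [apply: lspan0 | rewrite mul0r].
have [c hc] := om'_fword i l.
exists (uf j * y + ((j == i)%:R / (s - r) * c) *: fword l); last first.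
  rewrite /= e mulrDl mulrA; congr (_ + _); case: eqP => [->|_].
    by rewrite hc scalerA scalerAl.
  by rewrite !mul0r !scale0r mul0r.
apply: lspanD.
  apply: lspan_map hy => [|_ [w hw ->]]; first by move=> a x x'; rewrite mulrDr scalerAr.
  apply: lspan_gen; exists (j :: w); last by rewrite fword_cons.
  by rewrite (perm_catCA [:: i] [:: j] w) perm_cons.
case: eqP => [->|_]; last by rewrite !mul0r scale0r; apply: lspan0.
by apply/lspanZ/lspan_gen; exists l.
Qed.

Lemma dL_span i l : lspan (fun x => exists2 w, perm_eq (i :: w) l & x = fword w) (dL i l).
Proof.
elim: l => [|j l hy]; first exact: lspan0.
apply: lspanD.
  apply/lspanZ; apply: lspan_map hy => [|_ [w hw ->]].
    by move=> a x x'; rewrite mulrDr scalerAr.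
  apply: lspan_gen; exists (j :: w); last by rewrite fword_cons.
  by rewrite (perm_catCA [:: i] [:: j] w) perm_cons.
case: eqP => [->|_]; last by rewrite !mul0r scale0r; apply: lspan0.
by apply/lspanZ/lspan_gen; exists l.
Qed.

Lemma span_Uminus i l z y : wdeg l = qadd (qroot i) z ->
  lspan (fun x => exists2 w, perm_eq (i :: w) l & x = fword w) y -> Uminus z y.
Proof.
move=> hz hy; apply/UminusP; apply: lspan_map hy => // _ [w hw ->].
apply: lspan_gen; exists w => //; apply: (@qaddI _ (qroot i)).
by rewrite -wdeg_cons -hz; apply/perm_wdeg.
Qed.

Lemma Delta_linear : linear (@Delta K m r s).
Proof. by case: (@DeltaP K m r s r0 s0). Qed.

Lemma Delta1 : Delta (1 : U) = 1.
Proof. by case: (@DeltaP K m r s r0 s0). Qed.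

Lemma DeltaM (x y : U) : Delta (x * y) = Delta x * Delta y.
Proof. by case: (@DeltaP K m r s r0 s0). Qed.

Lemma Delta_e i : Delta (ue i) = ue i (x) 1 + om i false (x) ue i.
Proof. by case: (@DeltaP K m r s r0 s0) => _ _ _ []. Qed.

Lemma Delta_f i : Delta (uf i) = 1 (x) uf i + uf i (x) om' i false.
Proof. by case: (@DeltaP K m r s r0 s0) => _ _ _ []. Qed.

Definition grouplike (g : U) := Delta g = g (x) g.

Lemma grouplikeM g h : grouplike g -> grouplike h -> grouplike (g * h).
Proof. by rewrite /grouplike DeltaM => -> ->; rewrite [LHS]tmul_pp. Qed.

Lemma grouplike1 : grouplike 1.
Proof. exact: Delta1. Qed.

Lemma grouplike_ua i v : grouplike (ua i v).
Proof. by case: (@DeltaP K m r s r0 s0) => _ _ _ [_ _ h _]; apply: h. Qed.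

Lemma grouplike_ub i v : grouplike (ub i v).
Proof. by case: (@DeltaP K m r s r0 s0) => _ _ _ [_ _ _ h]; apply: h. Qed.

Lemma grouplike_om i v : grouplike (om i v).
Proof. exact/grouplikeM/grouplike_ub/grouplike_ua. Qed.

Lemma grouplike_om' i v : grouplike (om' i v).
Proof. exact/grouplikeM/grouplike_ub/grouplike_ua. Qed.

Lemma counit1 : counit (1 : U) = 1.
Proof. by case: (@counitP K m r s). Qed.

Lemma counitM (x y : U) : counit (x * y) = counit x * counit y.
Proof. by case: (@counitP K m r s). Qed.

Lemma counit_gen g : counit (pcls _ (TGen g) : U) = (torus g)%:R.
Proof. by case: (plift_morph (@counit_gen_rel K m r s)) => _ _ _; apply. Qed.

Lemma counit_e i : counit (ue i) = 0.
Proof. exact: counit_gen. Qed.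

Lemma counit_f i : counit (uf i) = 0.
Proof. exact: counit_gen. Qed.

Lemma counit_om i v : counit (om i v) = 1.
Proof. by rewrite counitM !counit_gen mulr1. Qed.

Lemma counit_om' i v : counit (om' i v) = 1.
Proof. by rewrite counitM !counit_gen mulr1. Qed.

Lemma tMpp (x y x' y' : U) : (x (x) y) * (x' (x) y') = (x * x') (x) (y * y').
Proof. exact: tmul_pp. Qed.

(** Each letter goes either to the left leg or to the right one, where it leaves an omega_i on the
    left. Collecting these torus factors behind the e-word costs only scalars, recorded in the first
    component of the entries of [W]. *)
Lemma Delta_eword l : exists2 W : seq (K * (seq 'I_m * seq 'I_m)),
  forall p, p \in W -> perm_eq (p.2.1 ++ p.2.2) l
  & Delta (eword l) = \sum_(p <- W) p.1 *: ((eword p.2.1 * omword p.2.2) (x) eword p.2.2).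
Proof.
elim: l => [|i l [W hW e]].
  exists [:: (1, ([::], [::]))]; first by move=> p; rewrite inE => /eqP ->.
  by rewrite big_seq1 /= scale1r /eword /omword !big_nil mulr1 Delta1.
(* The scalar depends on the left word, so it is chosen as a function of words. *)
have [c hc] := choice (om_eword i).
exists ([seq (p.1, (i :: p.2.1, p.2.2)) | p <- W] ++
        [seq (p.1 * c p.2.1, (p.2.1, i :: p.2.2)) | p <- W]).
  move=> q; rewrite mem_cat => /orP[] /mapP[p /hW hp ->] /=; first by rewrite perm_cons.
  by rewrite (perm_catCA p.2.1 [:: i] p.2.2) perm_cons.
rewrite eword_cons DeltaM e Delta_e mulrDl big_cat !big_map !mulr_sumr.
congr (_ + _); apply: eq_bigr => p _; rewrite -scalerAr tMpp /= ?mul1r.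
  by rewrite eword_cons mulrA.
by rewrite -scalerA mulrA hc omword_cons eword_cons -scalerAl tpZl mulrA.
Qed.

(** * Adjoints of the multiplications by e_i, and the commutator formula *)

Section Form.
Variables (form : U -> U -> K).
Hypothesis hform : hopf_pairing form.

Lemma pairingDl x y h : Bminus x -> Bminus y -> Bplus h ->
  form (x + y) h = form x h + form y h.
Proof. by move=> *; rewrite -[x]scale1r (hp_linl hform) // mul1r scale1r. Qed.

Lemma pairingDr x y h : Bminus h -> Bplus x -> Bplus y ->
  form h (x + y) = form h x + form h y.
Proof. by move=> *; rewrite -[x]scale1r (hp_linr hform) // mul1r scale1r. Qed.

Lemma pairing0l h : Bplus h -> form 0 h = 0.
Proof.
move=> hh; have := @pairingDl 0 0 h; rewrite addr0 => /(_ (subalg0 _) (subalg0 _) hh).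
by move/eqP; rewrite eq_sym -subr_eq0 addrK => /eqP.
Qed.

Lemma pairing0r h : Bminus h -> form h 0 = 0.
Proof.
move=> hh; have := @pairingDr 0 0 h; rewrite addr0 => /(_ hh (subalg0 _) (subalg0 _)).
by move/eqP; rewrite eq_sym -subr_eq0 addrK => /eqP.
Qed.

Lemma pairingZl a x h : Bminus x -> Bplus h -> form (a *: x) h = a * form x h.
Proof.
move=> hx hh; have := hp_linl hform a hx (subalg0 _) hh.
by rewrite pairing0l // !addr0.
Qed.

Lemma pairingZr a x h : Bminus h -> Bplus x -> form h (a *: x) = a * form h x.
Proof.
move=> hx hh; have := hp_linr hform a hx hh (subalg0 _).
by rewrite pairing0r // !addr0.
Qed.

Lemma pairing_suml I (l : seq I) (P : pred I) c x h : (forall i, P i -> Bminus (x i)) -> Bplus h ->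
  form (\sum_(i <- l | P i) c i *: x i) h = \sum_(i <- l | P i) c i * form (x i) h.
Proof.
move=> hx hh.
(* Linearity of [form] holds only on the subalgebras, so membership of the partial sums is carried
   along the induction. *)
suff [_ ->] : Bminus (\sum_(i <- l | P i) c i *: x i) /\
    form (\sum_(i <- l | P i) c i *: x i) h = \sum_(i <- l | P i) c i * form (x i) h by [].
elim: l => [|i l [hB ih]]; first by rewrite !big_nil pairing0l //; split=> //; apply: subalg0.
rewrite !big_cons; case: ifP => // Pi; have hi := hx i Pi.
have hci : Bminus (c i *: x i) by apply: subalg_scale.
by rewrite pairingDl // pairingZl // ih; split=> //; apply: sub_add.
Qed.

Lemma pairing_sumr I (l : seq I) (P : pred I) c x h : (forall i, P i -> Bplus (x i)) -> Bminus h ->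
  form h (\sum_(i <- l | P i) c i *: x i) = \sum_(i <- l | P i) c i * form h (x i).
Proof.
move=> hx hh.
suff [_ ->] : Bplus (\sum_(i <- l | P i) c i *: x i) /\
    form h (\sum_(i <- l | P i) c i *: x i) = \sum_(i <- l | P i) c i * form h (x i) by [].
elim: l => [|i l [hB ih]]; first by rewrite !big_nil pairing0r //; split=> //; apply: subalg0.
rewrite !big_cons; case: ifP => // Pi; have hi := hx i Pi.
have hci : Bplus (c i *: x i) by apply: subalg_scale.
by rewrite pairingDr // pairingZr // ih; split=> //; apply: sub_add.
Qed.

Lemma form_fe i j : form (uf i) (ue j) = (i == j)%:R / (s - r).
Proof. exact: (hp_gen hform (BF i) (BE j)). Qed.

Lemma form_f_om i j v : form (uf i) (om j v) = 0.
Proof. exact: (hp_gen hform (BF i) (BW j v)). Qed.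

Lemma form_om'_e i v j : form (om' i v) (ue j) = 0.
Proof. exact: (hp_gen hform (BW' i v) (BE j)). Qed.

Lemma form_om' i j : form (om' i false) (om j false) = omval i j.
Proof. exact: (hp_gen hform (BW' i false) (BW j false)). Qed.

Lemma form_mul_gl x y g : Bminus x -> Bminus y -> Bplus g -> grouplike g ->
  form (x * y) g = form x g * form y g.
Proof.
move=> hx hy hg hd; rewrite (hp_mull hform (w := [:: (g, g)])) ?big_seq1 //.
by move=> p; rewrite inE => /eqP ->.
Qed.

Lemma form_gl_mul g x y : Bplus x -> Bplus y -> Bminus g -> grouplike g ->
  form g (x * y) = form g x * form g y.
Proof.
move=> hx hy hg hd; rewrite (hp_mulr hform (w := [:: (g, g)])) ?big_seq1 //.
  by move=> p; rewrite inE => /eqP ->.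
by rewrite hd tflip_pure.
Qed.

Lemma form_mul_e x y i : Bminus x -> Bminus y ->
  form (x * y) (ue i) = form x (ue i) * counit y + form x (om i false) * form y (ue i).
Proof.
move=> hx hy; have he := Bplus_ue i; have ho := Bplus_om i false.
have h1 := subalg1 (fun x => exists g, x = @bval K m r s g).
rewrite (hp_mull hform (w := [:: (ue i, 1); (om i false, ue i)])) //.
- by rewrite big_cons big_seq1 /= (hp_1r hform).
- by move=> p; rewrite !inE => /orP[] /eqP ->.
- by rewrite big_cons big_seq1 Delta_e.
Qed.

(** By [hp_mulr], contracting the second leg of the opposite coproduct with e_i gives the adjoint of
    right multiplication by e_i, and contracting the first leg gives that of left multiplication.
    The contractions with group-like elements and with 1 belong to the same statement because the
    induction for [dR] uses the former at g = 1 and the one for [dL] uses the latter. *)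
Lemma coprod_fword l : exists w : seq (U * U),
  [/\ forall p, p \in w -> Bminus p.1 /\ Bminus p.2,
      tflip (Delta (fword l)) = \sum_(p <- w) p.1 (x) p.2,
      forall g, Bplus g -> grouplike g -> counit g = 1 -> (forall j, form (uf j) g = 0) ->
        \sum_(p <- w) form p.2 g *: p.1 = fword l,
      forall i, \sum_(p <- w) form p.2 (ue i) *: p.1 = dR i l
    & \sum_(p <- w) form p.1 1 *: p.2 = fword l /\
      forall i, \sum_(p <- w) form p.1 (ue i) *: p.2 = dL i l].
Proof.
have h1 := subalg1 (fun x => exists g, x = @bval K m r s g).
have h1' := subalg1 (fun x => exists g, x = @bval' K m r s g).
elim: l => [|j l [w [hw hD hg hR [h1w hL]]]].
  exists [:: (1, 1)]; split.
  - by move=> p; rewrite inE => /eqP ->.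
  - by rewrite /fword big_nil Delta1 tflip_pure big_seq1.
  - by move=> g hg _ g1 _; rewrite big_seq1 /= (hp_1l hform) // g1 /fword big_nil scale1r.
  - by move=> i; rewrite big_seq1 /= (hp_1l hform) ?counit_e ?scale0r //; apply: Bplus_ue.
  - split; first by rewrite big_seq1 /= (hp_1l hform) // counit1 scale1r /fword big_nil.
    by move=> i; rewrite big_seq1 /= (hp_1l hform) ?counit_e ?scale0r //; apply: Bplus_ue.
have hf := Bminus_uf j; have ho := Bminus_om' j false.
exists ([seq (uf j * p.1, p.2) | p <- w] ++ [seq (om' j false * p.1, uf j * p.2) | p <- w]).
split.
- move=> q; rewrite mem_cat => /orP[] /mapP[p /hw[hp1 hp2] ->] /=.
    by split=> //; apply: sub_mul.
  by split; apply: sub_mul.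
- rewrite fword_cons DeltaM tflipM hD Delta_f (linD (@tflip_linear _ _ _)) !tflip_pure.
  rewrite mulrDl big_cat !big_map !mulr_sumr.
  by congr (_ + _); apply: eq_bigr => p _; rewrite tMpp ?mul1r.
- move=> g gB gg g1 gf; rewrite big_cat !big_map /= [X in _ + X]big_seq [X in _ + X]big1.
    rewrite addr0 fword_cons -(hg g) // mulr_sumr; apply: eq_bigr => p _.
    by rewrite scalerAr.
  by move=> p /hw[hp1 hp2] /=; rewrite form_mul_gl // gf mul0r scale0r.
- move=> i; rewrite big_cat !big_map /= -hR mulr_sumr; congr (_ + _).
    by apply: eq_bigr => p _; rewrite scalerAr.
  (* Contracting with g = 1 is applying the counit, which recovers F_l from the list [w]. *)
  rewrite -(hg 1) //; first last.
  + by move=> k; rewrite (hp_1r hform) ?counit_f //; apply: Bminus_uf.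
  + exact: counit1.
  + exact: grouplike1.
  rewrite mulr_sumr scaler_sumr; apply: eq_big_seq => p /hw[hp1 hp2] /=.
  rewrite form_mul_e // form_fe form_f_om mul0r addr0 (hp_1r hform) //.
  by rewrite -scalerAr scalerA.
- split.
    rewrite big_cat !big_map /= big_seq big1 => [|p /hw[hp1 hp2]].
      rewrite add0r fword_cons -h1w mulr_sumr; apply: eq_big_seq => p /hw[hp1 hp2].
      rewrite form_mul_gl //; last exact: grouplike1.
      by rewrite (hp_1r hform) // counit_om' mul1r scalerAr.
    rewrite form_mul_gl //; last exact: grouplike1.
    by rewrite (hp_1r hform) // counit_f mul0r scale0r.
  move=> i; rewrite big_cat !big_map /= addrC; congr (_ + _).
    rewrite -hL mulr_sumr scaler_sumr; apply: eq_big_seq => p /hw[hp1 hp2].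
    by rewrite form_mul_e // form_om'_e mul0r add0r form_om' -scalerAr scalerA.
  rewrite -h1w scaler_sumr; apply: eq_big_seq => p /hw[hp1 hp2].
  by rewrite form_mul_e // form_fe form_f_om mul0r addr0 (hp_1r hform) // scalerA.
Qed.

Lemma sum_form_mem (w : seq (U * U)) (c : U * U -> K) (pr : U * U -> U) h :
  (forall p, p \in w -> Bminus (pr p)) -> Bplus h ->
  form (\sum_(p <- w) c p *: pr p) h = \sum_(p <- w) c p * form (pr p) h.
Proof. by move=> hp hh; rewrite big_seq pairing_suml // -big_seq. Qed.

Lemma form_fword_e l x i : Bplus x -> form (fword l) (x * ue i) = form (dR i l) x.
Proof.
move=> hx; have [w [hw hD _ hR _]] := coprod_fword l.
have he := Bplus_ue i; have hl := Bminus_fword l.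
rewrite (hp_mulr hform (w := w)) // -hR (@sum_form_mem w (fun p => form p.2 (ue i)) fst) //.
  by apply: eq_bigr => p _; rewrite mulrC.
by move=> p /hw[].
Qed.

Lemma form_fword_eL l x i : Bplus x -> form (fword l) (ue i * x) = form (dL i l) x.
Proof.
move=> hx; have [w [hw hD _ _ [_ hL]]] := coprod_fword l.
have he := Bplus_ue i; have hl := Bminus_fword l.
rewrite (hp_mulr hform (w := w)) // -hL (@sum_form_mem w (fun p => form p.1 (ue i)) snd) //.
by move=> p /hw[].
Qed.

(** Since omega_i is group-like with counit 1 and pairs to 0 with every f_j, contracting the second
    leg with it returns F_l. *)
Lemma form_fword_om l x i : Bplus x ->
  form (fword l) (x * om i false) = form (fword l) x.
Proof.
move=> hx; have [w [hw hD hg _ _]] := coprod_fword l.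
have ho := Bplus_om i false; have hl := Bminus_fword l.
have e : \sum_(p <- w) form p.2 (om i false) *: p.1 = fword l.
  apply: hg => //; first exact: grouplike_om; first exact: counit_om.
  by move=> j; apply: form_f_om.
rewrite (hp_mulr hform (w := w)) // -[in RHS]e.
rewrite (@sum_form_mem w (fun p => form p.2 (om i false)) fst) //.
  by apply: eq_bigr => p _; rewrite mulrC.
by move=> p /hw[].
Qed.

Lemma form_fword_omword l x l' : Bplus x ->
  form (fword l) (x * omword l') = form (fword l) x.
Proof.
elim: l' x => [|i l' ih] x hx; first by rewrite /omword big_nil mulr1.
have hxo : Bplus (x * om i false) by apply/sub_mul/Bplus_om.
by rewrite omword_cons mulrA ih // form_fword_om.
Qed.

(** A span induction that keeps the partial sums in [Uminus z], as the restricted linearity of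
    [form] demands. *)
Lemma Uminus_form_ind z (P : U -> Prop) : P 0 ->
  (forall c l y, wdeg l = z -> Uminus z y -> P y -> P (c *: fword l + y)) ->
  forall y, Uminus z y -> P y.
Proof.
move=> P0 PD y /UminusP hy; suff [] : P y /\ Uminus z y by [].
move: y hy; apply: lspan_ind => [|c x y [l hl ->] [Py hy]].
  by split=> //; apply: lspan0.
split; first exact: PD.
by apply: lspanD => //; apply: lspanZ; rewrite -hl; apply: Uminus_word.
Qed.

Lemma form_omword z y x l' : Uminus z y -> Bplus x -> form y (x * omword l') = form y x.
Proof.
move=> hy hx; have hxo : Bplus (x * omword l') by apply/sub_mul/Bplus_omword.
move: y hy; apply: Uminus_form_ind => [|c l y _ hy ih]; first by rewrite !pairing0l.
have hl := Bminus_fword l; have hy' := Uminus_Bminus hy.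
have hcl : Bminus (c *: fword l) by apply: subalg_scale.
by rewrite !pairingDl // !pairingZl // ih form_fword_omword.
Qed.

(** Because omega_i' pairs to 0 with every e_j, only the term E_l (x) 1 of the coproduct survives
    the contraction. This is what makes a right factor omega_i' invisible to U^+. *)
Lemma coprod_eword l : exists w : seq (U * U),
  [/\ forall p, p \in w -> Bplus p.1 /\ Bplus p.2,
      Delta (eword l) = \sum_(p <- w) p.1 (x) p.2
    & forall i, \sum_(p <- w) form (om' i false) p.2 *: p.1 = eword l].
Proof.
have h1 := subalg1 (fun x => exists g, x = @bval K m r s g).
elim: l => [|j l [w [hw hD hg]]].
  exists [:: (1, 1)]; split.
  - by move=> p; rewrite inE => /eqP ->.
  - by rewrite /eword big_nil Delta1 big_seq1.
  - move=> i; rewrite big_seq1 /= (hp_1r hform) ?counit_om' /eword ?big_nil ?scale1r //.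
    exact: Bminus_om'.
have he := Bplus_ue j; have ho := Bplus_om j false.
exists ([seq (ue j * p.1, p.2) | p <- w] ++ [seq (om j false * p.1, ue j * p.2) | p <- w]).
split.
- move=> q; rewrite mem_cat => /orP[] /mapP[p /hw[hp1 hp2] ->] /=.
    by split=> //; apply: sub_mul.
  by split; apply: sub_mul.
- rewrite eword_cons DeltaM hD Delta_e mulrDl big_cat !big_map !mulr_sumr.
  by congr (_ + _); apply: eq_bigr => p _; rewrite tMpp ?mul1r.
- move=> i; rewrite big_cat !big_map /= [X in _ + X]big_seq [X in _ + X]big1.
    rewrite addr0 eword_cons -(hg i) // mulr_sumr; apply: eq_bigr => p _.
    by rewrite scalerAr.
  move=> p /hw[hp1 hp2] /=; rewrite form_gl_mul //; first by rewrite form_om'_e mul0r scale0r.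
    exact: Bminus_om'.
  exact: grouplike_om'.
Qed.

Lemma form_om'_eword y i l : Bminus y -> form (y * om' i false) (eword l) = form y (eword l).
Proof.
move=> hy; have [w [hw hD hg]] := coprod_eword l.
have ho := Bminus_om' i false; have hl := Bplus_eword l.
rewrite (hp_mull hform (w := w)) // -[in RHS](hg i) big_seq [in RHS]big_seq pairing_sumr //.
  by apply: eq_bigr => p _; rewrite mulrC.
by move=> p /hw[].
Qed.

Lemma Uplus_form_ind z (P : U -> Prop) : P 0 ->
  (forall c l y, wdeg l = z -> Uplus z y -> P y -> P (c *: eword l + y)) ->
  forall y, Uplus z y -> P y.
Proof.
move=> P0 PD y /UplusP hy; suff [] : P y /\ Uplus z y by [].
move: y hy; apply: lspan_ind => [|c x y [l hl ->] [Py hy]].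
  by split=> //; apply: lspan0.
split; first exact: PD.
by apply: lspanD => //; apply: lspanZ; rewrite -hl; apply: Uplus_word.
Qed.

Lemma form_om'_Uplus y i z x : Bminus y -> Uplus z x -> form (y * om' i false) x = form y x.
Proof.
move=> hy hx; have hyo : Bminus (y * om' i false) by apply/sub_mul/Bminus_om'.
move: x hx; apply: Uplus_form_ind => [|c l x _ hx ih]; first by rewrite !pairing0r.
have hl := Bplus_eword l; have hx' := Uplus_Bplus hx.
have hcl : Bplus (c *: eword l) by apply: subalg_scale.
by rewrite !pairingDr // !pairingZr // ih form_om'_eword.
Qed.

(** Induction on the last letter i of the e-word: the adjoint removes one i from l, up to a torus
    factor that the pairing ignores, and none of the resulting words is a rearrangement of the
    shortened e-word. The counit settles the empty e-word. *)
Lemma form_words_neq l l' : ~~ perm_eq l l' -> form (fword l) (eword l') = 0.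
Proof.
elim/last_ind: l' l => [|l' i ih] l.
  case: l => [//|j l] _; have hf := Bminus_fword (j :: l).
  by rewrite /eword big_nil (hp_1r hform) // fword_cons counitM counit_f mul0r.
move=> hl; rewrite eword_rcons form_fword_e; last exact: Bplus_eword.
have [y [w [hw ->]] ->] := dR_span i l.
have hB (p : K * U) : p \in w -> Bminus p.2.
  by move=> /hw[v _ ->]; apply: Bminus_fword.
rewrite big_seq form_om'_eword; last first.
  rewrite -big_seq; elim: w hB {hw} => [_|p w ih' hB]; first by rewrite big_nil; apply: subalg0.
  rewrite big_cons; apply: sub_add; first exact/subalg_scale/hB/mem_head.
  by apply: ih' => q qw; apply: hB; rewrite inE qw orbT.
rewrite pairing_suml //; last exact: Bplus_eword.
apply: big1 => p /hw[v hv ->]; rewrite ih ?mulr0 //; apply: contra hl => hvl.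
rewrite perm_sym in hv; apply: (perm_trans hv).
by rewrite perm_sym perm_rcons perm_cons perm_sym.
Qed.

Lemma form_deg_neq z z' y x : Uminus z y -> Uplus z' x -> z != z' -> form y x = 0.
Proof.
move=> hy hx zz'; move: y hy; apply: Uminus_form_ind => [|c l y hl hy ih].
  by rewrite pairing0l //; apply: Uplus_Bplus hx.
have hB := Uplus_Bplus hx; have hy' := Uminus_Bminus hy; have hlB := Bminus_fword l.
have hcl : Bminus (c *: fword l) by apply: subalg_scale.
rewrite pairingDl // pairingZl // ih addr0.
move: x hx hB {ih}; apply: Uplus_form_ind => [|c' l' x hl' hx ih] hB.
  by rewrite pairing0r ?mulr0.
have hx' := Uplus_Bplus hx; have hl'B := Bplus_eword l'.
have hcl' : Bplus (c' *: eword l') by apply: subalg_scale.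
rewrite pairingDr // pairingZr // mulrDr ih // addr0 form_words_neq ?mulr0 //.
by apply: contra zz' => /perm_wdeg; rewrite hl hl' => ->.
Qed.

Variables (d : Qplus m -> nat) (u v : forall z, 'I_(d z) -> U).
Hypothesis huv : dual_bases form u v.

Lemma Uplus_u z k : Uplus z (u (z := z) k).
Proof. by case: (huv z) => [[]]. Qed.

Lemma Uminus_v z k : Uminus z (v (z := z) k).
Proof. by case: (huv z) => _ []. Qed.

Lemma Uplus_expand z x : Uplus z x -> x = \sum_k form (v (z := z) k) x *: u k.
Proof.
case: (huv z) => [[_ _ hu]] _ hd /hu[c ->]; apply: eq_bigr => k _.
have hu' l : true -> Bplus (u (z := z) l) by move=> _; apply/Uplus_Bplus/Uplus_u.
have hv := Uminus_Bminus (Uminus_v k).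
rewrite pairing_sumr // (bigD1 k) //= hd eqxx mulr1 big1 ?addr0 // => l lk.
by rewrite hd eq_sym (negbTE lk) mulr0.
Qed.

Lemma Uminus_expand z y : Uminus z y -> y = \sum_k form y (u (z := z) k) *: v k.
Proof.
case: (huv z) => _ [_ _ hv] hd /hv[c ->]; apply: eq_bigr => k _.
have hu' l : true -> Bminus (v (z := z) l) by move=> _; apply/Uminus_Bminus/Uminus_v.
have hu := Uplus_Bplus (Uplus_u k).
rewrite pairing_suml // (bigD1 k) //= hd eqxx mulr1 big1 ?addr0 // => l lk.
by rewrite hd (negbTE lk) mulr0.
Qed.

(** The two sums are p(y) and p'(y) in coordinates, the coefficient on v_k being the pairing with
    u_k. For a word, [ue_fword] gives the commutator, and the adjunctions identify [dR], stripped of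
    its omega_i', and [dL] with these sums. The coordinates let the scalars move to the other leg of
    Theta. *)
Lemma commutator_Uminus i z y : Uminus (qadd (qroot i) z) y ->
  ue i * y - y * ue i =
  (\sum_k form y (u (z := z) k * ue i) *: v k) * om' i false
  - om i false * (\sum_k form y (ue i * u (z := z) k) *: v k).
Proof.
have he := Bplus_ue i.
have huB k := Uplus_Bplus (@Uplus_u z k).
have hueB k : Bplus (u (z := z) k * ue i) by apply: sub_mul => //; apply: huB.
have heuB k : Bplus (ue i * u (z := z) k) by apply: sub_mul => //; apply: huB.
move: y; apply: Uminus_form_ind => [|c l y hl hy ih].
  rewrite mulr0 mul0r subrr !big1 ?mul0r ?mulr0 ?subrr // => k _;
    by rewrite pairing0l ?scale0r.
have hlB := Bminus_fword l; have hyB := Uminus_Bminus hy.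
have hclB : Bminus (c *: fword l) by apply: subalg_scale.
have [y' hy' eR] := dR_span i l.
have hy'z := span_Uminus hl hy'; have hy'B := Uminus_Bminus hy'z.
have -> : ue i * (c *: fword l + y) - (c *: fword l + y) * ue i =
    c *: (ue i * fword l - fword l * ue i) + (ue i * y - y * ue i).
  by rewrite mulrDr mulrDl opprD addrACA -scalerAr -scalerAl -scalerBr.
rewrite ih ue_fword eR [y' in LHS](Uminus_expand hy'z).
have -> : dL i l = \sum_k form (dL i l) (u (z := z) k) *: v k.
  exact/Uminus_expand/(span_Uminus hl)/dL_span.
have -> : \sum_k form (c *: fword l + y) (u (z := z) k * ue i) *: v k =
    c *: \sum_k form y' (u (z := z) k) *: v k + \sum_k form y (u (z := z) k * ue i) *: v k.
  rewrite scaler_sumr -big_split; apply: eq_bigr => k _ /=.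
  rewrite pairingDl // pairingZl // form_fword_e // eR (form_om'_Uplus _ _ (Uplus_u k)) //.
  by rewrite scalerDl scalerA.
have -> : \sum_k form (c *: fword l + y) (ue i * u (z := z) k) *: v k =
    c *: \sum_k form (dL i l) (u (z := z) k) *: v k
    + \sum_k form y (ue i * u (z := z) k) *: v k.
  rewrite scaler_sumr -big_split; apply: eq_bigr => k _ /=.
  by rewrite pairingDl // pairingZl // form_fword_eL // scalerDl scalerA.
by rewrite mulrDl mulrDr -scalerAl -scalerAr opprD addrACA -scalerBr.
Qed.

(** These are the degrees not of the form alpha_i + z. No letter of the words involved is i, so [dR]
    and [dL] both vanish. *)
Lemma commutator_Uminus0 i (z : Qplus m) y : z i = 0%N -> Uminus z y -> ue i * y = y * ue i.
Proof.
move=> zi; move: y; apply: Uminus_form_ind => [|c l y hl hy ih].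
  by rewrite mulr0 mul0r.
rewrite mulrDr mulrDl ih -scalerAr -scalerAl; congr (_ *: _ + _).
have il : i \notin l.
  by rewrite -has_pred1 has_count -leqNgt leqn0; move/ffunP/(_ i): hl; rewrite ffunE zi => ->.
have h0 x : lspan (fun x => exists2 w, perm_eq (i :: w) l & x = fword w) x -> x = 0.
  move: x; apply: lspan_ind => // c' x x' [w /perm_mem/(_ i)].
  by rewrite mem_head (negbTE il).
apply/eqP; rewrite -subr_eq0 ue_fword (h0 _ (dL_span i l)).
by have [x /h0 -> ->] := dR_span i l; rewrite mulr0 mul0r subrr.
Qed.

End Form.
End WordCalculus.

(** * The bicharacter f *)

Section Bicharacter.
Variables (K : fieldType) (m : nat) (r s : K).
Hypotheses (r0 : r != 0) (s0 : s != 0).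

Local Notation U := (Ugl m r s).
Local Notation ua := (@ua K m r s).
Local Notation ub := (@ub K m r s).
Local Notation om := (@om K m r s).
Local Notation om' := (@om' K m r s).
Local Notation Bplus := (@Bplus K m r s).
Local Notation Bminus := (@Bminus K m r s).
Implicit Types (x y : Lat m).

Lemma innerDr k x y : inner (eps k) (x + y) = inner (eps k) x + inner (eps k) y.
Proof. by rewrite !innerE ffunE. Qed.

Lemma expfz_sum (I : Type) (l : seq I) (g : I -> int) (c : K) : c != 0 ->
  c ^ (\sum_(i <- l) g i) = \prod_(i <- l) c ^ g i.
Proof.
move=> c0; elim: l => [|i l ih]; first by rewrite !big_nil expr0z.
by rewrite !big_cons expfzDr // ih.
Qed.

(** This is the basis in which omega_lambda and omega'_lambda are defined, so a pairing computed
    generator by generator can be recognised as a power with an inner product as exponent. *)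
Lemma expfz_inner (c : K) k x : c != 0 ->
  c ^ inner (eps k) x =
  (\prod_j (c ^ inner (eps k) (alpha j)) ^ acoef x (lo j))
  * (c ^ inner (eps k) (eps ord_max)) ^ acoef x ord_max.
Proof.
move=> c0; rewrite {1}[x]acoefE innerDr expfzDr //; congr (_ * _).
  rewrite innerE sum_ffunE expfz_sum //; apply: eq_bigr => j _.
  by rewrite ffunMzE innerE exprz_exp mulrzz.
by rewrite innerE ffunMzE innerE exprz_exp mulrzz.
Qed.

Lemma inner_lo_max (j : 'I_m) : inner (eps (lo j)) (eps ord_max) = 0.
Proof. by rewrite innerE ffunE -val_eqE /= (ltn_eqF (ltn_ord j)). Qed.

Lemma inner_hi_max (j : 'I_m) :
  inner (eps (hi j)) (eps ord_max) = - inner (eps ord_max) (alpha j).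
Proof.
rewrite !innerE !ffunE -!val_eqE /= /bump /= add1n.
by have := ltn_ord j; lia.
Qed.

(** It shows that the pairing value of omega_i' with omega_j is the inverse of the scalar by which
    omega_i' acts on the weight alpha_j. *)
Lemma inner_lo_hi (i j : 'I_m) :
  inner (eps (lo j)) (alpha i) = - inner (eps (hi i)) (alpha j).
Proof. by rewrite inner_lo inner_hi; lia. Qed.

Lemma om_false_true j : om j false * om j true = 1.
Proof.
rewrite /Defs.om -mulrA [ub _ _ * _]mulrA.
rewrite -[ub (hi j) false * ua (lo j) true](@torusC _ _ r s (gA (lo j) true) (gB (hi j) false)) //.
have /= ha := gl_relE (R1_a r s (lo j)); have /= hb := gl_relE (R1_b r s (hi j)).
rewrite -mulrA [X in _ * (_ * X)]hb scale1r mulr1.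
by rewrite [LHS]ha scale1r.
Qed.

Lemma om'_false_true j : om' j false * om' j true = 1.
Proof.
rewrite /Defs.om' -mulrA [ub _ _ * _]mulrA.
rewrite -[ub (lo j) false * ua (hi j) true](@torusC _ _ r s (gA (hi j) true) (gB (lo j) false)) //.
have /= ha := gl_relE (R1_a r s (hi j)); have /= hb := gl_relE (R1_b r s (lo j)).
rewrite -mulrA [X in _ * (_ * X)]hb scale1r mulr1.
by rewrite [LHS]ha scale1r.
Qed.

Lemma ua_false_true i : ua i false * ua i true = 1.
Proof. by have /= := gl_relE (R1_a r s i); rewrite scale1r. Qed.

Lemma ub_false_true i : ub i false * ub i true = 1.
Proof. by have /= := gl_relE (R1_b r s i); rewrite scale1r. Qed.

Lemma zpow_closed (P : U -> Prop) (g h : U) k :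
  (forall (x : U) n, P x -> P (x ^+ n)) -> P g -> P h -> P (zpow g h k).
Proof. by move=> hP hg hh; case: k => n; apply: hP. Qed.

Variable form : U -> U -> K.
Hypothesis hform : hopf_pairing form.

(* A character of the commutative group of group-like elements, abstracting
   the two partial evaluations of the pairing on them. *)
Record torus_character (G : U -> Prop) (chi : U -> K) : Prop := TorusCharacter {
  tc1 : chi 1 = 1;
  tcM : forall g h, G g -> G h -> chi (g * h) = chi g * chi h
}.

Section Characters.
Variables (G : U -> Prop) (chi : U -> K).
Hypotheses (G1 : G 1) (GM : forall g h, G g -> G h -> G (g * h)).
Hypothesis hchi : torus_character G chi.

Lemma char_exp g k : G g -> G (g ^+ k) /\ chi (g ^+ k) = chi g ^+ k.
Proof.
move=> hg; elim: k => [|k [ih1 ih2]]; first by rewrite !expr0 (tc1 hchi).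
by rewrite !exprS (tcM hchi) // ih2; split=> //; apply: GM.
Qed.

(** The relation g h = 1 makes chi(h) the inverse of chi(g), so the two branches of [zpow] agree
    with one integer power. *)
Lemma char_zpow g h k : G g -> G h -> g * h = 1 ->
  [/\ G (zpow g h k), chi g != 0 & chi (zpow g h k) = chi g ^ k].
Proof.
move=> hg hh gh; have e : chi g * chi h = 1 by rewrite -(tcM hchi) // gh (tc1 hchi).
have g0 : chi g != 0.
  by apply/eqP => g0; move/eqP: e; rewrite g0 mul0r eq_sym oner_eq0.
have e' : chi h = (chi g)^-1 by rewrite -[LHS](mulKf g0) e mulr1.
case: k => k /=; have [h1 h2] := char_exp k hg; first by rewrite h2.
by have [h3 h4] := char_exp k.+1 hh; rewrite h4 e' NegzE -exprnN exprVn.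
Qed.

Lemma char_prod (I : Type) (l : seq I) (g : I -> U) : (forall i, G (g i)) ->
  G (\prod_(i <- l) g i) /\ chi (\prod_(i <- l) g i) = \prod_(i <- l) chi (g i).
Proof.
move=> hg; elim: l => [|i l [ih1 ih2]]; first by rewrite !big_nil (tc1 hchi).
by rewrite !big_cons (tcM hchi) // ih2; split=> //; apply: GM.
Qed.

End Characters.

Definition Gplus g := Bplus g /\ grouplike g.
Definition Gminus g := [/\ Bminus g, grouplike g & counit g = 1].

Lemma Gplus1 : Gplus 1.
Proof. by split; [apply: subalg1 | apply: grouplike1]. Qed.

Lemma GplusM g h : Gplus g -> Gplus h -> Gplus (g * h).
Proof. by move=> [? ?] [? ?]; split; [apply: sub_mul | apply: grouplikeM]. Qed.

Lemma Gminus1 : Gminus 1.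
Proof. by split; [apply: subalg1 | apply: grouplike1 | apply: counit1]. Qed.

Lemma GminusM g h : Gminus g -> Gminus h -> Gminus (g * h).
Proof.
move=> [? ? hg] [? ? hh]; split; [exact: sub_mul | exact: grouplikeM |].
by rewrite counitM hg hh mulr1.
Qed.

Lemma Gplus_om j v : Gplus (om j v).
Proof. by split; [apply: Bplus_om | apply: grouplike_om]. Qed.

Lemma Gplus_ua v : Gplus (ua ord_max v).
Proof. by split; [apply: sub_gen; exists (BA m v) | apply: grouplike_ua]. Qed.

Lemma Gminus_om' j v : Gminus (om' j v).
Proof. by split; [apply: Bminus_om' | apply: grouplike_om' | apply: counit_om']. Qed.

Lemma Gminus_ub v : Gminus (ub ord_max v).
Proof.
split; [by apply: sub_gen; exists (BB m v) | exact: grouplike_ub |].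
exact: counit_gen.
Qed.

Lemma char_plus g : Gminus g -> torus_character Gplus (form g).
Proof.
move=> [gB gg g1]; split; first by rewrite (hp_1r hform).
by move=> x y [? ?] [? ?]; rewrite (form_gl_mul hform).
Qed.

Lemma char_minus g : Gplus g -> counit g = 1 -> torus_character Gminus (form^~ g).
Proof.
move=> [gB gg] g1; split; first by rewrite (hp_1l hform).
by move=> x y [? ? _] [? ? _]; rewrite (form_mul_gl hform).
Qed.

Lemma form_om_lat g x : Gminus g ->
  form g (om_lat r s x) = (\prod_j form g (om j false) ^ acoef x (lo j))
    * form g (ua ord_max false) ^ acoef x ord_max.
Proof.
move=> hg; have hc := char_plus hg; rewrite /om_lat.
have hz j k := char_zpow Gplus1 GplusM hc k (Gplus_om j false) (Gplus_om j true) (om_false_true j).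
have [h1 _ h2] := char_zpow Gplus1 GplusM hc (acoef x ord_max)
  (Gplus_ua false) (Gplus_ua true) (ua_false_true _).
have [h3 h4] := char_prod Gplus1 GplusM hc (index_enum 'I_m)
  (g := fun j => zpow (om j false) (om j true) (acoef x (lo j)))
  (fun j => let: And3 h _ _ := hz j (acoef x (lo j)) in h).
rewrite (tcM hc) // h4 h2; congr (_ * _); apply: eq_bigr => j _.
by case: (hz j (acoef x (lo j))).
Qed.

Lemma form_om'_lat g y : Gplus g -> counit g = 1 ->
  form (om'_lat r s y) g = (\prod_j form (om' j false) g ^ acoef y (lo j))
    * form (ub ord_max false) g ^ acoef y ord_max.
Proof.
move=> hg g1; have hc := char_minus hg g1; rewrite /om'_lat.
have hz j k := char_zpow Gminus1 GminusM hc k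
  (Gminus_om' j false) (Gminus_om' j true) (om'_false_true j).
have [h1 _ h2] := char_zpow Gminus1 GminusM hc (acoef y ord_max)
  (Gminus_ub false) (Gminus_ub true) (ub_false_true _).
have [h3 h4] := char_prod Gminus1 GminusM hc (index_enum 'I_m)
  (g := fun j => zpow (om' j false) (om' j true) (acoef y (lo j)))
  (fun j => let: And3 h _ _ := hz j (acoef y (lo j)) in h).
rewrite (tcM hc) // h4 h2; congr (_ * _); apply: eq_bigr => j _.
by case: (hz j (acoef y (lo j))).
Qed.

Lemma Gminus_om'_lat y : Gminus (om'_lat r s y).
Proof.
have hX g k : Gminus g -> Gminus (g ^+ k).
  move=> hg; elim: k => [|k ih]; first by rewrite expr0; apply: Gminus1.
  by rewrite exprS; apply: GminusM.
apply: GminusM.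
  elim/big_ind: _ => [|g h|j _]; [exact: Gminus1 | exact: GminusM |].
  by apply: zpow_closed => //; apply: Gminus_om'.
by apply: zpow_closed => //; apply: Gminus_ub.
Qed.

Lemma Gplus_om_lat x : Gplus (om_lat r s x) /\ counit (om_lat r s x) = 1.
Proof.
pose P g := Gplus g /\ counit g = 1.
have P1 : P 1 by split; [apply: Gplus1 | apply: counit1].
have PM g h : P g -> P h -> P (g * h).
  by move=> [? hg] [? hh]; split; [apply: GplusM | rewrite counitM hg hh mulr1].
have hX g k : P g -> P (g ^+ k).
  move=> hg; elim: k => [|k ih]; first by rewrite expr0.
  by rewrite exprS; apply: PM.
apply: (PM).
  elim/big_ind: _ => [|g h|j _] //; first exact: PM.
  by apply: zpow_closed => //; split; rewrite ?counit_om //; apply: Gplus_om.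
apply: zpow_closed => //; split; try exact: Gplus_ua; exact: counit_gen.
Qed.

(** The scalar by which omega_i acts on vectors of weight y; [omchar'] below is the analogue for
    omega_i'. *)
Definition omchar y (i : 'I_m) : K :=
  r ^ inner (eps (lo i)) y * s ^ inner (eps (hi i)) y.
Definition omchar' x (i : 'I_m) : K :=
  r ^ inner (eps (hi i)) x * s ^ inner (eps (lo i)) x.

Lemma omchar_neq0 y i : omchar y i != 0.
Proof. by rewrite mulf_neq0 ?expfz_neq0. Qed.

(** The link between the pairing and the weights of modules: pairing with omega'_y evaluates omega_i
    on the weight y. It allows f to compensate the torus parts of coproducts. *)
Lemma form_lat_om y i : form (om'_lat r s y) (om i false) = omchar y i.
Proof.
rewrite form_om'_lat ?counit_om //; last exact: Gplus_om.
rewrite /omchar (expfz_inner _ y r0) (expfz_inner _ y s0).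
rewrite inner_lo_max expr0z exp1rz mulr1 mulrA -big_split; congr (_ * _).
  by apply: eq_bigr => j _; rewrite (form_om' hform) /= -expfzMl.
by rewrite (hp_gen hform (BB m false) (BW i false)) /= inner_hi_max.
Qed.

Lemma form_om'_latr x i : form (om' i false) (om_lat r s x) = (omchar' x i)^-1.
Proof.
rewrite form_om_lat; last exact: Gminus_om'.
have rV : r^-1 != 0 by rewrite invr_eq0.
have sV : s^-1 != 0 by rewrite invr_eq0.
rewrite /omchar' invfM !invr_expz -!exprz_inv (expfz_inner _ x rV) (expfz_inner _ x sV).
rewrite inner_lo_max expr0z exp1rz mulr1 mulrAC -big_split; congr (_ * _).
  apply: eq_bigr => j _; rewrite (form_om' hform) /= -expfzMl /omval.
  by rewrite !exprz_inv (inner_lo_hi i j) (inner_lo_hi j i) opprK.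
rewrite (hp_gen hform (BW' i false) (BA m false)) /= exprz_inv.
by rewrite inner_hi_max opprK.
Qed.

Lemma fcoefDr x y y' : fcoef form x (y + y') = fcoef form x y * fcoef form x y'.
Proof.
have [hg g1] := Gplus_om_lat x; have hc := char_minus hg g1.
(* The exponents may be negative, so splitting the powers requires nonzero bases. Each base is the
   value of a character at an invertible group-like element; of [char_zpow] only the nonvanishing is
   used, hence the exponent 0. *)
have nz g h : Gminus g -> Gminus h -> g * h = 1 -> form g (om_lat r s x) != 0.
  by move=> g2 h2 gh; have [] := char_zpow Gminus1 GminusM hc 0 g2 h2 gh.
rewrite /fcoef -invfM; congr (_^-1); rewrite !form_om'_lat // mulrACA -big_split.
rewrite acoefD expfzDr; last exact: nz (Gminus_ub false) (Gminus_ub true) (ub_false_true _).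
congr (_ * _); apply: eq_bigr => j _; rewrite acoefD expfzDr //.
exact: nz (Gminus_om' j false) (Gminus_om' j true) (om'_false_true j).
Qed.

(** A shift by alpha_i in the first argument contributes the inverse of the scalar of omega_i, and
    in the second one ([fcoef_addr]) the scalar of omega_i'. These are the two corrections needed
    for R to commute with Delta(e_i). *)
Lemma fcoef_addl x i y : fcoef form (x + alpha i) y = (omchar y i)^-1 * fcoef form x y.
Proof.
have hg := Gminus_om'_lat y; have hc := char_plus hg.
rewrite /fcoef -invfM; congr (_^-1); rewrite !form_om_lat // acoefD.
rewrite acoef_alpha -val_eqE /= (gtn_eqF (ltn_ord i)) addr0 mulrA; congr (_ * _).
rewrite (bigD1 i) //= [in RHS](bigD1 i) //= mulrA; congr (_ * _).
  rewrite acoefD acoef_alpha eqxx expfzDr ?form_lat_om ?omchar_neq0 //.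
  by rewrite expr1z mulrC.
apply: eq_bigr => j ij; rewrite acoefD acoef_alpha -val_eqE /= val_eqE (negbTE ij).
by rewrite addr0.
Qed.

Lemma fcoef_addr x i y : fcoef form x (y + alpha i) = omchar' x i * fcoef form x y.
Proof.
rewrite fcoefDr mulrC; congr (_ * _); rewrite -[RHS]invrK -form_om'_latr; congr (_^-1).
have [hg g1] := Gplus_om_lat x; rewrite form_om'_lat // (bigD1 i) //= acoef_alpha eqxx expr1z.
rewrite acoef_alpha -val_eqE /= (gtn_eqF (ltn_ord i)) expr0z mulr1 big1 ?mulr1 // => j ij.
by rewrite acoef_alpha -val_eqE /= val_eqE (negbTE ij) expr0z.
Qed.

Lemma fcoef_addl_word x l y :
  fcoef form x y = (\prod_(i <- l) omchar y i) * fcoef form (x + Qval (wdeg l)) y.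
Proof.
rewrite -wdegE; elim: l => [|i l ih]; first by rewrite !big_nil addr0 mul1r.
rewrite !big_cons [alpha i + _]addrC addrA fcoef_addl mulrACA mulfV ?omchar_neq0 //.
by rewrite mul1r -ih.
Qed.

End Bicharacter.

(** * Weights in category O *)

Section LocallyFinite.
Variables (K : fieldType) (T : choiceType) (V W : lmodType K) (L : T -> V -> W).
Local Open Scope classical_set_scope.
Hypothesis L_lin : forall z, linear (L z).
Hypothesis L_fin : forall t, finite_set [set z | L z t != 0].

(** Finiteness is pointwise: the relevant indices may depend on the vector, as happens for Theta. *)
Lemma linear_fsum : linear (fun t => \sum_(z \in [set: T]) L z t).
Proof.
move=> a x y; have hl : linear (fun w : W => a *: w).
  by move=> b w w'; rewrite scalerDr !scalerA mulrC.
rewrite (lin_fsum hl) // -fsumD //; first by apply: eq_fsbigr => z _; rewrite L_lin.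
by apply: sub_finite_set (L_fin x) => z /=; apply: contraNN => /eqP ->; rewrite scaler0.
Qed.

End LocallyFinite.

Lemma fin_support_add (T : choiceType) (V : zmodType) (F G : T -> V) :
  finite_set [set z | F z != 0]%classic -> finite_set [set z | G z != 0]%classic ->
  finite_set [set z | F z + G z != 0]%classic.
Proof.
move=> hF hG.
apply: (@sub_finite_set _ _ ([set z | F z != 0] `|` [set z | G z != 0])%classic).
  by move=> z /=; case: (eqVneq (F z) 0) => [->|]; [rewrite add0r; right|left].
by rewrite finite_setU.
Qed.

Section Modules.
Variables (K : fieldType) (m : nat) (r s : K).
Hypotheses (r0 : r != 0) (s0 : s != 0).

Local Notation U := (Ugl m r s).
Local Notation ue := (@ue K m r s).
Local Notation uf := (@uf K m r s).
Local Notation ua := (@ua K m r s).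
Local Notation ub := (@ub K m r s).
Local Notation om := (@om K m r s).
Local Notation om' := (@om' K m r s).
Local Notation Uplus := (@Uplus K m r s).
Local Notation Uminus := (@Uminus K m r s).
Local Notation eword := (@eword K m r s).
Local Notation fword := (@fword K m r s).
Local Notation omword := (@omword K m r s).
Local Notation omchar := (@omchar K m r s).
Local Notation omchar' := (@omchar' K m r s).
Implicit Types (M N : amodule U).

Lemma act_linearr M (x : U) : linear (act x : M -> M).
Proof. by move=> c w w'; apply: act_linr. Qed.

Lemma act_linearl M (w : M) : linear (fun x : U => act x w).
Proof. by move=> c x x'; apply: act_linl. Qed.

Section Weights.
Variable M : amodule U.
Implicit Types (w : M) (x : Lat m).

Lemma wt0 x : wt_space x (0 : M).
Proof. by move=> i; rewrite !(lin0 (act_linearr _)) !scaler0. Qed.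

Lemma wtD x w w' : wt_space x w -> wt_space x w' -> wt_space x (w + w').
Proof.
move=> h h' i; have [a b] := h i; have [a' b'] := h' i.
by rewrite !(linD (act_linearr _)) a a' b b' !scalerDr.
Qed.

Lemma wtZ x c w : wt_space x w -> wt_space x (c *: w).
Proof.
move=> h i; have [a b] := h i.
by rewrite !(linZ (act_linearr _)) a b !scalerA ![c * _]mulrC.
Qed.

Lemma wt_om x w j : wt_space x w -> act (om j false) w = omchar x j *: w.
Proof.
move=> h; have [a _] := h (lo j); have [_ b] := h (hi j).
by rewrite /Defs.om actM b (linZ (act_linearr _)) a scalerA mulrC.
Qed.

Lemma wt_om' x w j : wt_space x w -> act (om' j false) w = omchar' x j *: w.
Proof.
move=> h; have [a _] := h (hi j); have [_ b] := h (lo j).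
by rewrite /Defs.om' actM b (linZ (act_linearr _)) a scalerA mulrC.
Qed.

Lemma wt_omword x w l : wt_space x w ->
  act (omword l) w = (\prod_(i <- l) omchar x i) *: w.
Proof.
move=> h; elim: l => [|i l ih]; first by rewrite /omword !big_nil act1 scale1r.
rewrite omword_cons actM ih (linZ (act_linearr _)) (wt_om _ h) scalerA big_cons.
by rewrite mulrC.
Qed.

Lemma innerBr k (x y : Lat m) : inner (eps k) (x - y) = inner (eps k) x - inner (eps k) y.
Proof. by rewrite !innerE !ffunE. Qed.

Lemma wt_e x w j : wt_space x w -> wt_space (x + alpha j) (act (ue j) w).
Proof.
move=> h i; have [a b] := h i.
rewrite -!actM ua_e ub_e !(linZ (act_linearl _)) !actM a b !(linZ (act_linearr _)).
by rewrite !scalerA innerDr -!expfzDr // ![inner _ (alpha j) + _]addrC.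
Qed.

Lemma wt_f x w j : wt_space x w -> wt_space (x - alpha j) (act (uf j) w).
Proof.
move=> h i; have [a b] := h i.
rewrite -!actM ua_f ub_f !(linZ (act_linearl _)) !actM a b !(linZ (act_linearr _)).
by rewrite !scalerA innerBr -!expfzDr // ![- inner _ (alpha j) + _]addrC.
Qed.

Lemma wt_Uplus x w z X : wt_space x w -> Uplus z X -> wt_space (x + Qval z) (act X w).
Proof.
move=> h /UplusP; move: X; apply: lspan_ind => [|c X Y [l hl ->] hY].
  by rewrite (lin0 (act_linearl _)); apply: wt0.
rewrite (linD (act_linearl _)) (linZ (act_linearl _)).
apply: wtD => //; apply: wtZ; rewrite -{}hl -wdegE {hY}.
elim: l => [|i l ih]; first by rewrite /eword !big_nil act1 addr0.
by rewrite eword_cons actM big_cons addrA addrAC; apply: wt_e.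
Qed.

Lemma wt_Uminus x w z X : wt_space x w -> Uminus z X -> wt_space (x - Qval z) (act X w).
Proof.
move=> h /UminusP; move: X; apply: lspan_ind => [|c X Y [l hl ->] hY].
  by rewrite (lin0 (act_linearl _)); apply: wt0.
rewrite (linD (act_linearl _)) (linZ (act_linearl _)).
apply: wtD => //; apply: wtZ; rewrite -{}hl -wdegE {hY}.
elim: l => [|i l ih]; first by rewrite /fword !big_nil act1 subr0.
by rewrite fword_cons actM big_cons opprD addrA addrAC; apply: wt_f.
Qed.

Local Open Scope classical_set_scope.
Hypothesis hM : catO M.

Lemma wt_compP w : wt_dec w (wt_comp w).
Proof.
have [c [hc _]] := catO_sum hM w.
exact: (@xgetI _ (fun=> 0) [set c | wt_dec w c] c hc).
Qed.

Lemma wt_comp_uniq w c : wt_dec w c -> wt_comp w = c.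
Proof.
have [c0 [h0 hu]] := catO_sum hM w.
by move=> /hu <-; rewrite -(hu _ (wt_compP w)).
Qed.

Lemma wt_comp_wt w x : wt_space x (wt_comp w x).
Proof. by case: (wt_compP w). Qed.

Lemma wt_comp_fin w : finite_set [set x | wt_comp w x != 0].
Proof. by case: (wt_compP w). Qed.

Lemma wt_comp_sum w : w = \sum_(x \in [set: Lat m]) wt_comp w x.
Proof. by case: (wt_compP w). Qed.

(** By uniqueness of weight decompositions it suffices that the componentwise combination is one. *)
Lemma wt_comp_linear x : linear (fun w => wt_comp w x).
Proof.
move=> a w w'; rewrite (@wt_comp_uniq _ (fun x => a *: wt_comp w x + wt_comp w' x)) //.
have hl : linear (fun w : M => a *: w).
  by move=> b t t'; rewrite scalerDr !scalerA mulrC.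
have fa : finite_set [set x | a *: wt_comp w x != 0].
  apply: sub_finite_set (wt_comp_fin w) => y /=.
  by apply: contraNN => /eqP ->; rewrite scaler0.
split=> [y||].
- by apply: wtD; [apply: wtZ|]; apply: wt_comp_wt.
- by apply: fin_support_add => //; apply: wt_comp_fin.
- rewrite {1}[w]wt_comp_sum {1}[w']wt_comp_sum (lin_fsum hl) ?fsumD //; exact: wt_comp_fin.
Qed.

Lemma wt_comp_pure x w : wt_space x w -> wt_comp w = (fun y => if y == x then w else 0).
Proof.
move=> hw; apply: wt_comp_uniq; split.
- by move=> y; case: eqP => [->|_] //; apply: wt0.
- apply: (@sub_finite_set _ _ [set x]); last exact: finite_set1.
  by move=> y /=; case: (eqVneq y x) => // _; rewrite eqxx.
- by rewrite (@fsum1 _ _ _ x) /= ?eqxx // => y /negbTE ->.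
Qed.

Lemma catO_ind (P : M -> Prop) : P 0 -> (forall w w', P w -> P w' -> P (w + w')) ->
  (forall x w, wt_space x w -> P w) -> forall w, P w.
Proof.
move=> P0 PD Pw w; rewrite [w]wt_comp_sum; apply: fsum_closed => // x.
exact/Pw/wt_comp_wt.
Qed.

Lemma Qplus_bounded_finite (b : Qplus m) : finite_set [set z : Qplus m | forall j, (z j <= b j)%N].
Proof.
pose B := (\sum_j b j)%N.
have hB j : (b j <= B)%N by rewrite /B (bigD1 j) //= leq_addr.
pose h (g : {ffun 'I_m -> 'I_B.+1}) : Qplus m := [ffun j => val (g j)].
apply: (@sub_finite_set _ _ (h @` [set: {ffun 'I_m -> 'I_B.+1}])); last first.
  exact/finite_image/finite_finset.
move=> z /= hz; exists [ffun j => inord (z j)] => //.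
by apply/ffunP => j; rewrite !ffunE /= inordK // ltnS (leq_trans (hz j)).
Qed.

(* Category O bounds the weights from above, so raising by large degrees kills
   every vector. *)
Lemma Uplus_locally_finite w :
  finite_set [set z | exists2 X, Uplus z X & act X w != 0].
Proof.
move: w; apply: catO_ind => [|w w' hw hw'|x w hw].
- apply: (@sub_finite_set _ _ set0) => // z [X _].
  by rewrite (lin0 (act_linearr _)) eqxx.
- apply: (@sub_finite_set _ _ ([set z | exists2 X, Uplus z X & act X w != 0]
      `|` [set z | exists2 X, Uplus z X & act X w' != 0])).
    move=> z /= [X hX h]; case: (eqVneq (act X w) 0) => e; [right|left]; exists X => //.
    by apply: contraNN h => /eqP e'; rewrite (linD (act_linearr _)) e e' addr0.
  by rewrite finite_setU.
have [F hF] := catO_bound hM.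
apply: (@sub_finite_set _ _ (\bigcup_(y in [set` F]) [set z | Qpos (y - (x + Qval z))])).
  move=> z /= [X hX h]; have [|y yF hy] := hF (x + Qval z); last by exists y.
  by exists (act X w) => //; apply: wt_Uplus.
apply: bigcup_finite => [|y _]; first exact: finite_seq.
(* If some z0 satisfies y - (x + z0) = b0 with b0 in Q^+, then every other such z satisfies z + b =
   z0 + b0 with b in Q^+. Hence z is bounded coordinatewise by z0 + b0. *)
case: (pselect (exists z, Qpos (y - (x + Qval z)))) => [[z0 [b0 _ hb0]]|hn]; last first.
  by apply: (@sub_finite_set _ _ set0) => // z hz; case: hn; exists z.
apply: sub_finite_set (Qplus_bounded_finite (qadd z0 b0)) => z /= [b _ hb] j.
have /ffunP/(_ j) : qadd z b = qadd z0 b0.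
  have e a : a + (y - (x + a)) = y - x by rewrite [x + a]addrC opprD addrCA addNKr.
  by apply: Qval_inj; rewrite !QvalD hb hb0 !e.
by rewrite !ffunE => <-; rewrite leq_addr.
Qed.

End Weights.

Lemma tensor_wt_ind M N (P : tensor M N -> Prop) : catO M -> catO N ->
  P 0 -> (forall t t', P t -> P t' -> P (t + t')) ->
  (forall x y w w', wt_space x w -> wt_space y w' -> P (w (x) w')) -> forall t, P t.
Proof.
move=> hM hN P0 PD Pw; apply: tensor_ind => // w w'; move: w.
apply: (catO_ind hM) => [|w1 w2 h1 h2|x w hw].
- by rewrite tp0l.
- by rewrite tpDl; apply: PD.
move: w'; apply: (catO_ind hN) => [|w1 w2 h1 h2|y w' hw'].
- by rewrite tp0r.
- by rewrite tpDr; apply: PD.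
exact: Pw hw hw'.
Qed.

(** As a lift in the element of U (x) U, it lets Delta(X) act without a choice of Sweedler terms. *)
Definition tact M N (T : tensor U U) (t : tensor M N) : tensor M N :=
  tlift (fun x y => tmap (act x) (act y) t) T.
Arguments tact {M N}.

Lemma tact_bilin M N (t : tensor M N) : bilin (fun x y => tmap (act x) (act y) t).
Proof.
apply: linear_bilin => [y|x] a X X'; elim/tensor_ind: t => [|t t' h h'|w w'].
- by rewrite !(lin0 (tmap_linear (act_linearr _) (act_linearr _))) scaler0 addr0.
- by rewrite !(linD (tmap_linear (act_linearr _) (act_linearr _))) h h' scalerDr addrACA.
- by rewrite !(tmapE _ _ (act_linearr _) (act_linearr _)) act_linl tpDl tpZl.
- by rewrite !(lin0 (tmap_linear (act_linearr _) (act_linearr _))) scaler0 addr0.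
- by rewrite !(linD (tmap_linear (act_linearr _) (act_linearr _))) h h' scalerDr addrACA.
- by rewrite !(tmapE _ _ (act_linearr _) (act_linearr _)) act_linl tpDr tpZr.
Qed.

Lemma tact_linearl M N (t : tensor M N) : linear (tact ^~ t).
Proof. exact/tlift_linear/tact_bilin. Qed.

Lemma tact_pure M N x y (w : M) (w' : N) :
  tact (x (x) y) (w (x) w') = act x w (x) act y w'.
Proof. by rewrite /tact (tlift_pure (tact_bilin _)) (tmapE _ _ (act_linearr _) (act_linearr _)). Qed.

Lemma tact_linearr M N T : linear (@tact M N T).
Proof.
move=> a t t'; elim/tensor_ind: T => [|T T' h h'|x y].
- by rewrite !(lin0 (tact_linearl _)) scaler0 addr0.
- by rewrite !(linD (tact_linearl _)) h h' scalerDr addrACA.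
- rewrite /tact !(tlift_pure (tact_bilin _)).
  exact: (tmap_linear (act_linearr _) (act_linearr _)).
Qed.

Lemma tactM M N T T' (t : tensor M N) : tact (T * T') t = tact T (tact T' t).
Proof.
elim/tensor_ind: T => [|T1 T2 h h'|x y].
- by rewrite mul0r !(lin0 (tact_linearl _)).
- by rewrite mulrDl !(linD (tact_linearl _)) h h'.
elim/tensor_ind: T' => [|T1 T2 h h'|x' y'].
- by rewrite mulr0 !(lin0 (tact_linearl _)) (lin0 (tact_linearr _)).
- by rewrite mulrDr !(linD (tact_linearl _)) h h' (linD (tact_linearr _)).
elim/tensor_ind: t => [|t1 t2 h h'|w w'].
- by rewrite !(lin0 (tact_linearr _)).
- by rewrite !(linD (tact_linearr _)) h h'.
by rewrite [_ * _]tmul_pp !tact_pure !actM.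
Qed.

Lemma tact1 M N (t : tensor M N) : tact 1 t = t.
Proof.
elim/tensor_ind: t => [|t1 t2 h h'|w w'].
- by rewrite !(lin0 (tact_linearr _)).
- by rewrite !(linD (tact_linearr _)) h h'.
by rewrite [X in tact X _](_ : _ = 1 (x) 1) // tact_pure !act1.
Qed.

End Modules.

(** * The R-matrix and the hexagon *)

Section RMatrix.
Variables (K : fieldType) (m : nat) (r s : K).
Hypotheses (r0 : r != 0) (s0 : s != 0).

Local Notation U := (Ugl m r s).
Local Notation ue := (@ue K m r s).
Local Notation uf := (@uf K m r s).
Local Notation om := (@om K m r s).
Local Notation om' := (@om' K m r s).
Local Notation Uplus := (@Uplus K m r s).
Local Notation Uminus := (@Uminus K m r s).
Local Notation eword := (@eword K m r s).
Local Notation omchar := (@omchar K m r s).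
Local Notation omchar' := (@omchar' K m r s).
Implicit Types (M N A B C : amodule U).

Variables (form : U -> U -> K) (d : Qplus m -> nat).
Variables (u v : forall z : Qplus m, 'I_(d z) -> U).
Hypotheses (hform : hopf_pairing form) (huv : dual_bases form u v).

Local Notation Th N' N := (@Theta K m r s d u v N' N).
Local Notation Ft N' N := (@ftilde K m r s form N' N).
Local Notation Rm N N' := (@Rmat K m r s form d u v N N').
Local Notation tact := (@tact K m r s _ _).

Definition Theta_deg z N' N : tensor N' N -> tensor N' N :=
  tlift (fun w' w => \sum_(k < d z) act (v k) w' (x) act (u k) w).
Arguments Theta_deg z {N' N}.

Lemma Theta_deg_bilin z N' N :
  bilin (fun (w' : N') (w : N) => \sum_(k < d z) act (v k) w' (x) act (u k) w).
Proof.
apply: linear_bilin => [w|w'] a x x'; rewrite scaler_sumr -big_split;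
  apply: eq_bigr => k _; first by rewrite act_linearr tpDl tpZl.
by rewrite act_linearr tpDr tpZr.
Qed.

Lemma Theta_deg_linear z N' N : linear (@Theta_deg z N' N).
Proof. exact/tlift_linear/Theta_deg_bilin. Qed.

Lemma Theta_deg_pure z N' N (w' : N') (w : N) :
  Theta_deg z (w' (x) w) = \sum_(k < d z) act (v k) w' (x) act (u k) w.
Proof. exact/tlift_pure/Theta_deg_bilin. Qed.

(** A single list of degrees controls Theta on w' (x) w for all w' at once, since the U^+ leg acts
    on w. *)
Definition raises_within N (S : seq (Qplus m)) (w : N) :=
  forall z X, z \notin S -> Uplus z X -> act X w = 0.

Lemma ex_raises_within N (w : N) : catO N -> exists2 S, uniq S & raises_within S w.
Proof.
move=> hN; have [S uS hS] := fin_seq (Uplus_locally_finite r0 s0 hN w).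
exists S => // z X zS hX; apply/eqP; case: eqP => // /eqP h.
by move/negP: zS; case; apply: hS; exists X.
Qed.

Lemma Theta_deg_within S z N' N (w' : N') (w : N) : raises_within S w -> z \notin S ->
  Theta_deg z (w' (x) w) = 0.
Proof.
move=> hS zS; rewrite Theta_deg_pure big1 // => k _.
by rewrite (hS z) ?tp0r //; apply: (Uplus_u huv).
Qed.

Local Open Scope classical_set_scope.

Lemma fin_within (V : lmodType K) (S : seq (Qplus m)) (F : Qplus m -> V) :
  (forall z, z \notin S -> F z = 0) -> finite_set [set z | F z != 0].
Proof.
move=> h; apply: (@sub_finite_set _ _ [set` S]); last exact: finite_seq.
by move=> z /= hz; apply/negPn/negP => /h e; rewrite e eqxx in hz.
Qed.

Lemma fin_fam_tensor (N' N : lmodType K) (V : lmodType K) (L : Qplus m -> tensor N' N -> V) :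
  (forall z, linear (L z)) -> (forall w' w, finite_set [set z | L z (w' (x) w) != 0]) ->
  forall t, finite_set [set z | L z t != 0].
Proof.
move=> hL hp; apply: tensor_ind => [|t t' h h'|w' w] //.
  by apply: (@sub_finite_set _ _ set0) => // z; rewrite /= (lin0 (hL z)) eqxx.
have -> : [set z | L z (t + t') != 0] = [set z | L z t + L z t' != 0].
  by apply/seteqP; split=> z; rewrite /= (linD (hL z)).
exact: fin_support_add.
Qed.

Lemma Theta_deg_fin N' N : catO N -> forall t : tensor N' N,
  finite_set [set z | Theta_deg z t != 0].
Proof.
move=> hN; apply: fin_fam_tensor => [z|w' w]; first exact: Theta_deg_linear.
have [S _ hS] := ex_raises_within w hN.
by apply: (@fin_within _ S) => z; apply: Theta_deg_within.
Qed.

(** [Theta] sums over degrees inside the lift. Taking the sum outside uses local finiteness twice: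
    for the bilinearity of the lifted function and for the additivity of the outer sum. *)
Lemma Theta_sum N' N : catO N -> forall t : tensor N' N,
  Th N' N t = \sum_(z \in [set: Qplus m]) Theta_deg z t.
Proof.
move=> hN; have hb : bilin (fun (w' : N') (w : N) => \sum_(z \in [set: Qplus m])
    \sum_(k < d z) act (v k) w' (x) act (u k) w).
  apply: linear_bilin => [w|w'].
    apply: (@linear_fsum K (Qplus m) N' (tensor N' N)
      (fun z w' => \sum_(k < d z) act (v k) w' (x) act (u k) w)) => [z|w'].
      move=> a x x'; case: (Theta_deg_bilin z N' N) => hDl _ hZl _.
      by rewrite hDl hZl.
    have h := Theta_deg_fin hN (w' (x) w).
    by apply: sub_finite_set h => z /=; rewrite Theta_deg_pure.
  apply: (@linear_fsum K (Qplus m) N (tensor N' N)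
    (fun z w => \sum_(k < d z) act (v k) w' (x) act (u k) w)) => [z|w].
    move=> a x x'; case: (Theta_deg_bilin z N' N) => _ hDr _ hZr.
    by rewrite hDr hZr.
  have h := Theta_deg_fin hN (w' (x) w).
  by apply: sub_finite_set h => z /=; rewrite Theta_deg_pure.
apply: tensor_linear_eq => [||w' w].
- exact: tlift_linear.
- by apply: linear_fsum => [z|t]; [apply: Theta_deg_linear | apply: Theta_deg_fin].
- by rewrite [LHS](tlift_pure hb); apply: eq_fsbigr => z _; rewrite Theta_deg_pure.
Qed.

Lemma Theta_linear N' N : catO N -> linear (Th N' N).
Proof.
move=> hN a t t'; rewrite !Theta_sum //.
apply: (linear_fsum (L := fun z t => Theta_deg z t)) => [z|]; first exact: Theta_deg_linear.
exact: Theta_deg_fin.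
Qed.

Lemma Theta_within S N' N (w' : N') (w : N) : catO N -> uniq S -> raises_within S w ->
  Th N' N (w' (x) w) = \sum_(z <- S) \sum_(k < d z) act (v k) w' (x) act (u k) w.
Proof.
move=> hN uS hS; rewrite Theta_sum // (fsum_seq uS).
  by apply: eq_bigr => z _; rewrite Theta_deg_pure.
by move=> z; apply: Theta_deg_within.
Qed.

Lemma ftilde_bilin N' N : catO N' -> catO N ->
  bilin (fun (w' : N') (w : N) => \sum_(x \in [set: Lat m]) \sum_(y \in [set: Lat m])
    fcoef form x y *: (wt_comp w' x (x) wt_comp w y)).
Proof.
move=> hN' hN.
have hlin x y (w : N) : linear (fun w' : N' => fcoef form x y *: (wt_comp w' x (x) wt_comp w y)).
  by move=> a t t'; rewrite (wt_comp_linear hN') tpDl tpZl scalerDr !scalerA mulrC.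
have hlin' x y (w' : N') : linear (fun w : N => fcoef form x y *: (wt_comp w' x (x) wt_comp w y)).
  by move=> a t t'; rewrite (wt_comp_linear hN) tpDr tpZr scalerDr !scalerA mulrC.
have fin' x (w' : N') (w : N) :
    finite_set [set y | fcoef form x y *: (wt_comp w' x (x) wt_comp w y) != 0].
  apply: sub_finite_set (wt_comp_fin hN w) => y /=.
  by apply: contraNN => /eqP ->; rewrite tp0r scaler0.
have fin (w' : N') (w : N) : finite_set [set x | \sum_(y \in [set: Lat m])
    fcoef form x y *: (wt_comp w' x (x) wt_comp w y) != 0].
  apply: sub_finite_set (wt_comp_fin hN' w') => x /=.
  apply: contraNN => /eqP e; rewrite fsbig1 // => y _.
  by rewrite e tp0l scaler0.
apply: linear_bilin => [w|w'].
  apply: (linear_fsum (L := fun x w' => \sum_(y \in [set: Lat m])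
    fcoef form x y *: (wt_comp w' x (x) wt_comp w y))) => // x.
  exact: (linear_fsum (L := fun y w' => fcoef form x y *: (wt_comp w' x (x) wt_comp w y))).
apply: (linear_fsum (L := fun x w => \sum_(y \in [set: Lat m])
  fcoef form x y *: (wt_comp w' x (x) wt_comp w y))) => // x.
exact: (linear_fsum (L := fun y w => fcoef form x y *: (wt_comp w' x (x) wt_comp w y))).
Qed.

Lemma ftilde_linear N' N : catO N' -> catO N -> linear (Ft N' N).
Proof. by move=> hN' hN; apply/tlift_linear/ftilde_bilin. Qed.

Lemma ftilde_pure N' N x y (w' : N') (w : N) : catO N' -> catO N ->
  wt_space x w' -> wt_space y w -> Ft N' N (w' (x) w) = fcoef form x y *: (w' (x) w).
Proof.
move=> hN' hN hw' hw; rewrite /ftilde (tlift_pure (ftilde_bilin hN' hN)).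
rewrite (wt_comp_pure hN' hw') (wt_comp_pure hN hw).
rewrite (@fsum1 _ _ _ x) => [|x' /negbTE x'x]; last first.
  by rewrite fsbig1 // => y' _; rewrite x'x tp0l scaler0.
rewrite (@fsum1 _ _ _ y) => [|y' /negbTE y'y]; last by rewrite y'y tp0r scaler0.
by rewrite !eqxx.
Qed.

Lemma Rmat_linear N N' : catO N -> catO N' -> linear (Rm N N').
Proof.
move=> hN hN' a t t'; rewrite /Rmat tflip_linear ftilde_linear //.
exact: Theta_linear.
Qed.

Lemma Rmat_pure N N' x y (w : N) (w' : N') : catO N -> catO N' ->
  wt_space x w -> wt_space y w' ->
  Rm N N' (w (x) w') = fcoef form y x *: Th N' N (w' (x) w).
Proof.
move=> hN hN' hw hw'.
by rewrite /Rmat tflip_pure (ftilde_pure hN' hN hw' hw) (linZ (Theta_linear hN)).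
Qed.

(** * Commutation of R with the coproduct of U^+ *)

Lemma Delta_e_tact N N' i (w : N) (w' : N') :
  tact (Delta (ue i)) (w (x) w') = act (ue i) w (x) w' + act (om i false) w (x) act (ue i) w'.
Proof. by rewrite Delta_e // (linD (tact_linearl _)) !tact_pure act1. Qed.

(* Commutators [[e_i, v_k]] lower the degree by [alpha_i], so the failure of
   each [Theta_deg z] to intertwine is cancelled by that of a neighbouring degree. *)
Lemma Theta_e N' N i (w' : N') (w : N) : catO N ->
  tact (Delta (ue i)) (Th N' N (w' (x) w)) =
  Th N' N (act (om' i false) w' (x) act (ue i) w) + Th N' N (act (ue i) w' (x) w).
Proof.
move=> hN; have [S uS hS] := ex_raises_within w hN.
(* The part of Delta(e_i) Theta_z that is not Theta_z (e_i (x) 1): [Acom] comes from e_i (x) 1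
   through the commutators, and [Bz] from omega_i (x) e_i. *)
pose Acom z := \sum_(k < d z)
  (act (ue i) (act (v k) w') - act (v k) (act (ue i) w')) (x) act (u k) w.
pose Bz z := \sum_(k < d z)
  act (om i false) (act (v k) w') (x) act (ue i) (act (u k) w).
have fA : finite_set [set z | Acom z != 0].
  apply: (@fin_within _ S) => z zS; rewrite /Acom big1 // => k _.
  by rewrite (hS z) ?tp0r //; apply: (Uplus_u huv).
have fB : finite_set [set z | Bz z != 0].
  apply: (@fin_within _ S) => z zS; rewrite /Bz big1 // => k _.
  by rewrite (hS z) ?(lin0 (act_linearr _)) ?tp0r //; apply: (Uplus_u huv).
(* The commutator formula writes [Acom] in degree z + alpha_i over the dual basis of degree z.
   Moving the scalars to the right leg reassembles u_l e_i and e_i u_l: the first sum is Theta_z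
   (omega_i' (x) e_i), and the second, with its minus sign, cancels [Bz z]. *)
have shift z : Acom (qadd (qroot i) z) + Bz z = Theta_deg z (act (om' i false) w' (x) act (ue i) w).
  have e k : act (ue i) (act (v (z := qadd (qroot i) z) k) w') - act (v k) (act (ue i) w') =
      \sum_l form (v k) (u (z := z) l * ue i) *: act (v l) (act (om' i false) w')
      - \sum_l form (v k) (ue i * u (z := z) l) *: act (om i false) (act (v l) w').
    rewrite -!actM -(linN (act_linearl _)) -(linD (act_linearl _)).
    rewrite (commutator_Uminus r0 s0 hform huv (Uminus_v huv k)).
    rewrite mulr_suml mulr_sumr (linD (act_linearl _)) (linN (act_linearl _)).
    rewrite !(lin_sum (act_linearl _)); congr (_ - _); apply: eq_bigr => l _.
      by rewrite -scalerAl (linZ (act_linearl _)) actM.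
    by rewrite -scalerAr (linZ (act_linearl _)) actM.
  have eu (X : U) : Uplus (qadd (qroot i) z) X ->
      act X w = \sum_(k < d (qadd (qroot i) z)) form (v k) X *: act (u k) w.
    move=> hX; rewrite {1}(Uplus_expand hform huv hX) (lin_sum (act_linearl _)).
    by apply: eq_bigr => k _; rewrite (linZ (act_linearl _)).
  rewrite Theta_deg_pure /Acom; under eq_bigr => k _.
    rewrite e tpDl tpNl !tp_suml; under eq_bigr => l _ do rewrite tpZl -tpZr.
    under [X in _ - X]eq_bigr => l _ do rewrite tpZl -tpZr.
    over.
  rewrite sumrB exchange_big [X in _ - X + _]exchange_big /=.
  rewrite [X in _ - X + _](_ : _ = Bz z) ?subrK; last first.
    apply: eq_bigr => l _; rewrite -tp_sumr -eu ?actM //.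
    by apply: UplusM; [apply: Uplus_e | apply: (Uplus_u huv)].
  apply: eq_bigr => l _; rewrite -tp_sumr -eu ?actM //.
  by rewrite qaddC; apply: UplusM; [apply: (Uplus_u huv) | apply: Uplus_e].
have split z : tact (Delta (ue i)) (Theta_deg z (w' (x) w)) =
    (Acom z + Bz z) + Theta_deg z (act (ue i) w' (x) w).
  rewrite !Theta_deg_pure (lin_sum (tact_linearr _)) addrAC -!big_split.
  apply: eq_bigr => k _ /=; rewrite Delta_e_tact; congr (_ + _).
  by rewrite -tpDl subrK.
(* Reindexing by z -> z + alpha_i omits only degrees with z_i = 0, where e_i commutes with all the
   v_k. *)
have sumA : \sum_(z \in [set: Qplus m]) Acom z =
    \sum_(z \in [set: Qplus m]) Acom (qadd (qroot i) z).
  rewrite -(@fsbig_image _ _ _ _ _ [set: Qplus m] (qadd (qroot i)) Acom); last first.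
    by move=> z z' _ _; apply: qaddI.
  apply/esym/fsbig_widen => // z [_ hz] /=.
  have zi : z i = 0%N.
    by apply/eqP; case: eqP => // /eqP /qsub_root[y hy]; case: hz; exists y.
  rewrite /Acom big1 // => k _; rewrite -!actM.
  by rewrite (commutator_Uminus0 r0 s0 zi (Uminus_v huv k)) subrr tp0l.
rewrite !Theta_sum // (lin_fsum (tact_linearr _)); last exact: Theta_deg_fin.
under eq_fsbigr => z _ do rewrite split.
rewrite fsumD; [|exact: fin_support_add|exact: Theta_deg_fin].
rewrite fsumD // sumA -fsumD //.
  by congr (_ + _); apply: eq_fsbigr => z _.
have -> : [set z | Acom (qadd (qroot i) z) != 0] = qadd (qroot i) @^-1` [set z | Acom z != 0] by [].
by apply: finite_preimage => // z z' _ _; apply: qaddI.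
Qed.

(** By [Theta_e], Delta(e_i) Theta = Theta (omega_i' (x) e_i + e_i (x) 1), whereas flipping
    Delta(e_i) gives e_i (x) omega_i + 1 (x) e_i. The shifts of f account for the difference: one
    supplies omega_i' on w', the other cancels omega_i on w. *)
Lemma Rmat_e N N' i : catO N -> catO N' -> forall t : tensor N N',
  Rm N N' (tact (Delta (ue i)) t) = tact (Delta (ue i)) (Rm N N' t).
Proof.
move=> hN hN'; have hR := Rmat_linear hN hN'.
apply: (tensor_wt_ind hN hN') => [|t t' h h'|x y w w' hw hw'].
- by rewrite !(lin0 (tact_linearr _), lin0 hR).
- by rewrite !(linD (tact_linearr _), linD hR) h h'.
have hTh := Theta_linear hN.
rewrite Delta_e_tact (linD hR) (Rmat_pure hN hN' (wt_e r0 s0 i hw) hw').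
rewrite (wt_om _ hw) tpZl (linZ hR) (Rmat_pure hN hN' hw (wt_e r0 s0 i hw')).
rewrite (Rmat_pure hN hN' hw hw') (linZ (tact_linearr _)) Theta_e //.
rewrite (wt_om' _ hw') tpZl (linZ (hTh _)) scalerDr !scalerA.
rewrite (fcoef_addr r0 s0 hform) (fcoef_addl r0 s0 hform).
by rewrite mulrA mulfV ?omchar_neq0 // mul1r mulrC.
Qed.

Lemma Rmat_Uplus N N' z X : catO N -> catO N' -> Uplus z X -> forall t : tensor N N',
  Rm N N' (tact (Delta X) t) = tact (Delta X) (Rm N N' t).
Proof.
move=> hN hN' /UplusP hX t; have hR := Rmat_linear hN hN'.
have hD := @Delta_linear K m r s r0 s0.
move: X hX; apply: lspan_ind => [|c X Y [l _ ->] hY].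
  by rewrite (lin0 hD) !(lin0 (tact_linearl _)) (lin0 hR).
rewrite (linD hD) (linZ hD) !(linD (tact_linearl _)) !(linZ (tact_linearl _)).
rewrite (linD hR) (linZ hR) hY; congr (_ *: _ + _).
elim: l t {hY} => [|i l ih] t; first by rewrite /eword big_nil Delta1 // !tact1.
by rewrite eword_cons DeltaM // !tactM Rmat_e // ih.
Qed.

(** Since f(x, 0) = 1 and f is multiplicative in its second argument, f(x, -y) inverts f(x, y). *)
Lemma fcoef_neq0 x y : fcoef form x y != 0.
Proof.
have h := fcoefDr r0 s0 hform x y (- y).
apply/eqP => e; move: h; rewrite e mul0r subrr /fcoef => /eqP.
have [hg g1] := Gplus_om_lat r0 s0 x.
have a0 i : acoef (0 : Lat m) i = 0 by rewrite /acoef big1 // => k _; rewrite ffunE.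
rewrite (form_om'_lat r0 s0 hform) // a0 expr0z mulr1 big1 ?invr1 ?oner_eq0 // => j _.
by rewrite a0 expr0z.
Qed.

(** The legs of Delta(X) have varying degrees, so a common index set S is needed to compare terms.
    Degrees other than z contribute 0 by orthogonality, and X kills a when z lies outside S. *)
Lemma act_expand A z X S (a : A) : Uplus z X -> uniq S -> raises_within S a ->
  act X a = \sum_(g <- S) \sum_(k < d g) form (v k) X *: act (u k) a.
Proof.
move=> hX uS hS.
have h0 g : g != z -> \sum_(k < d g) form (v k) X *: act (u k) a = 0.
  move=> gz; rewrite big1 // => k _.
  by rewrite (form_deg_neq r0 s0 hform (Uminus_v huv k) hX gz) scale0r.
case: (boolP (z \in S)) => zS.
  rewrite (bigD1_seq z) //= [X in _ + X]big1 ?addr0 => [|g gz]; last exact: h0.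
  rewrite {1}(Uplus_expand hform huv hX) (lin_sum (act_linearl _)).
  by apply: eq_bigr => k _; rewrite (linZ (act_linearl _)).
rewrite (hS z) // big1_seq // => g /= gS; apply: h0.
by apply: contraNneq zS => <-.
Qed.

(* The coproduct of [U^+] is dual to the product of [U^-]; on the first factor
   the torus part of [Delta X] acts by scalars, which [f(nu, -)] absorbs as the
   shift of [nu] by the degree [e]. *)
Lemma tact_Uplus A B x nu z X S1 S2 (a : A) (b : B) : wt_space x a -> Uplus z X ->
  uniq S1 -> raises_within S1 a -> uniq S2 -> raises_within S2 b ->
  fcoef form nu x *: tact (Delta X) (a (x) b) =
  \sum_(g <- S1) \sum_(e <- S2) \sum_(i < d g) \sum_(j < d e)
    (fcoef form (nu - Qval e) x * form (v i * v j) X) *: (act (u i) a (x) act (u j) b).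
Proof.
move=> ha hX uS1 hS1 uS2 hS2.
have vB g (i : 'I_(d g)) := Uminus_Bminus (Uminus_v huv i).
have vvB g e (i : 'I_(d g)) (j : 'I_(d e)) : Bminus (v i * v j) := sub_mul (vB _ i) (vB _ j).
move: X hX; apply: Uplus_form_ind => [|c l X hl hX ih].
  rewrite (lin0 (@Delta_linear K m r s r0 s0)) (lin0 (tact_linearl _)) scaler0.
  rewrite big1 // => g _; rewrite big1 // => e _; rewrite big1 // => i _; rewrite big1 // => j _.
  by rewrite (pairing0r hform) ?mulr0 ?scale0r.
have hXB := Uplus_Bplus hX; have hlB := Bplus_eword r s l.
have hcB : Bplus (c *: eword l) := subalg_scale c hlB.
rewrite (linD (@Delta_linear K m r s r0 s0)) (linZ (@Delta_linear K m r s r0 s0)).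
rewrite (linD (tact_linearl _)) (linZ (tact_linearl _)) scalerDr ih {ih}.
have -> : fcoef form nu x *: (c *: tact (Delta (eword l)) (a (x) b)) =
  c *: (\sum_(g <- S1) \sum_(e <- S2) \sum_(i < d g) \sum_(j < d e)
    (fcoef form (nu - Qval e) x * form (v i * v j) (eword l))
      *: (act (u i) a (x) act (u j) b)); last first.
  rewrite !scaler_sumr -big_split; apply: eq_bigr => g _ /=.
  rewrite !scaler_sumr -big_split; apply: eq_bigr => e _ /=.
  rewrite !scaler_sumr -big_split; apply: eq_bigr => i _ /=.
  rewrite !scaler_sumr -big_split; apply: eq_bigr => j _ /=.
  rewrite (pairingDr hform) // (pairingZr hform) // mulrDr scalerDl scalerA.
  by rewrite mulrCA.
rewrite scalerA mulrC -scalerA; congr (_ *: _).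
have [W hW eW] := Delta_eword r0 s0 l.
(* The pairing of a product v_i v_j with a word is read off from the coproduct of the word; the
   torus word in the left leg is ignored by the pairing. *)
have hform_l g e (i : 'I_(d g)) (j : 'I_(d e)) : form (v i * v j) (eword l) =
    \sum_(p <- W) p.1 * (form (v i) (eword p.2.1) * form (v j) (eword p.2.2)).
  rewrite (hp_mull hform (w := [seq (p.1 *: (eword p.2.1 * omword r s p.2.2), eword p.2.2) | p <- W])) //.
  - rewrite big_map; apply: eq_bigr => p _ /=.
    rewrite (pairingZr hform) // ?(form_omword r0 s0 hform _ (Uminus_v huv i)) ?mulrA //;
      try exact: Bplus_eword.
    by apply: sub_mul; [apply: Bplus_eword | apply: Bplus_omword].
  - move=> _ /mapP[p _ ->] /=; split; last exact: Bplus_eword.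
    by apply/subalg_scale/sub_mul; [apply: Bplus_eword | apply: Bplus_omword].
  - by rewrite eW big_map; apply: eq_bigr => p _; rewrite tpZl.
(* The torus word of p acts on a by this product of characters, which turns f(nu, x) into f(nu - deg
   p, x). If e differs from deg p, both sides vanish by orthogonality. *)
have scal p e (j : 'I_(d e)) : fcoef form nu x * (\prod_(i <- p) omchar x i)
      * form (v j) (eword p) = fcoef form (nu - Qval e) x * form (v j) (eword p).
  case: (eqVneq e (wdeg p)) => [ep|ep].
    congr (_ * _); rewrite ep [in RHS](fcoef_addl_word r0 s0 hform _ p) subrK.
    by rewrite mulrC.
  by rewrite (form_deg_neq r0 s0 hform (Uminus_v huv j) (Uplus_word r s p) ep) !mulr0.
rewrite eW (lin_sum (tact_linearl _)) scaler_sumr.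
under [RHS]eq_bigr => g _.
  under eq_bigr => e _.
    under eq_bigr => i _.
      under eq_bigr => j _ do rewrite hform_l mulr_sumr scaler_suml.
      rewrite exchange_big /=. over.
    rewrite exchange_big /=. over.
  rewrite exchange_big /=. over.
rewrite exchange_big /=; apply: eq_bigr => p _.
rewrite (linZ (tact_linearl _)) tact_pure actM (wt_omword _ ha).
rewrite (linZ (act_linearr _)) tpZl (act_expand (Uplus_word r s p.2.1) uS1 hS1).
rewrite (act_expand (Uplus_word r s p.2.2) uS2 hS2) tp_suml !scaler_sumr.
apply: eq_bigr => g _; rewrite tp_sumr !scaler_sumr; apply: eq_bigr => e _.
rewrite tp_suml !scaler_sumr; apply: eq_bigr => i _.
rewrite tp_sumr !scaler_sumr; apply: eq_bigr => j _.
rewrite tpZl tpZr !scalerA; congr (_ *: _).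
have := scal p.2.2 e j; set f1 := fcoef _ nu x; set f2 := fcoef _ _ x.
set c1 := form _ _; set c2 := form _ _; set q := \prod_(_ <- _) _ => h.
have -> : f2 * (p.1 * (c2 * c1)) = p.1 * c2 * (f2 * c1) by ring.
by rewrite -h; ring.
Qed.

(* [(1 (x) Delta)(Theta)], acting on [C (x) (A (x) B)]. *)
Definition Theta_Delta_deg z A B C (c : C) (t : tensor A B) : tensor C (tensor A B) :=
  \sum_(k < d z) act (v k) c (x) tact (Delta (u k)) t.

Lemma Theta_Delta_deg_linear z A B C (c : C) : linear (@Theta_Delta_deg z A B C c).
Proof.
move=> a t t'; rewrite /Theta_Delta_deg scaler_sumr -big_split; apply: eq_bigr => k _ /=.
by rewrite tact_linearr tpDr tpZr.
Qed.

Definition Theta_Delta A B C (c : C) (t : tensor A B) : tensor C (tensor A B) :=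
  \sum_(z \in [set: Qplus m]) Theta_Delta_deg z c t.

Lemma Uminus_expand_act C z Z X (c : C) : Uminus z X -> uniq Z -> z \in Z ->
  \sum_(g <- Z) \sum_(k < d g) form X (u k) *: act (v k) c = act X c.
Proof.
move=> hX uZ zZ; rewrite (bigD1_seq z) //= [X in _ + X]big1 ?addr0 => [|g gz].
  rewrite {2}(Uminus_expand hform huv hX) (lin_sum (act_linearl _)).
  by apply: eq_bigr => k _; rewrite (linZ (act_linearl _)).
rewrite big1 // => k _; rewrite eq_sym in gz.
by rewrite (form_deg_neq r0 s0 hform hX (Uplus_u huv k) gz) scale0r.
Qed.

Definition degree_sums (S1 S2 : seq (Qplus m)) : seq (Qplus m) :=
  undup [seq qadd g e | g <- S1, e <- S2].

Lemma degree_sumsP S1 S2 g e : g \in S1 -> e \in S2 -> qadd g e \in degree_sums S1 S2.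
Proof. by move=> hg he; rewrite mem_undup; apply: allpairs_f. Qed.

Lemma Theta_Delta_deg_within A B C x z S1 S2 (a : A) (b : B) (c : C) : wt_space x a ->
  uniq S1 -> raises_within S1 a -> uniq S2 -> raises_within S2 b ->
  z \notin degree_sums S1 S2 -> Theta_Delta_deg z c (a (x) b) = 0.
Proof.
move=> ha uS1 hS1 uS2 hS2 hz; rewrite /Theta_Delta_deg big1 // => k _.
(* Any weight may stand for nu here, since the nonzero factor f(nu, x) is cancelled afterwards. *)
have := tact_Uplus (0 : Lat m) ha (Uplus_u huv k) uS1 hS1 uS2 hS2.
rewrite big1_seq => [/eqP|g /= gS].
  by rewrite scaler_eq0 (negbTE (fcoef_neq0 _ _)) => /eqP ->; rewrite tp0r.
rewrite big1_seq // => e /= eS; rewrite big1 // => i _; rewrite big1 // => j _.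
have hge : qadd g e != z by apply: contraNneq hz => <-; apply: degree_sumsP.
rewrite (form_deg_neq r0 s0 hform (UminusM (Uminus_v huv i) (Uminus_v huv j)) (Uplus_u huv k) hge).
by rewrite mulr0 scale0r.
Qed.

Lemma Theta_Delta_deg_fin A B C (c : C) : catO A -> catO B -> forall t : tensor A B,
  finite_set [set z | Theta_Delta_deg z c t != 0].
Proof.
move=> hA hB; apply: (tensor_wt_ind hA hB) => [|t t' h h'|x y a b ha hb].
- by apply: (@fin_within _ [::]) => z _; rewrite (lin0 (Theta_Delta_deg_linear _ _)).
- have e : [set z | Theta_Delta_deg z c (t + t') != 0] = [set z | Theta_Delta_deg z c t + Theta_Delta_deg z c t' != 0].
    by apply/seteqP; split=> z; rewrite /= (linD (Theta_Delta_deg_linear _ _)).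
  by rewrite e; apply: fin_support_add.
have [S1 uS1 hS1] := ex_raises_within a hA.
have [S2 uS2 hS2] := ex_raises_within b hB.
apply: (@fin_within _ (degree_sums S1 S2)) => z.
exact: Theta_Delta_deg_within ha uS1 hS1 uS2 hS2.
Qed.

Lemma Theta_Delta_linear A B C (c : C) : catO A -> catO B -> linear (@Theta_Delta A B C c).
Proof.
move=> hA hB; apply: (linear_fsum (L := fun z t => Theta_Delta_deg z c t)) => [z|].
  exact: Theta_Delta_deg_linear.
exact: Theta_Delta_deg_fin.
Qed.

(** * The hexagon identity and the Yang-Baxter equation *)

Local Notation R12' A B C := (@R12 K m r s form d u v A B C).
Local Notation R23' A B C := (@R23 K m r s form d u v A B C).

Lemma id_linear (V : lmodType K) : linear (@id V).
Proof. by []. Qed.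

Lemma R12_linear A B C : catO A -> catO B -> linear (R12' A B C).
Proof. by move=> hA hB; apply: tmap_linear; [apply: Rmat_linear | apply: id_linear]. Qed.

Arguments R12_linear {A B} C.

Lemma R23_linear A B C : catO B -> catO C -> linear (R23' A B C).
Proof.
move=> hB hC a t t'; rewrite /R23 tassoc_linear.
rewrite (tmap_linear (@id_linear _) (Rmat_linear hB hC)) tassocV_linear //.
Qed.

Arguments R23_linear A {B C}.

Lemma hexagon_pure A B C x y nu (a : A) (b : B) (c : C) :
  catO A -> catO B -> catO C ->
  wt_space x a -> wt_space y b -> wt_space nu c ->
  R12' A C B (R23' A B C ((a (x) b) (x) c)) =
  fcoef form nu (x + y) *: tassocV (Theta_Delta c (a (x) b)).
Proof.
move=> hA hB hC ha hb hc.
have [S1 uS1 hS1] := ex_raises_within a hA.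
have [S2 uS2 hS2] := ex_raises_within b hB.
have hV := @tassocV_linear K C A B.
(* The first braiding gives f(nu, y) and terms v_j c (x) u_j b. As v_j lowers the weight of c by its
   degree e, the second braiding contributes f(nu - e, x) rather than f(nu, x). *)
transitivity (fcoef form nu y *: \sum_(g <- S1) \sum_(e <- S2) \sum_(i < d g) \sum_(j < d e)
   fcoef form (nu - Qval e) x *: ((act (v i * v j) c (x) act (u i) a) (x) act (u j) b)).
  rewrite /R23 tassoc_pure (tmapE _ _ (@id_linear _) (Rmat_linear hB hC)).
  rewrite (Rmat_pure hB hC hb hc) tpZr !(linZ (@tassocV_linear _ _ _ _)).
  rewrite (linZ (R12_linear _ hA hC)); congr (_ *: _).
  rewrite (Theta_within _ hB uS2 hS2) tp_sumr (lin_sum (@tassocV_linear _ _ _ _)).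
  rewrite (lin_sum (R12_linear _ hA hC)) exchange_big; apply: eq_bigr => e _ /=.
  under [RHS]eq_bigr => g _ do rewrite exchange_big /=.
  rewrite [RHS]exchange_big tp_sumr (lin_sum (@tassocV_linear _ _ _ _)).
  rewrite (lin_sum (R12_linear _ hA hC)); apply: eq_bigr => j _ /=.
  rewrite tassocV_pure /R12 (tmapE _ _ (Rmat_linear hA hC) (@id_linear _)).
  rewrite (Rmat_pure hA hC ha (wt_Uminus r0 s0 hc (Uminus_v huv j))) tpZl.
  rewrite (Theta_within _ hA uS1 hS1) tp_suml scaler_sumr; apply: eq_bigr => g _.
  rewrite tp_suml scaler_sumr; apply: eq_bigr => i _.
  by rewrite actM.
rewrite (fcoefDr r0 s0 hform) [_ * fcoef form nu y]mulrC -scalerA; congr (_ *: _).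
rewrite -(linZ hV) /Theta_Delta (@fsum_seq _ _ _ (degree_sums S1 S2)); first last.
- by move=> z; apply: Theta_Delta_deg_within ha uS1 hS1 uS2 hS2.
- exact: undup_uniq.
rewrite scaler_sumr /Theta_Delta_deg.
(* [tact_Uplus] expands Delta(u_k) over pairs (u_i, u_j). The sums over z and k then move innermost,
   where the sum of (v_i v_j, u_k) v_k collapses to v_i v_j. *)
under [in RHS]eq_bigr => z _.
  rewrite scaler_sumr; under eq_bigr => k _.
    rewrite -tpZr (tact_Uplus nu ha (Uplus_u huv k) uS1 hS1 uS2 hS2) tp_sumr.
    over.
  rewrite exchange_big /=. over.
rewrite [in RHS]exchange_big (lin_sum hV); apply: eq_big_seq => g gS.
under [in RHS]eq_bigr => z _.
  under eq_bigr => k _ do rewrite tp_sumr.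
  rewrite exchange_big /=. over.
rewrite [in RHS]exchange_big (lin_sum hV); apply: eq_big_seq => e eS.
under [in RHS]eq_bigr => z _.
  under eq_bigr => k _ do rewrite tp_sumr.
  rewrite exchange_big /=. over.
rewrite [in RHS]exchange_big (lin_sum hV); apply: eq_bigr => i _.
under [in RHS]eq_bigr => z _.
  under eq_bigr => k _ do rewrite tp_sumr.
  rewrite exchange_big /=. over.
rewrite [in RHS]exchange_big (lin_sum hV); apply: eq_bigr => j _ /=.
under [in RHS]eq_bigr => z _.
  under eq_bigr => k _ do rewrite tpZr -scalerA -tpZl.
  rewrite -scaler_sumr -tp_suml. over.
rewrite -scaler_sumr -tp_suml.
rewrite (Uminus_expand_act _ (UminusM (Uminus_v huv i) (Uminus_v huv j))) ?undup_uniq ?degree_sumsP //.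
by rewrite (linZ hV) tassocV_pure.
Qed.

(** R sends a pure tensor to a sum of tensors whose factors have various weights. The scalar f(nu,
    -) of the hexagon sees only the total weight, so the hexagon extends to such sums. *)
Inductive total_wt A B (x : Lat m) : tensor A B -> Prop :=
| total_wt0 : total_wt x 0
| total_wtD t t' : total_wt x t -> total_wt x t' -> total_wt x (t + t')
| total_wt_pure y y' a b : wt_space y a -> wt_space y' b -> y + y' = x -> total_wt x (a (x) b).

(* The two braidings past [C] compose to the braiding of [A (x) B] past [C]. *)
Lemma hexagon A B C x nu (t : tensor A B) (c : C) : catO A -> catO B -> catO C ->
  total_wt x t -> wt_space nu c ->
  R12' A C B (R23' A B C (t (x) c)) = fcoef form nu x *: tassocV (Theta_Delta c t).
Proof.
move=> hA hB hC ht hc.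
have h1 := R12_linear B hA hC; have h2 := R23_linear A hB hC.
have hK := Theta_Delta_linear c hA hB; have hV := @tassocV_linear K C A B.
elim: ht => [|t1 t2 _ e1 _ e2|y y' a b ha hb <-].
- by rewrite tp0l (lin0 h2) (lin0 h1) (lin0 hK) (lin0 hV) scaler0.
- by rewrite tpDl (linD h2) (linD h1) e1 e2 (linD hK) (linD hV) scalerDr.
- exact: hexagon_pure.
Qed.

(** Each term of Theta_z lowers one factor by z and raises the other by z. *)
Lemma total_wt_Rmat A B x (t : tensor A B) : catO A -> catO B -> total_wt x t -> total_wt x (Rm A B t).
Proof.
move=> hA hB; elim=> [|t1 t2 _ e1 _ e2|y y' a b ha hb <-].
- by rewrite (lin0 (Rmat_linear hA hB)); apply: total_wt0.
- by rewrite (linD (Rmat_linear hA hB)); apply: total_wtD.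
have [S uS hS] := ex_raises_within a hA.
rewrite (Rmat_pure hA hB ha hb) (Theta_within _ hA uS hS) scaler_sumr.
elim/big_ind: _ => [|t1 t2|z _]; [exact: total_wt0 | exact: total_wtD | rewrite scaler_sumr].
elim/big_ind: _ => [|t1 t2|k _]; [exact: total_wt0 | exact: total_wtD | rewrite -tpZl].
apply: total_wt_pure (wtZ _ (wt_Uminus r0 s0 hb (Uminus_v huv k)))
  (wt_Uplus r0 s0 ha (Uplus_u huv k)) _.
by rewrite addrCA subrK.
Qed.

Lemma Theta_Delta_Rmat A B C (c : C) (t : tensor A B) : catO A -> catO B ->
  tmap id (Rm A B) (Theta_Delta c t) = Theta_Delta c (Rm A B t).
Proof.
move=> hA hB; have hR := Rmat_linear hA hB.
rewrite /Theta_Delta (lin_fsum (tmap_linear (@id_linear _) hR)); last exact: Theta_Delta_deg_fin.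
apply: eq_fsbigr => z _; rewrite /Theta_Delta_deg (lin_sum (tmap_linear (@id_linear _) hR)).
apply: eq_bigr => k _; rewrite (tmapE _ _ (@id_linear _) hR).
by rewrite (Rmat_Uplus hA hB (Uplus_u huv k)).
Qed.

(** The left side is the hexagon applied to R(a (x) b), the right side is R applied after the
    hexagon for a (x) b. Both carry the same scalar, as R preserves the total weight, and the
    remaining equality is the naturality [Theta_Delta_Rmat]. *)
Lemma yang_baxter A B C (t : tensor (tensor A B) C) : catO A -> catO B -> catO C ->
  R12' B C A (R23' B A C (R12' A B C t)) = R23' C A B (R12' A C B (R23' A B C t)).
Proof.
move=> hA hB hC.
have hl : linear (fun t => R12' B C A (R23' B A C (R12' A B C t))).
  move=> a x y; rewrite (R12_linear C hA hB) (R23_linear B hA hC).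
  exact: (R12_linear A hB hC).
have hr : linear (fun t => R23' C A B (R12' A C B (R23' A B C t))).
  move=> a x y; rewrite (R23_linear A hB hC) (R12_linear B hA hC).
  exact: (R23_linear C hA hB).
move: t; apply: (tensor_linear_eq hl hr) => t c; move: t.
apply: (tensor_wt_ind hA hB) => [|t t' h h'|x y a b ha hb].
- by rewrite tp0l (lin0 hl) (lin0 hr).
- by rewrite tpDl (linD hl) (linD hr) h h'.
move: c; apply: (catO_ind hC) => [|c c' h h'|nu c hc].
- by rewrite tp0r (lin0 hl) (lin0 hr).
- by rewrite tpDr (linD hl) (linD hr) h h'.
have ht : total_wt (x + y) (a (x) b) by apply: total_wt_pure ha hb _.
rewrite [R12' A B C _](tmapE _ _ (Rmat_linear hA hB) (@id_linear _)).
rewrite (hexagon hB hA hC (total_wt_Rmat hA hB ht) hc) (hexagon hA hB hC ht hc).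
(* The associator inside [R23] cancels the one produced by the hexagon, so R acts directly on the A
   (x) B component. *)
rewrite (linZ (R23_linear C hA hB)) /R23 tassocVK; congr (_ *: tassocV _).
by rewrite Theta_Delta_Rmat.
Qed.

End RMatrix.

(* n = m.+1, so that n >= 2 reads 0 < m. *)
Theorem theorem5p4 (K : closedFieldType) (m : nat) (hm : (0 < m)%N)
  (r s : K) (hr : r != 0) (hs : s != 0) (hrs : r != s)
  (form : Ugl m r s -> Ugl m r s -> K) (hform : hopf_pairing form)
  (d : Qplus m -> nat) (u v : forall z : Qplus m, 'I_(d z) -> Ugl m r s)
  (huv : dual_bases form u v)
  (M M' M'' : amodule (Ugl m r s))
  (hM : catO M) (hM' : catO M') (hM'' : catO M'') :
  forall t : tensor (tensor M M') M'',
    R12 form u v M' M'' M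
      (R23 form u v M' M M''
        (R12 form u v M M' M'' t))
    =
    R23 form u v M'' M M'
      (R12 form u v M M'' M'
        (R23 form u v M M' M'' t)).
Proof.
by move=> t; apply: (yang_baxter hr hs hform huv t hM hM' hM'').
Qed.
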